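(* Let $\mathcal{P}=He_1\oplus He_2$ be the free left $H$-module of rank two with basis $e_1,e_2$, equipped with an $H$-pseudoalgebra structure such that $$e_{1}\ast e_{1}=0, \quad e_{2}\ast e_{2}=(1\otimes s+t)\otimes_{H} e_{2}$$ for some $t\in\mathbf{k}$ and some nonzero $s\in\delta$ (and $e_1\ast e_2$, $e_2\ast e_1$ are arbitrary elements of $(H\otimes H)\otimes_H\mathcal{P}$). Then $\mathcal{P}$ is a left pre-Lie $H$-pseudoalgebra if and only if it is of one of the following types: (1) $e_{1}\ast e_{2}=0$, $e_{2}\ast e_{1}=0$; (2) $e_{1}\ast e_{2}=\alpha\otimes_{H}e_{1}$, $e_{2}\ast e_{1}=(1\otimes s+ls\otimes1+k)\otimes_{H}e_{1}$, where $\alpha\in\{0,\ t,\ 1\otimes s+t\}$ and $k, l\in\mathbf{k}$ are arbitrary.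
   Context: $\mathbf{k}$ is an algebraically closed field of characteristic $0$, $\delta$ is a finite-dimensional Lie algebra over $\mathbf{k}$, and $H=U(\delta)$ is its universal enveloping algebra with the standard cocommutative Hopf structure ($\Delta(x)=x\otimes1+1\otimes x$ for $x\in\delta$). We regard $\mathbf{k},\delta\subset H$. $H^{\otimes n}$ is a right $H$-module via the iterated coproduct, e.g. $(f\otimes g)\cdot h=(f\otimes g)\Delta(h)$. An $H$-pseudoalgebra is a left $H$-module $A$ with a map $\ast:A\otimes A\to(H\otimes H)\otimes_H A$ that is $H$-bilinear: $hx\ast gy=(h\otimes g\otimes_H1)(x\ast y)$ for $x,y\in A$, $h,g\in H$. For $\beta\in H\otimes H$ and $x\ast y=\sum_i\alpha_i\otimes_Hc_i$ one sets, in $H^{\otimes3}\otimes_HA$, $(\beta\otimes_Hx)\ast y=\sum_i(\beta\otimes1)(\Delta\otimes\mathrm{id})(\alpha_i)\otimes_Hc_i$ and $x\ast(\beta\otimes_Hy)=\sum_i(1\otimes\beta)(\mathrm{id}\otimes\Delta)(\alpha_i)\otimes_Hc_i$. $A$ is left pre-Lie if for all $x,y,z\in A$ $$(x\ast y)\ast z-x\ast(y\ast z)=((12)\otimes_H\mathrm{id})[(y\ast x)\ast z-y\ast(x\ast z)],$$ where $(12)(f\otimes h\otimes g)=h\otimes f\otimes g$. Conventions: a scalar $c\in\mathbf{k}$ appearing as an element of $H\otimes H$ means $c(1\otimes1)$; $f\otimes g\otimes_He$ means $(f\otimes g)\otimes_He$. By $H$-bilinearity a pseudoproduct on a free module is determined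 by its values on basis elements. *)

(* Defs.v *)
From HB Require Import structures.
From mathcomp Require Import all_boot all_order all_algebra.
From mathcomp Require Import boolp classical_sets.

Set Implicit Arguments.
Unset Strict Implicit.
Unset Printing Implicit Defensive.

Import GRing.Theory.
Local Open Scope quotient_scope.
Local Open Scope ring_scope.

(** [tensor ra la] is the abelian group [M (x)_R N], where [R] acts on [M] from
    the right by [ra] and on [N] from the left by [la].  It is the quotient of
    the formal sums of pairs [(m, n)] by the relations that hold under every
    balanced map; a negation is not needed in formal sums since
    [- (m (x) n) = (- m) (x) n].  The map [tlift f] evaluates [f] on a formal sum
    representing its argument; it is independent of the latter when [f] is balanced. *)

Section Tensor.
Variables (R : Type) (M N : zmodType) (ra : M -> R -> M) (la : R -> N -> N).

Record balanced (G : zmodType) (f : M -> N -> G) : Prop := Balanced {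
  balancedDl : forall m m' n, f (m + m') n = f m n + f m' n;
  balancedDr : forall m n n', f m (n + n') = f m n + f m n';
  balancedA : forall m r n, f (ra m r) n = f m (la r n) }.

Definition fsum (G : zmodType) (f : M -> N -> G) (s : seq (M * N)) : G :=
  \sum_(p <- s) f p.1 p.2.

Definition tequiv (s s' : seq (M * N)) : Prop :=
  forall (G : zmodType) (f : M -> N -> G), balanced f -> fsum f s = fsum f s'.

Definition tequivb : rel (seq (M * N)) := fun s s' => `[< tequiv s s' >].

Lemma tequivb_equiv : equiv_class_of tequivb.
Proof.
split=> [s|s s'|s1 s2 s3].
- by apply/asboolP.
- by apply/asboolP/asboolP => h G f /h.
- move=> /asboolP h12 /asboolP h23; apply/asboolP => G f hf.
  by rewrite (h12 _ _ hf) (h23 _ _ hf).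
Qed.

Canonical tequivb_rel := EquivRelPack tequivb_equiv.

Definition tensor := {eq_quot tequivb}.
HB.instance Definition _ := Choice.on tensor.
HB.instance Definition _ := EqQuotient.on tensor.

Definition tlift (G : zmodType) (f : M -> N -> G) (x : tensor) : G :=
  fsum f (repr x).

Definition tpure (m : M) (n : N) : tensor := \pi_tensor [:: (m, n)].

Lemma tlift_pi (G : zmodType) (f : M -> N -> G) s :
  balanced f -> tlift f (\pi_tensor s) = fsum f s.
Proof.
move=> hf; have /eqmodP/asboolP h := reprK (\pi_tensor s).
exact: h.
Qed.

Lemma tensor_ext (x y : tensor) :
  (forall (G : zmodType) (f : M -> N -> G), balanced f ->
     tlift f x = tlift f y) -> x = y.
Proof.
by move=> h; rewrite -[x]reprK -[y]reprK; apply/eqmodP/asboolP.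
Qed.

Definition tzero : tensor := \pi_tensor [::].
Definition tadd (x y : tensor) : tensor := \pi_tensor (repr x ++ repr y).
Definition topp (x : tensor) : tensor :=
  \pi_tensor [seq (- p.1, p.2) | p <- repr x].

Lemma balanced0l (G : zmodType) (f : M -> N -> G) n : balanced f -> f 0 n = 0.
Proof. by move=> hf; apply: (addIr (f 0 n)); rewrite -(balancedDl hf) !add0r. Qed.

Lemma balancedNl (G : zmodType) (f : M -> N -> G) m n :
  balanced f -> f (- m) n = - f m n.
Proof.
move=> hf; apply: (addIr (f m n)).
by rewrite -(balancedDl hf) !addNr balanced0l.
Qed.

Let lift0 (G : zmodType) (f : M -> N -> G) : balanced f -> tlift f tzero = 0.
Proof. by move=> hf; rewrite tlift_pi // /fsum big_nil. Qed.

Let liftD (G : zmodType) (f : M -> N -> G) x y :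
  balanced f -> tlift f (tadd x y) = tlift f x + tlift f y.
Proof. by move=> hf; rewrite tlift_pi // /fsum big_cat. Qed.

Let liftN (G : zmodType) (f : M -> N -> G) x :
  balanced f -> tlift f (topp x) = - tlift f x.
Proof.
move=> hf; rewrite tlift_pi // /fsum big_map -sumrN.
by apply: eq_bigr => p _; rewrite /= balancedNl.
Qed.

Let taddA : associative tadd.
Proof. by move=> x y z; apply: tensor_ext => G f hf; rewrite !liftD // addrA. Qed.
Let taddC : commutative tadd.
Proof. by move=> x y; apply: tensor_ext => G f hf; rewrite !liftD // addrC. Qed.
Let tadd0 : left_id tzero tadd.
Proof. by move=> x; apply: tensor_ext => G f hf; rewrite liftD // lift0 // add0r. Qed.
Let taddN : left_inverse tzero topp tadd.
Proof.
by move=> x; apply: tensor_ext => G f hf; rewrite liftD // liftN // lift0 // addNr.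
Qed.

HB.instance Definition _ := GRing.isZmodule.Build tensor taddA taddC tadd0 taddN.

Lemma tlift0 (G : zmodType) (f : M -> N -> G) : balanced f -> tlift f 0 = 0.
Proof. exact: lift0. Qed.

Lemma tliftD (G : zmodType) (f : M -> N -> G) x y :
  balanced f -> tlift f (x + y) = tlift f x + tlift f y.
Proof. exact: liftD. Qed.

Lemma tliftN (G : zmodType) (f : M -> N -> G) x :
  balanced f -> tlift f (- x) = - tlift f x.
Proof. exact: liftN. Qed.

Lemma tliftE (G : zmodType) (f : M -> N -> G) m n :
  balanced f -> tlift f (tpure m n) = f m n.
Proof. by move=> hf; rewrite tlift_pi // /fsum big_seq1. Qed.

Lemma tpure_balanced : balanced tpure.
Proof.
split=> [m m' n|m n n'|m r n]; apply: tensor_ext => G f hf;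
  rewrite ?tliftD // !tliftE //.
- exact: balancedDl.
- exact: balancedDr.
- exact: balancedA.
Qed.

Lemma tensor_ind (P : tensor -> Prop) :
  P 0 -> (forall x y, P x -> P y -> P (x + y)) -> (forall m n, P (tpure m n)) ->
  forall x, P x.
Proof.
move=> P0 PD Pp x; rewrite -[x]reprK.
elim: (repr x) => [|[m n] s IHs]; first exact: P0.
suff -> : \pi_tensor ((m, n) :: s) = tpure m n + \pi_tensor s by apply: PD.
apply: tensor_ext => G f hf.
by rewrite tliftD // tliftE // !tlift_pi // /fsum big_cons.
Qed.

End Tensor.

Section FieldTensor.
Variable k : fieldType.

Definition ktensor (V W : lmodType k) : Type :=
  tensor (fun (v : V) (c : k) => c *: v) (fun (c : k) (w : W) => c *: w).

HB.instance Definition _ V W := GRing.Zmodule.on (ktensor V W).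

Definition ktens (V W : lmodType k) (v : V) (w : W) : ktensor V W :=
  tpure _ _ v w.

End FieldTensor.

Notation "v \ox w" := (ktens v w) (at level 40, left associativity) : ring_scope.

Definition kbalanced (k : fieldType) (V W : lmodType k) (G : zmodType)
    (f : V -> W -> G) : Prop :=
  balanced (fun (v : V) (c : k) => c *: v) (fun (c : k) (w : W) => c *: w) f.

Definition klift (k : fieldType) (V W : lmodType k) (G : zmodType)
    (f : V -> W -> G) (x : ktensor V W) : G := tlift f x.

Section KTensorTheory.
Variables (k : fieldType) (V W : lmodType k).
Implicit Types (v : V) (w : W) (c : k).

Lemma ktens_balanced : kbalanced (@ktens k V W).
Proof. exact: tpure_balanced. Qed.

Lemma ktensDl v v' w : (v + v') \ox w = v \ox w + v' \ox w.
Proof. exact: balancedDl ktens_balanced _ _ _. Qed.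

Lemma ktensDr v w w' : v \ox (w + w') = v \ox w + v \ox w'.
Proof. exact: balancedDr ktens_balanced _ _ _. Qed.

Lemma ktensZ c v w : (c *: v) \ox w = v \ox (c *: w).
Proof. exact: balancedA ktens_balanced _ _ _. Qed.

Lemma kliftE (G : zmodType) (f : V -> W -> G) v w :
  kbalanced f -> klift f (v \ox w) = f v w.
Proof. by move=> hf; apply: tliftE. Qed.

Lemma klift0 (G : zmodType) (f : V -> W -> G) : kbalanced f -> klift f 0 = 0.
Proof. exact: tlift0. Qed.

Lemma kliftD (G : zmodType) (f : V -> W -> G) x y :
  kbalanced f -> klift f (x + y) = klift f x + klift f y.
Proof. exact: tliftD. Qed.

Lemma ktensor_ind (P : ktensor V W -> Prop) :
  P 0 -> (forall x y, P x -> P y -> P (x + y)) -> (forall v w, P (v \ox w)) ->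
  forall x, P x.
Proof. exact: tensor_ind. Qed.

Definition kscale c (x : ktensor V W) : ktensor V W :=
  klift (fun v w => (c *: v) \ox w) x.

Let kscale_balanced c : kbalanced (fun v w => (c *: v) \ox w).
Proof.
split=> *; first by rewrite scalerDr ktensDl.
- by rewrite ktensDr.
- by rewrite -ktensZ !scalerA mulrC.
Qed.

Let kscaleE c v w : kscale c (v \ox w) = (c *: v) \ox w.
Proof. exact: (kliftE _ _ (kscale_balanced c)). Qed.

Let kscaleDr : right_distributive kscale +%R.
Proof. by move=> c x y; apply: (kliftD _ _ (kscale_balanced c)). Qed.

Let kscale0 c : kscale c 0 = 0.
Proof. exact: klift0 (kscale_balanced c). Qed.

Let kscaleA a b x : kscale a (kscale b x) = kscale (a * b) x.
Proof.
elim/ktensor_ind: x => [|x y hx hy|v w]; first by rewrite !kscale0.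
- by rewrite !kscaleDr hx hy.
- by rewrite !kscaleE scalerA.
Qed.

Let kscale1 : left_id 1 kscale.
Proof.
move=> x; elim/ktensor_ind: x => [|x y hx hy|v w]; first by rewrite !kscale0.
- by rewrite !kscaleDr hx hy.
- by rewrite !kscaleE scale1r.
Qed.

Let kscaleDl x : {morph kscale^~ x : a b / a + b}.
Proof.
move=> a b; elim/ktensor_ind: x => [|x y hx hy|v w].
- by rewrite !kscale0 addr0.
- by rewrite !kscaleDr hx hy addrACA.
- by rewrite !kscaleE scalerDl ktensDl.
Qed.

HB.instance Definition _ := GRing.Zmodule_isLmodule.Build k (ktensor V W)
  kscaleA kscale1 kscaleDr kscaleDl.

Lemma scale_ktens c v w : c *: (v \ox w) = (c *: v) \ox w.
Proof. exact: kscaleE. Qed.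

End KTensorTheory.

Section LinearForm.
Variables (k : fieldType) (V : lmodType k) (v : V).
Hypothesis v0 : v != 0.

Let pform (G : set (V * k)) : Prop :=
  [/\ forall c x y a b, G (x, a) -> G (y, b) -> G (c *: x + y, c * a + b),
      forall a, G (0, a) -> a = 0 & forall a, G (v, a) -> a = 1].

Let ext (G : set (V * k)) x a : set (V * k) :=
  fun p => exists y b c, (G (y, b) \/ (y, b) = (0, 0)) /\
    p = (y + c *: x, b + c * a).

Let ext_pform G x a : pform G -> (forall b, ~ G (x, b)) -> x <> 0 ->
  ((forall b, ~ G (v, b)) -> x = v /\ a = 1) -> pform (ext G x a).
Proof.
move=> [GL G0 Gv] xG x0 xv; split.
- move=> c y z d e [y1 [d1 [c1 [h1 [-> ->]]]]] [y2 [d2 [c2 [h2 [-> ->]]]]].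
  exists (c *: y1 + y2), (c * d1 + d2), (c * c1 + c2); split; last first.
    congr pair; first by rewrite scalerDr scalerDl scalerA addrACA.
    by rewrite mulrDr mulrDl mulrA addrACA.
  case: h1 => [h1|[-> ->]].
    case: h2 => [h2|[-> ->]]; first by left; apply: GL.
    left; have := GL (c - 1) _ _ _ _ h1 h1.
    by rewrite scalerBl mulrBl scale1r mul1r !subrK !addr0.
  by rewrite scaler0 mulr0 !add0r.
- move=> b [y [d [c [h [e1 e2]]]]].
  have [c0|c0] := eqVneq c 0.
    move: e1 e2; rewrite c0 scale0r mul0r !addr0 => e1 e2; move: h; rewrite -e1 -e2.
    by case=> [/G0|[]].
  case: h => [h|[yE dE]]; last first.
    move: e1; rewrite yE add0r => /esym/eqP; rewrite scaler_eq0 (negPf c0) /=.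
    by move/eqP.
  exfalso; apply: (xG (- c^-1 * d)).
  have -> : x = - c^-1 *: y.
    have -> : y = - (c *: x) by apply/eqP; rewrite -addr_eq0 -e1.
    by rewrite scalerN scaleNr opprK scalerA mulVf // scale1r.
  have := GL (- c^-1 - 1) _ _ _ _ h h.
  by rewrite scalerBl mulrBl scale1r mul1r !subrK.
- move=> b [y [d [c [h [e1 e2]]]]].
  have [[b' hb']|nv] := pselect (exists b', G (v, b')).
    have b'1 := Gv _ hb'; subst b'.
    have [c0|c0] := eqVneq c 0.
      move: e1 e2; rewrite c0 scale0r mul0r !addr0 => e1 e2; move: h; rewrite -e1 -e2.
      case=> [/Gv//|[vE _]]; by move: v0; rewrite vE eqxx.
    have xE : x = c^-1 *: (v - y).
      by rewrite e1 addrC addKr scalerA mulVf // scale1r.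
    exfalso; case: h => [h|[yE dE]].
      apply: (xG (- c^-1 * d + c^-1 * 1)); rewrite xE scalerBr addrC -scaleNr.
      have := GL (c^-1 - 1) _ _ _ _ hb' hb'.
      rewrite scalerBl mulrBl scale1r mul1r !subrK; exact: GL.
    apply: (xG (c^-1 * 1)); rewrite xE yE subr0.
    have := GL (c^-1 - 1) _ _ _ _ hb' hb'.
    by rewrite scalerBl mulrBl scale1r mul1r !subrK.
  have nv' b' : ~ G (v, b') by move=> hb; apply: nv; exists b'.
  have [xE aE] := xv nv'; subst x a.
  have yE : y = (1 - c) *: v.
    by rewrite scalerBl scale1r; apply/eqP; rewrite eq_sym subr_eq -e1.
  have [c1|c1] := eqVneq (1 - c) 0.
    move: yE e2; rewrite c1 scale0r mulr1 => yE ->.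
    have -> : d = 0 by case: h => [|[_ //]]; rewrite yE => /G0.
    by rewrite add0r; apply/esym/eqP; rewrite -subr_eq0 c1.
  exfalso; case: h => [h|[y0 _]].
    apply: (nv' ((1 - c)^-1 * d)).
    have := GL ((1 - c)^-1 - 1) _ _ _ _ h h.
    rewrite scalerBl mulrBl scale1r mul1r !subrK.
    by rewrite {1}yE scalerA mulVf // scale1r.
  move: yE; rewrite y0 => /esym/eqP; rewrite scaler_eq0 (negPf c1) /=.
  by rewrite (negPf v0).
Qed.

Lemma exists_linear_form : exists phi : V -> k,
  (forall c x y, phi (c *: x + y) = c * phi x + phi y) /\ phi v = 1.
Proof.
have [|G [pG Gmax]] := @Zorn_bigcup (V * k)%type pform.
  move=> F FP Ftot; split.
  - move=> c x y a b [X FX Xx] [Y FY Yy].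
    by have [XY|YX] := Ftot _ _ FX FY; [exists Y|exists X] => //;
      [case: (FP _ FY) => h _ _|case: (FP _ FX) => h _ _]; apply: h => //;
      [apply: XY|apply: YX].
  - by move=> a [X FX Xa]; case: (FP _ FX) => _ h _; apply: h.
  - by move=> a [X FX Xa]; case: (FP _ FX) => _ _ h; apply: h.
have extend x (a : k) : (forall b, ~ G (x, b)) -> x <> 0 ->
    ((forall b, ~ G (v, b)) -> x = v /\ a = 1) -> False.
  move=> xG x0 xv; suff /Gmax : (G `<` ext G x a)%classic by apply; apply: ext_pform.
  split; last first.
    move=> hsub; apply: (xG a); apply: hsub.
    by exists 0, 0, 1; split; [right|rewrite !add0r scale1r mul1r].
  move=> [y b] hy; exists y, b, 0.
  by split; [left|rewrite scale0r mul0r !addr0].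
have [GL G0 Gv] := pG.
have [b hb] : exists b, G (v, b).
  apply: contrapT => nv; apply: (extend v 1) => // [b hb|vE].
    by apply: nv; exists b.
  by move: v0; rewrite vE eqxx.
have b1 := Gv _ hb; subst b.
have Gtot x : exists a, G (x, a).
  apply: contrapT => nx; apply: (extend x 0) => [b hb'|x0|nv].
  - by apply: nx; exists b.
  - apply: nx; exists 0; rewrite x0.
    by have := GL (- 1) _ _ _ _ hb hb; rewrite scaleN1r mulN1r !addNr.
  - by case: (nv _ hb).
have [phi phiP] := boolp.choice Gtot.
have Guniq x a b : G (x, a) -> G (x, b) -> a = b.
  move=> ha hb'; have := GL (- 1) _ _ _ _ ha hb'.
  by rewrite scaleN1r mulN1r addNr => /G0 /eqP; rewrite addrC subr_eq0 => /eqP.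
exists phi; split=> [c x y|]; last by apply: Gv; apply: phiP.
by apply: Guniq (phiP _) _; apply: GL.
Qed.

End LinearForm.

Section AlgebraTensor.
Variables (k : fieldType) (A B : algType k).
Implicit Types (x y z : ktensor A B).

Let inner a b (y : ktensor A B) : ktensor A B :=
  klift (fun a' b' => (a * a') \ox (b * b')) y.

Let inner_balanced (a : A) (b : B) :
  kbalanced (fun (a' : A) (b' : B) => (a * a') \ox (b * b')).
Proof.
split=> *; first by rewrite mulrDr ktensDl.
- by rewrite mulrDr ktensDr.
- by rewrite -!scalerAr ktensZ.
Qed.

Let innerD a b : {morph inner a b : x y / x + y}.
Proof. by move=> x y; apply: kliftD (inner_balanced a b). Qed.

Let inner0 a b : inner a b 0 = 0.
Proof. exact: klift0 (inner_balanced a b). Qed.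

Let innerE a b a' b' : inner a b (a' \ox b') = (a * a') \ox (b * b').
Proof. exact: kliftE (inner_balanced a b). Qed.

Let outer_balanced y : kbalanced (fun a b => inner a b y).
Proof.
split=> [a a' b|a b b'|a c b]; elim/ktensor_ind: y => [|y z hy hz|u w];
  rewrite ?inner0 ?addr0 // ?innerD ?innerE ?hy ?hz //.
- by rewrite addrACA.
- by rewrite mulrDl ktensDl.
- by rewrite addrACA.
- by rewrite mulrDl ktensDr.
- by rewrite -!scalerAl ktensZ.
Qed.

Definition kmul (x y : ktensor A B) : ktensor A B :=
  klift (fun a b => klift (fun a' b' => (a * a') \ox (b * b')) y) x.

Let kmulDl : left_distributive kmul +%R.
Proof. by move=> x y z; apply: kliftD (outer_balanced z). Qed.

Let kmul0l x : kmul 0 x = 0.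
Proof. exact: klift0 (outer_balanced x). Qed.

Let kmulEl a b y : kmul (a \ox b) y = inner a b y.
Proof. exact: kliftE (outer_balanced y). Qed.

Let kmulE a b a' b' : kmul (a \ox b) (a' \ox b') = (a * a') \ox (b * b').
Proof. by rewrite kmulEl innerE. Qed.

Let kmulDr : right_distributive kmul +%R.
Proof.
move=> x y z; elim/ktensor_ind: x => [|x x' hx hx'|a b].
- by rewrite !kmul0l addr0.
- by rewrite !kmulDl hx hx' addrACA.
- by rewrite !kmulEl innerD.
Qed.

Let kmul0r x : kmul x 0 = 0.
Proof. by apply: (addIr (kmul x 0)); rewrite -kmulDr !add0r. Qed.

Let kmulA : associative kmul.
Proof.
move=> x y z; elim/ktensor_ind: x => [|x x' hx hx'|a b].
- by rewrite !kmul0l.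
- by rewrite !kmulDl hx hx'.
elim/ktensor_ind: y => [|y y' hy hy'|a' b'].
- by rewrite !(kmul0l, kmul0r).
- by rewrite !(kmulDl, kmulDr) hy hy'.
elim/ktensor_ind: z => [|z z' hz hz'|a'' b''].
- by rewrite !kmul0r.
- by rewrite !kmulDr hz hz'.
by rewrite !kmulE !mulrA.
Qed.

Let kmul1l : left_id (1 \ox 1) kmul.
Proof.
move=> x; elim/ktensor_ind: x => [|x y hx hy|a b]; first by rewrite kmul0r.
- by rewrite kmulDr hx hy.
- by rewrite kmulE !mul1r.
Qed.

Let kmul1r : right_id (1 \ox 1) kmul.
Proof.
move=> x; elim/ktensor_ind: x => [|x y hx hy|a b]; first by rewrite kmul0l.
- by rewrite kmulDl hx hy.
- by rewrite kmulE !mulr1.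
Qed.

Let kone_neq0 : 1 \ox 1 != 0 :> ktensor A B.
Proof.
have [phi [phiL phi1]] := exists_linear_form (oner_neq0 A).
have [psi [psiL psi1]] := exists_linear_form (oner_neq0 B).
have hf : kbalanced (fun (a : A) (b : B) => phi a * psi b).
  split=> [a a' b|a b b'|a c b].
  - by have := phiL 1 a a'; rewrite scale1r mul1r => ->; rewrite mulrDl.
  - by have := psiL 1 b b'; rewrite scale1r mul1r => ->; rewrite mulrDr.
  have phi0 : phi 0 = 0.
    by have := phiL (- 1) 0 0; rewrite scaler0 addr0 mulN1r addNr.
  have psi0 : psi 0 = 0.
    by have := psiL (- 1) 0 0; rewrite scaler0 addr0 mulN1r addNr.
  have := phiL c a 0; rewrite addr0 phi0 addr0 => ->.
  have := psiL c b 0; rewrite addr0 psi0 addr0 => ->.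
  by rewrite mulrA [phi a * c]mulrC.
apply/eqP => /(congr1 (klift (fun a b => phi a * psi b))).
rewrite kliftE // klift0 // phi1 psi1 mulr1 => /eqP.
by rewrite oner_eq0.
Qed.

HB.instance Definition _ := GRing.Zmodule_isNzRing.Build (ktensor A B)
  kmulA kmul1l kmul1r kmulDl kmulDr kone_neq0.

Lemma mul_ktens (a a' : A) (b b' : B) :
  (a \ox b) * (a' \ox b') = (a * a') \ox (b * b').
Proof. exact: kmulE. Qed.

Lemma one_ktens : 1 = 1 \ox 1 :> ktensor A B.
Proof. by []. Qed.

Let kscaleAl (c : k) (x y : ktensor A B) : c *: (x * y) = (c *: x) * y.
Proof.
elim/ktensor_ind: x => [|x x' hx hx'|a b].
- by rewrite mul0r !scaler0 mul0r.
- by rewrite mulrDl !scalerDr mulrDl hx hx'.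
elim/ktensor_ind: y => [|y y' hy hy'|a' b'].
- by rewrite !mulr0 scaler0.
- by rewrite !mulrDr scalerDr hy hy'.
by rewrite scale_ktens !mul_ktens scale_ktens scalerAl.
Qed.

HB.instance Definition _ :=
  GRing.Lmodule_isLalgebra.Build k (ktensor A B) kscaleAl.

Let kscaleAr (c : k) (x y : ktensor A B) : c *: (x * y) = x * (c *: y).
Proof.
elim/ktensor_ind: x => [|x x' hx hx'|a b].
- by rewrite !mul0r scaler0.
- by rewrite !mulrDl scalerDr hx hx'.
elim/ktensor_ind: y => [|y y' hy hy'|a' b'].
- by rewrite mulr0 !scaler0 mulr0.
- by rewrite !mulrDr !scalerDr mulrDr hy hy'.
by rewrite scale_ktens !mul_ktens scale_ktens scalerAr.
Qed.

HB.instance Definition _ :=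
  GRing.Lalgebra_isAlgebra.Build k (ktensor A B) kscaleAr.

End AlgebraTensor.

HB.mixin Record isLieAlgebra (k : fieldType) L of GRing.Lmodule k L := {
  lie : L -> L -> L;
  lie_linearl : forall z, linear (lie^~ z);
  lie_linearr : forall x, linear (lie x);
  lie_alternating : forall x, lie x x = 0;
  lie_jacobi : forall x y z,
    lie x (lie y z) + lie y (lie z x) + lie z (lie x y) = 0 }.

#[short(type="lieAlgType")]
HB.structure Definition LieAlgebra (k : fieldType) :=
  {L of GRing.Lmodule k L & isLieAlgebra k L}.

#[short(type="finLieAlgType")]
HB.structure Definition FinLieAlgebra (k : fieldType) :=
  {L of Vector k L & isLieAlgebra k L}.

(** The universal enveloping algebra [uea L] is the algebra of noncommutative polynomial expressions in the elements
    of [L], two expressions being identified when they take the same value under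
    every Lie algebra homomorphism from [L] to an associative unital algebra. *)

Section Enveloping.
Variables (k : fieldType) (L : lieAlgType k).

Record lie_hom (A : algType k) (f : L -> A) : Prop := LieHom {
  lie_hom_linear : linear f;
  lie_hom_lie : forall x y, f (lie x y) = f x * f y - f y * f x }.

Inductive uterm : Type :=
  | UGen of L
  | UConst of k
  | UAdd of uterm & uterm
  | UMul of uterm & uterm.

HB.instance Definition _ := gen_eqMixin uterm.
HB.instance Definition _ := gen_choiceMixin uterm.

Fixpoint ueval (A : algType k) (f : L -> A) (t : uterm) : A :=
  match t with
  | UGen x => f x
  | UConst c => c%:A
  | UAdd t1 t2 => ueval f t1 + ueval f t2
  | UMul t1 t2 => ueval f t1 * ueval f t2
  end.

Definition uequiv (t t' : uterm) : Prop :=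
  forall (A : algType k) (f : L -> A), lie_hom f -> ueval f t = ueval f t'.

Definition uequivb : rel uterm := fun t t' => `[< uequiv t t' >].

Lemma uequivb_equiv : equiv_class_of uequivb.
Proof.
split=> [t|t t'|t1 t2 t3].
- by apply/asboolP.
- by apply/asboolP/asboolP => h A f /h.
- move=> /asboolP h12 /asboolP h23; apply/asboolP => A f hf.
  by rewrite (h12 _ _ hf) (h23 _ _ hf).
Qed.

Canonical uequivb_rel := EquivRelPack uequivb_equiv.

Definition uea := {eq_quot uequivb}.
HB.instance Definition _ := Choice.on uea.
HB.instance Definition _ := EqQuotient.on uea.

(** Meaningful for [f] satisfying [lie_hom], see [uea_lift_pi]. *)
Definition uea_lift (A : algType k) (f : L -> A) (u : uea) : A :=
  ueval f (repr u).

Definition uea_in (x : L) : uea := \pi_uea (UGen x).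

Lemma uea_lift_pi (A : algType k) (f : L -> A) t :
  lie_hom f -> uea_lift f (\pi_uea t) = ueval f t.
Proof. by move=> hf; have /eqmodP/asboolP := reprK (\pi_uea t); apply. Qed.

Lemma uea_ext (u v : uea) :
  (forall (A : algType k) (f : L -> A), lie_hom f ->
     uea_lift f u = uea_lift f v) -> u = v.
Proof. by move=> h; rewrite -[u]reprK -[v]reprK; apply/eqmodP/asboolP. Qed.

Definition uzero : uea := \pi_uea (UConst 0).
Definition uone : uea := \pi_uea (UConst 1).
Definition uadd (u v : uea) : uea := \pi_uea (UAdd (repr u) (repr v)).
Definition umul (u v : uea) : uea := \pi_uea (UMul (repr u) (repr v)).
Definition uscale (c : k) (u : uea) : uea := \pi_uea (UMul (UConst c) (repr u)).
Definition uopp (u : uea) : uea := uscale (- 1) u.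

Section Lift.
Variables (A : algType k) (f : L -> A).
Hypothesis hf : lie_hom f.

Let lift0 : uea_lift f uzero = 0.
Proof. by rewrite uea_lift_pi //= scale0r. Qed.
Let lift1 : uea_lift f uone = 1.
Proof. by rewrite uea_lift_pi //= scale1r. Qed.
Let liftD u v : uea_lift f (uadd u v) = uea_lift f u + uea_lift f v.
Proof. by rewrite uea_lift_pi. Qed.
Let liftM u v : uea_lift f (umul u v) = uea_lift f u * uea_lift f v.
Proof. by rewrite uea_lift_pi. Qed.
Let liftZ c u : uea_lift f (uscale c u) = c *: uea_lift f u.
Proof. by rewrite uea_lift_pi //= -scalerAl mul1r. Qed.
Let liftN u : uea_lift f (uopp u) = - uea_lift f u.
Proof. by rewrite liftZ scaleN1r. Qed.
Definition uea_lift_ops := (lift0, lift1, liftD, liftM, liftN, liftZ).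
End Lift.

Local Ltac uea_tac lem :=
  let hf := fresh "hf" in
  move=> *; apply: uea_ext => ? ? hf; by rewrite ?(uea_lift_ops hf) lem.

Let uaddA : associative uadd. Proof. uea_tac addrA. Qed.
Let uaddC : commutative uadd. Proof. uea_tac addrC. Qed.
Let uadd0 : left_id uzero uadd. Proof. uea_tac add0r. Qed.
Let uaddN : left_inverse uzero uopp uadd. Proof. uea_tac addNr. Qed.

HB.instance Definition _ := GRing.isZmodule.Build uea uaddA uaddC uadd0 uaddN.

Let umulA : associative umul. Proof. uea_tac mulrA. Qed.
Let umul1l : left_id uone umul. Proof. uea_tac mul1r. Qed.
Let umul1r : right_id uone umul. Proof. uea_tac mulr1. Qed.
Let umulDl : left_distributive umul uadd. Proof. uea_tac mulrDl. Qed.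
Let umulDr : right_distributive umul uadd. Proof. uea_tac mulrDr. Qed.
Let uone_neq0 : uone != uzero.
Proof.
have hf : @lie_hom k^o (fun=> 0).
  split=> [c x y|x y] /=; last by rewrite mulr0 subrr.
  by rewrite [c *: _]mulr0 addr0.
apply/eqP => /(congr1 (uea_lift (fun=> 0 : k^o))).
by rewrite !(uea_lift_ops hf) => /eqP; rewrite oner_eq0.
Qed.

HB.instance Definition _ := GRing.Zmodule_isNzRing.Build uea
  umulA umul1l umul1r umulDl umulDr uone_neq0.

Let uscaleA a b u : uscale a (uscale b u) = uscale (a * b) u.
Proof. uea_tac scalerA. Qed.
Let uscale1 : left_id 1 uscale. Proof. uea_tac scale1r. Qed.
Let uscaleDr : right_distributive uscale uadd. Proof. uea_tac scalerDr. Qed.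
Let uscaleDl u : {morph uscale^~ u : a b / a + b >-> uadd a b}.
Proof. uea_tac scalerDl. Qed.

HB.instance Definition _ := GRing.Zmodule_isLmodule.Build k uea
  uscaleA uscale1 uscaleDr uscaleDl.

Let uscaleAl (c : k) (u v : uea) : uscale c (umul u v) = umul (uscale c u) v.
Proof. uea_tac scalerAl. Qed.
HB.instance Definition _ := GRing.Lmodule_isLalgebra.Build k uea uscaleAl.

Let uscaleAr (c : k) (u v : uea) : uscale c (umul u v) = umul u (uscale c v).
Proof. uea_tac scalerAr. Qed.
HB.instance Definition _ := GRing.Lalgebra_isAlgebra.Build k uea uscaleAr.

Lemma uea_in_hom : lie_hom uea_in.
Proof.
split=> [c x y|x y]; apply: uea_ext => A f hf.
  rewrite [RHS](uea_lift_ops hf) [uea_lift f (c *: _)](uea_lift_ops hf).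
  rewrite !uea_lift_pi //=; exact: lie_hom_linear.
rewrite [RHS](uea_lift_ops hf) [uea_lift f (- _)](uea_lift_ops hf).
rewrite ![uea_lift f (_ * _)](uea_lift_ops hf).
rewrite !uea_lift_pi //=; exact: lie_hom_lie.
Qed.

Lemma uea_ind (P : uea -> Prop) :
  (forall x, P (uea_in x)) -> (forall c, P c%:A) ->
  (forall u v, P u -> P v -> P (u + v)) -> (forall u v, P u -> P v -> P (u * v)) ->
  forall u, P u.
Proof.
move=> Pin Pc PD PM u; rewrite -[u]reprK.
elim: (repr u) => [x|c|t1 h1 t2 h2|t1 h1 t2 h2].
- exact: Pin.
- suff -> : \pi_uea (UConst c) = c%:A by apply: Pc.
  apply: uea_ext => A f hf; rewrite [RHS](uea_lift_ops hf).
  by rewrite [uea_lift f 1](uea_lift_ops hf) uea_lift_pi.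
- suff -> : \pi_uea (UAdd t1 t2) = \pi_uea t1 + \pi_uea t2 by apply: PD.
  by apply: uea_ext => A f hf; rewrite [RHS](uea_lift_ops hf) !uea_lift_pi.
- suff -> : \pi_uea (UMul t1 t2) = \pi_uea t1 * \pi_uea t2 by apply: PM.
  by apply: uea_ext => A f hf; rewrite [RHS](uea_lift_ops hf) !uea_lift_pi.
Qed.

Record alg_hom (A B : algType k) (F : A -> B) : Prop := AlgHom {
  alg_hom_linear : linear F;
  alg_hom1 : F 1 = 1;
  alg_homM : {morph F : u v / u * v} }.

Lemma uea_lift_hom (A : algType k) (f : L -> A) :
  lie_hom f -> alg_hom (uea_lift f).
Proof.
move=> hf; split=> [c u v||u v]; rewrite [LHS](uea_lift_ops hf) //.
by rewrite [uea_lift f (c *: _)](uea_lift_ops hf).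
Qed.

Lemma uea_lift_in (A : algType k) (f : L -> A) x :
  lie_hom f -> uea_lift f (uea_in x) = f x.
Proof. by move=> hf; rewrite uea_lift_pi. Qed.

End Enveloping.

Section TensorMaps.
Variable k : fieldType.

Definition ktmap (V V' W W' : lmodType k) (f : V -> V') (g : W -> W') :
  ktensor V W -> ktensor V' W' := klift (fun v w => f v \ox g w).

Definition ktswap (V W : lmodType k) : ktensor V W -> ktensor W V :=
  klift (fun v w => w \ox v).

Definition ktassoc (U V W : lmodType k) :
  ktensor U (ktensor V W) -> ktensor (ktensor U V) W :=
  klift (fun u => klift (fun v w => (u \ox v) \ox w)).

Lemma linD (V W : lmodType k) (f : V -> W) :
  linear f -> {morph f : x y / x + y}.
Proof. by move=> hf x y; rewrite -[x]scale1r hf !scale1r. Qed.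

Lemma lin0 (V W : lmodType k) (f : V -> W) : linear f -> f 0 = 0.
Proof. by move=> /linD fD; apply: (addIr (f 0)); rewrite -fD !add0r. Qed.

Lemma linZ (V W : lmodType k) (f : V -> W) :
  linear f -> forall c x, f (c *: x) = c *: f x.
Proof. by move=> hf c x; rewrite -[c *: x]addr0 hf lin0 // addr0. Qed.

Lemma klift_linear (V W X : lmodType k) (f : V -> W -> X) :
  kbalanced f -> (forall w, linear (f^~ w)) -> linear (klift f).
Proof.
move=> hf fl c x y; rewrite kliftD //; congr (_ + _).
elim/ktensor_ind: x => [|x x' hx hx'|v w].
- by rewrite scaler0 !klift0 // scaler0.
- by rewrite scalerDr !kliftD // hx hx' scalerDr.
- by rewrite scale_ktens !kliftE // (linZ (fl w)).
Qed.

Lemma ktmap_balanced (V V' W W' : lmodType k) (f : V -> V') (g : W -> W') :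
  linear f -> linear g -> kbalanced (fun v w => f v \ox g w).
Proof.
move=> hf hg; split=> [v v' w|v w w'|v c w].
- by rewrite (linD hf) ktensDl.
- by rewrite (linD hg) ktensDr.
- by rewrite (linZ hf) (linZ hg) ktensZ.
Qed.

Lemma ktmapE (V V' W W' : lmodType k) (f : V -> V') (g : W -> W') v w :
  linear f -> linear g -> ktmap f g (v \ox w) = f v \ox g w.
Proof. by move=> hf hg; apply: kliftE; apply: ktmap_balanced. Qed.

Lemma ktmap_linear (V V' W W' : lmodType k) (f : V -> V') (g : W -> W') :
  linear f -> linear g -> linear (ktmap f g).
Proof.
move=> hf hg; apply: klift_linear => [|w c v v']; first exact: ktmap_balanced.
by rewrite (linD hf) (linZ hf) ktensDl scale_ktens.
Qed.

Lemma ktswap_balanced (V W : lmodType k) :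
  kbalanced (fun (v : V) (w : W) => w \ox v).
Proof. by split=> *; rewrite ?ktensDr ?ktensDl ?ktensZ. Qed.

Lemma ktswapE (V W : lmodType k) (v : V) (w : W) : ktswap (v \ox w) = w \ox v.
Proof. exact: kliftE (@ktswap_balanced V W). Qed.

Lemma ktswap_linear (V W : lmodType k) : linear (@ktswap V W).
Proof.
apply: klift_linear => [|w c v v']; first exact: ktswap_balanced.
by rewrite ktensDr -ktensZ scale_ktens.
Qed.

Let assoc_balanced (U V W : lmodType k) (u : U) :
  kbalanced (fun (v : V) (w : W) => (u \ox v) \ox w).
Proof.
split=> *; first by rewrite ktensDr ktensDl.
- by rewrite ktensDr.
- by rewrite -[RHS]ktensZ scale_ktens ktensZ.
Qed.

Lemma ktassoc_balanced (U V W : lmodType k) : kbalanced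
  (fun (u : U) => klift (fun (v : V) (w : W) => (u \ox v) \ox w)).
Proof.
split=> [u u' x|u x y|u c x]; last 2 first.
- exact: kliftD.
- elim/ktensor_ind: x => [|x y hx hy|v w]; first by rewrite scaler0 !klift0.
    by rewrite scalerDr !kliftD // hx hy.
  by rewrite scale_ktens !kliftE // ktensZ.
elim/ktensor_ind: x => [|x y hx hy|v w]; first by rewrite !klift0 // addr0.
- by rewrite !kliftD // hx hy addrACA.
- by rewrite !kliftE // !ktensDl.
Qed.

Lemma ktassocE (U V W : lmodType k) (u : U) (v : V) (w : W) :
  ktassoc (u \ox (v \ox w)) = (u \ox v) \ox w.
Proof. by rewrite /ktassoc !kliftE //; apply: ktassoc_balanced. Qed.

Lemma ktassoc_linear (U V W : lmodType k) : linear (@ktassoc U V W).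
Proof.
apply: klift_linear => [|x c u u']; first exact: ktassoc_balanced.
rewrite (balancedDl (@ktassoc_balanced U V W)); congr (_ + _).
elim/ktensor_ind: x => [|x y hx hy|v w]; first by rewrite !klift0 // scaler0.
- by rewrite !kliftD // hx hy scalerDr.
- by rewrite !kliftE // !scale_ktens.
Qed.

Lemma ktensor_alg_hom (A B C : algType k) (F : ktensor A B -> C) : linear F -> F 1 = 1 ->
  (forall a b a' b', F ((a * a') \ox (b * b')) = F (a \ox b) * F (a' \ox b')) ->
  alg_hom F.
Proof.
move=> hF F1 FM; split=> // x y.
elim/ktensor_ind: x => [|x x' hx hx'|a b].
- by rewrite mul0r lin0 // mul0r.
- by rewrite mulrDl !(linD hF) hx hx' mulrDl.
elim/ktensor_ind: y => [|y y' hy hy'|a' b'].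
- by rewrite mulr0 lin0 // mulr0.
- by rewrite mulrDr !(linD hF) hy hy' mulrDr.
- by rewrite mul_ktens FM.
Qed.

Lemma ktmap_hom (A A' B B' : algType k) (f : A -> A') (g : B -> B') :
  alg_hom f -> alg_hom g -> alg_hom (ktmap f g).
Proof.
move=> [fl f1 fM] [gl g1 gM]; apply: ktensor_alg_hom => [||a b a' b'].
- exact: ktmap_linear.
- by rewrite one_ktens ktmapE // f1 g1.
- by rewrite !ktmapE // fM gM mul_ktens.
Qed.

Lemma ktswap_hom (A B : algType k) : alg_hom (@ktswap A B).
Proof.
apply: ktensor_alg_hom => [||a b a' b']; first exact: ktswap_linear.
- by rewrite one_ktens ktswapE.
- by rewrite !ktswapE mul_ktens.
Qed.

Lemma ktassoc_hom (A B C : algType k) : alg_hom (@ktassoc A B C).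
Proof.
apply: ktensor_alg_hom => [||a x a' x']; first exact: ktassoc_linear.
  by rewrite !one_ktens ktassocE.
have lD u : {morph (fun z : ktensor B C => ktassoc (u \ox z)) : y z / y + z}.
  by move=> y z; rewrite ktensDr; apply: linD; apply: ktassoc_linear.
have l0 u : ktassoc (u \ox (0 : ktensor B C)) = 0 :> ktensor (ktensor A B) C.
  by apply: (addIr (ktassoc (u \ox 0))); rewrite -lD !add0r.
elim/ktensor_ind: x => [|x y hx hy|b c].
- by rewrite mul0r !l0 mul0r.
- by rewrite mulrDl !lD hx hy mulrDl.
elim/ktensor_ind: x' => [|x y hx hy|b' c'].
- by rewrite mulr0 !l0 mulr0.
- by rewrite mulrDr !lD hx hy mulrDr.
- by rewrite mul_ktens !ktassocE !mul_ktens.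
Qed.

Lemma id_hom (A : algType k) : alg_hom (@id A).
Proof. by []. Qed.

Lemma comp_hom (A B C : algType k) (g : B -> C) (f : A -> B) :
  alg_hom g -> alg_hom f -> alg_hom (g \o f).
Proof.
move=> [gl g1 gM] [fl f1 fM]; split=> [c x y||x y] /=.
- by rewrite fl gl.
- by rewrite f1 g1.
- by rewrite fM gM.
Qed.

Lemma uea_hom_ext (L : lieAlgType k) (A : algType k) (f g : uea L -> A) :
  alg_hom f -> alg_hom g ->
  (forall x, f (uea_in x) = g (uea_in x)) -> f =1 g.
Proof.
move=> [fl f1 fM] [gl g1 gM] h u.
elim/uea_ind: u => [//|c|u v hu hv|u v hu hv].
- by rewrite (linZ fl) (linZ gl) f1 g1.
- by rewrite (linD fl) (linD gl) hu hv.
- by rewrite fM gM hu hv.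
Qed.

End TensorMaps.

(** [H^{(x)3}] is encoded as [(H (x) H) (x) H] *)

Section Comultiplication.
Variables (k : fieldType) (L : lieAlgType k).
Local Notation H := (uea L).

Definition delta_in (x : L) : ktensor H H := uea_in x \ox 1 + 1 \ox uea_in x.

Definition delta : H -> ktensor H H := uea_lift delta_in.

Definition delta_id : ktensor H H -> ktensor (ktensor H H) H :=
  ktmap delta id.

Definition id_delta (a : ktensor H H) : ktensor (ktensor H H) H :=
  ktassoc (ktmap id delta a).

Definition delta3 (h : H) : ktensor (ktensor H H) H := delta_id (delta h).

Definition swap12 : ktensor (ktensor H H) H -> ktensor (ktensor H H) H :=
  ktmap (@ktswap _ _ _) id.

Lemma delta_in_hom : lie_hom delta_in.
Proof.
have [inl inM] := uea_in_hom L.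
split=> [c x y|x y]; rewrite /delta_in.
  rewrite inl ktensDl ktensDr -ktensZ scalerDr !scale_ktens.
  by rewrite addrACA.
rewrite inM !(mulrDl, mulrDr, mul_ktens, mulr1, mul1r, ktensDl, ktensDr).
have Nl (a b : H) : (- a) \ox b = - (a \ox b).
  by rewrite -scaleN1r -scale_ktens scaleN1r.
have Nr (a b : H) : a \ox (- b) = - (a \ox b).
  by rewrite -scaleN1r -ktensZ -scale_ktens scaleN1r.
rewrite Nl Nr !opprD [X in _ = X]addrACA.
rewrite -!addrA; congr (_ + _).
have gen (G : zmodType) (a b c d e : G) :
    - a + (b - c) = d + (- a + (- e + (e + (b + (- d - c))))).
  by rewrite addKr [RHS]addrCA [d + (b + _)]addrCA [d + _]addrA subrr add0r.
exact: gen.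
Qed.

Lemma delta_hom : alg_hom delta.
Proof. exact: uea_lift_hom delta_in_hom. Qed.

Lemma deltaE x : delta (uea_in x) = uea_in x \ox 1 + 1 \ox uea_in x.
Proof. exact: uea_lift_in delta_in_hom. Qed.

Lemma delta_id_hom : alg_hom delta_id.
Proof. exact: ktmap_hom delta_hom (id_hom _). Qed.

Lemma id_delta_hom : alg_hom id_delta.
Proof. exact: comp_hom (ktassoc_hom _ _ _) (ktmap_hom (id_hom _) delta_hom). Qed.

Lemma delta3_hom : alg_hom delta3.
Proof. exact: comp_hom delta_id_hom delta_hom. Qed.

Lemma swap12_hom : alg_hom swap12.
Proof. exact: ktmap_hom (ktswap_hom _ _) (id_hom _). Qed.

Lemma delta_coassoc h : id_delta (delta h) = delta3 h.
Proof.
apply: (uea_hom_ext (comp_hom id_delta_hom delta_hom) delta3_hom) => x /=.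
have [dl d1 _] := delta_hom.
have {}d1 : delta 1 = 1 \ox 1 by [].
rewrite /delta3 deltaE /id_delta /delta_id.
rewrite !(linD (ktmap_linear _ _)) // !ktmapE // d1 deltaE.
rewrite !(ktensDl, ktensDr) !(linD (@ktassoc_linear k H H H)).
by rewrite !ktassocE addrA.
Qed.

Lemma swap12_delta3 h : swap12 (delta3 h) = delta3 h.
Proof.
apply: (uea_hom_ext (comp_hom swap12_hom delta3_hom) delta3_hom) => x /=.
have [dl d1 _] := delta_hom.
have {}d1 : delta 1 = 1 \ox 1 by [].
have [sl _ _] := swap12_hom.
rewrite /delta3 deltaE /delta_id.
rewrite !(linD (ktmap_linear _ _)) // !ktmapE // d1 deltaE.
rewrite !(ktensDl, ktensDr) !(linD sl) /swap12.
have tl := @ktswap_linear k H H.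
by rewrite !ktmapE // !ktswapE; congr (_ + _); rewrite addrC.
Qed.

End Comultiplication.

(** [ptensor D A] is [T (x)_H A], where [h : H] acts on the algebra [T] by right
    multiplication by [D h]; it is used with [D := delta] ([T] being [H (x) H])
    and [D := delta3] ([T] being [H (x) H (x) H]). *)

Section Pseudotensor.
Variables (k : fieldType) (L : lieAlgType k).
Local Notation H := (uea L).
Variables (T : algType k) (D : H -> T) (A : lmodType H).

Definition ptensor : Type :=
  tensor (fun (a : T) (h : H) => a * D h) (fun (h : H) (x : A) => h *: x).

HB.instance Definition _ := GRing.Zmodule.on ptensor.

Definition ptens (a : T) (x : A) : ptensor := tpure _ _ a x.

Definition pbalanced (G : zmodType) (f : T -> A -> G) : Prop :=
  balanced (fun (a : T) (h : H) => a * D h) (fun (h : H) (x : A) => h *: x) f.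

Definition plift (G : zmodType) (f : T -> A -> G) (q : ptensor) : G :=
  tlift f q.

Lemma ptens_balanced : pbalanced ptens.
Proof. exact: tpure_balanced. Qed.

Lemma pliftE (G : zmodType) (f : T -> A -> G) a x :
  pbalanced f -> plift f (ptens a x) = f a x.
Proof. by move=> hf; apply: tliftE. Qed.

Lemma plift0 (G : zmodType) (f : T -> A -> G) : pbalanced f -> plift f 0 = 0.
Proof. exact: tlift0. Qed.

Lemma pliftD (G : zmodType) (f : T -> A -> G) p q :
  pbalanced f -> plift f (p + q) = plift f p + plift f q.
Proof. exact: tliftD. Qed.

Lemma ptensor_ind (P : ptensor -> Prop) :
  P 0 -> (forall p q, P p -> P q -> P (p + q)) -> (forall a x, P (ptens a x)) ->
  forall p, P p.
Proof. exact: tensor_ind. Qed.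

Definition pact (b : T) : ptensor -> ptensor :=
  plift (fun a x => ptens (b * a) x).

Lemma pact_balanced b : pbalanced (fun a x => ptens (b * a) x).
Proof.
split=> *; first by rewrite mulrDr (balancedDl ptens_balanced).
- by rewrite (balancedDr ptens_balanced).
- by rewrite mulrA (balancedA ptens_balanced).
Qed.

Lemma pactE b a x : pact b (ptens a x) = ptens (b * a) x.
Proof. exact: pliftE (pact_balanced b). Qed.

End Pseudotensor.

Notation "a \oxH x" := (ptens _ a x) (at level 40, left associativity) : ring_scope.

Section Pseudoalgebra.
Variables (k : fieldType) (L : lieAlgType k).
Local Notation H := (uea L).
Variable A : lmodType H.
Local Notation A2 := (ptensor (@delta k L) A).
Local Notation A3 := (ptensor (@delta3 k L) A).

(** [k]-bilinearity of [star] is the case [h, g \in k] of [pseudo_bilinear]. *)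
Record pseudoproduct (star : A -> A -> A2) : Prop := Pseudoproduct {
  pseudoDl : forall x x' y, star (x + x') y = star x y + star x' y;
  pseudoDr : forall x y y', star x (y + y') = star x y + star x y';
  pseudo_bilinear : forall (h g : H) (x y : A),
    star (h *: x) (g *: y) = pact (h \ox g) (star x y) }.

Variable star : A -> A -> A2.

(** The extensions of [star] to [A2 (x) A] and [A (x) A2]; [ktassoc (1 \ox b)]
    is [1 (x) b] in [H (x) H (x) H].  That the lifted maps are balanced, hence that
    these are well defined, is [starl_balanced] and [starr_balanced] below. *)
Definition starl (p : A2) (y : A) : A3 :=
  plift (fun b x =>
    plift (fun a c => ((b \ox (1 : H)) * delta_id a) \oxH c) (star x y)) p.

Definition starr (x : A) (p : A2) : A3 :=
  plift (fun b y =>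
    plift (fun a c => (ktassoc ((1 : H) \ox b) * id_delta a) \oxH c) (star x y)) p.

Definition pswap12 : A3 -> A3 := plift (fun a c => swap12 a \oxH c).

Definition left_preLie : Prop := forall x y z : A,
  starl (star x y) z - starr x (star y z) =
  pswap12 (starl (star y x) z - starr y (star x z)).

Hypothesis star_pseudo : pseudoproduct star.

Lemma starl_balanced_in (b : ktensor H H) : pbalanced (@delta k L)
  (fun a (c : A) => ((b \ox (1 : H)) * delta_id a) \oxH c : A3).
Proof.
have [dl _ dM] := delta_id_hom L.
have pb := ptens_balanced (@delta3 k L) A.
split=> [a a' c|a c c'|a h c].
- by rewrite (linD dl) mulrDr (balancedDl pb).
- exact: (balancedDr pb).
- by rewrite dM mulrA (balancedA pb).
Qed.

Lemma starr_balanced_in (b : ktensor H H) : pbalanced (@delta k L)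
  (fun a (c : A) => (ktassoc ((1 : H) \ox b) * id_delta a) \oxH c : A3).
Proof.
have [dl _ dM] := id_delta_hom L.
have pb := ptens_balanced (@delta3 k L) A.
split=> [a a' c|a c c'|a h c].
- by rewrite (linD dl) mulrDr (balancedDl pb).
- exact: (balancedDr pb).
- by rewrite dM delta_coassoc mulrA (balancedA pb).
Qed.

Lemma pswap12_balanced : pbalanced (@delta3 k L)
  (fun a (c : A) => swap12 a \oxH c : A3).
Proof.
have [sl _ sM] := swap12_hom L.
have pb := ptens_balanced (@delta3 k L) A.
split=> [a a' c|a c c'|a h c].
- by rewrite (linD sl) (balancedDl pb).
- exact: (balancedDr pb).
- by rewrite sM swap12_delta3 (balancedA pb).
Qed.

Lemma starl_balanced y : pbalanced (@delta k L) (fun b x =>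
  plift (fun a c => ((b \ox (1 : H)) * delta_id a) \oxH c : A3) (star x y)).
Proof.
have pb := ptens_balanced (@delta3 k L) A.
split=> [b b' x|b x x'|b h x].
- elim/ptensor_ind: (star x y) => [|p q hp hq|a c].
  + by rewrite !plift0 ?addr0 //; apply: starl_balanced_in.
  + rewrite !(pliftD _ _ (starl_balanced_in _)) hp hq.
    by rewrite addrACA.
  + rewrite !(pliftE _ _ (starl_balanced_in _)).
    by rewrite ktensDl mulrDl (balancedDl pb).
- by rewrite (pseudoDl star_pseudo) (pliftD _ _ (starl_balanced_in _)).
- have := pseudo_bilinear star_pseudo h 1 x y; rewrite scale1r => ->.
  elim/ptensor_ind: (star x y) => [|p q hp hq|a c].
  + rewrite /pact (plift0 (pact_balanced _ _ _)).
    by rewrite !plift0 //; apply: starl_balanced_in.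
  + rewrite /pact (pliftD _ _ (pact_balanced _ _ _)).
    by rewrite !(pliftD _ _ (starl_balanced_in _)) hp hq.
  + rewrite pactE !(pliftE _ _ (starl_balanced_in _)).
    have [_ _ ->] := delta_id_hom L.
    rewrite {2}/delta_id ktmapE //; last by have [] := delta_hom L.
    by rewrite mulrA mul_ktens mulr1.
Qed.

Lemma starr_balanced x : pbalanced (@delta k L) (fun b y =>
  plift (fun a c => (ktassoc ((1 : H) \ox b) * id_delta a) \oxH c : A3) (star x y)).
Proof.
have pb := ptens_balanced (@delta3 k L) A.
have [al _ aM] := ktassoc_hom H H H.
split=> [b b' y|b y y'|b h y].
- elim/ptensor_ind: (star x y) => [|p q hp hq|a c].
  + by rewrite !plift0 ?addr0 //; apply: starr_balanced_in.
  + rewrite !(pliftD _ _ (starr_balanced_in _)) hp hq.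
    by rewrite addrACA.
  + rewrite !(pliftE _ _ (starr_balanced_in _)).
    by rewrite ktensDr (linD al) mulrDl (balancedDl pb).
- by rewrite (pseudoDr star_pseudo) (pliftD _ _ (starr_balanced_in _)).
- have := pseudo_bilinear star_pseudo 1 h x y; rewrite scale1r => ->.
  elim/ptensor_ind: (star x y) => [|p q hp hq|a c].
  + rewrite /pact (plift0 (pact_balanced _ _ _)).
    by rewrite !plift0 //; apply: starr_balanced_in.
  + rewrite /pact (pliftD _ _ (pact_balanced _ _ _)).
    by rewrite !(pliftD _ _ (starr_balanced_in _)) hp hq.
  + rewrite pactE !(pliftE _ _ (starr_balanced_in _)).
    have [_ _ ->] := id_delta_hom L.
    rewrite {2}/id_delta ktmapE //; last by have [] := delta_hom L.
    have -> : (1 : H) \ox (b * delta h) = ((1 : H) \ox b) * (1 \ox delta h).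
      by rewrite mul_ktens mulr1.
    by rewrite aM mulrA.
Qed.

Lemma starl_ptens b x y : starl (b \oxH x) y =
  plift (fun a c => ((b \ox (1 : H)) * delta_id a) \oxH c) (star x y).
Proof. exact: pliftE (starl_balanced y). Qed.

Lemma starr_ptens b x y : starr x (b \oxH y) =
  plift (fun a c => (ktassoc ((1 : H) \ox b) * id_delta a) \oxH c) (star x y).
Proof. exact: pliftE (starr_balanced x). Qed.

Lemma pswap12_ptens a c : pswap12 (a \oxH c) = swap12 a \oxH c.
Proof. exact: pliftE pswap12_balanced. Qed.

Lemma starl_ptens2 b x y a c : star x y = a \oxH c ->
  starl (b \oxH x) y = ((b \ox (1 : H)) * delta_id a) \oxH c.
Proof.
by rewrite starl_ptens => ->; apply: pliftE; apply: starl_balanced_in.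
Qed.

Lemma starr_ptens2 b x y a c : star x y = a \oxH c ->
  starr x (b \oxH y) = (ktassoc ((1 : H) \ox b) * id_delta a) \oxH c.
Proof.
by rewrite starr_ptens => ->; apply: pliftE; apply: starr_balanced_in.
Qed.

End Pseudoalgebra.

Definition module_basis2 (R : pzRingType) (M : lmodType R) (e1 e2 : M) : Prop :=
  bijective (fun a : R * R => a.1 *: e1 + a.2 *: e2).

(* Main.v *)
From HB Require Import structures.
Require Import Defs.
From mathcomp Require Import all_boot all_order all_algebra.
From mathcomp Require Import boolp functions.
From mathcomp Require Import mpoly zify ring.

Set Implicit Arguments.
Unset Strict Implicit.
Unset Printing Implicit Defensive.

Import GRing.Theory Order.TTheory.
Local Open Scope ring_scope.

(** Write [H] for the enveloping algebra and

      e1 * e2 = a e1 + b e2,    e2 * e1 = c e1 + d e2,    e2 * e2 = alpha e2,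

    with [a], [b], [c], [d] in [H (x) H].  The pre-Lie identity is [H]-linear
    in its three arguments, so it may be tested on [e1] and [e2]; comparing
    the coefficients of [e1] and [e2] turns it into equations between elements
    of [H (x) H (x) H] ([left_preLie_coord]).  They involve the images of
    [a], [b], [c], [d] under the four homomorphisms [in12], [in23],
    [delta_id], [id_delta] and the exchange [swap12] of the first two factors.

    Such equations are solved by comparing leading terms in one of the three
    factors.  By the Poincare-Birkhoff-Witt theorem ordered monomials form a
    basis of [H], and multiplication adds the leading exponents and multiplies
    the leading coefficients ([lead_mul]).  The four homomorphisms, seen in a
    fixed factor, preserve leading exponents and have a simple effect on
    leading coefficients ([lead_hom]).  The basis of the Lie algebra is chosen
    with [s] as its smallest element, so that nothing lies between the
    exponents of [1] and of [s].

    - The product of the images of [b] has in the second factor the degrees of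
      both factors of [b] on one side of its equation, and only one of them on
      the other; hence [b = f (x) 1].  The next equation then forces [d = 0]
      because it doubles the degree of [d] on one side only.
    - Now [f = 0] or [c = 0], and if [c = 0] then the coefficient of [s] in the
      third factor of another equation is [f (x) 1], so [f = 0] and [b = 0].
    - Either [c = 0], and then also [a = 0], or [c = f (x) 1 + 1 (x) s] where
      [(1 (x) s - s (x) 1) Delta(f) = 1 (x) f s - f s (x) 1].  In
      characteristic zero the solutions of this equation are the affine
      elements [f = l s + c'] ([affine_equation]).
    - In the second case [a = 1 (x) h] by degrees in the first factor.  By
      degrees in the second factor of [a], either [h] is a scalar [r], and the
      equation says [r (r - t) = 0], or [h = s + t].

    Conversely, in all these cases only the three copies of [s] in
    [H (x) H (x) H] occur; they commute, and the equations are identities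
    between polynomials.

    The Poincare-Birkhoff-Witt theorem itself is obtained from straightening:
    a function on decreasing words extends to all words in a way compatible
    with the relations of [H], by the diamond lemma ([diamond]), and right
    translation of such extensions represents [H] ([word_action_hom]).  The
    coordinates of an element of [H] are read off from this representation. *)

(** * Linear operators on functions of words *)

Section WordOperators.
Variables (k : fieldType) (T : Type).
Local Notation V := (seq T -> k^o).

Definition linear_operator : {pred V -> V} := fun f => `[< linear f >].

(** The endomorphism algebra to which a representation on functions of words
    is to be extended; bundling the linearity makes it an [algType]. *)
Record operator := Operator {
  operator_fun :> V -> V; _ : operator_fun \in linear_operator }.

HB.instance Definition _ := [isSub for operator_fun].
HB.instance Definition _ := [Choice of operator by <:].

Fact linear_operator_submod : submod_closed linear_operator.
Proof.
split; first by apply/asboolP => c f g /=; rewrite scaler0 addr0.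
move=> a f g /asboolP lf /asboolP lg; apply/asboolP => c u v.
rewrite /= -[(a *: f + g) _]/(a *: f _ + g _) lf lg.
rewrite -[(a *: f + g) u]/(a *: f u + g u) -[(a *: f + g) v]/(a *: f v + g v).
rewrite !scalerDr addrACA !scalerA [a * c]mulrC; congr (_ + _ + _).
Qed.

HB.instance Definition _ :=
  GRing.isSubmodClosed.Build k (V -> V) linear_operator linear_operator_submod.
HB.instance Definition _ := [SubChoice_isSubLmodule of operator by <:].

Lemma operatorP (f : operator) : linear f.
Proof. by case: f => f /= /asboolP. Qed.

Fact id_operator : (id : V -> V) \in linear_operator.
Proof. by apply/asboolP. Qed.

Fact comp_operator (f g : operator) : f \o g \in linear_operator.
Proof. by apply/asboolP => c u v /=; rewrite !operatorP. Qed.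

Definition opmul (f g : operator) := Operator (comp_operator f g).

Let opP (f g : operator) : f =1 g -> f = g.
Proof. by move=> e; apply/val_inj/funext. Qed.

Fact opmulA : associative opmul. Proof. by move=> f g h; apply: opP. Qed.
Fact opmul1 : left_id (Operator id_operator) opmul.
Proof. by move=> f; apply: opP. Qed.
Fact op1mul : right_id (Operator id_operator) opmul.
Proof. by move=> f; apply: opP. Qed.
Fact opmulDl : left_distributive opmul +%R.
Proof. by move=> f g h; apply: opP. Qed.
Fact opmulDr : right_distributive opmul +%R.
Proof. by move=> f g h; apply: opP => v /=; exact: (linD (operatorP f)). Qed.
Fact op1_neq0 : Operator id_operator != 0.
Proof.
apply/eqP => /(congr1 (fun f : operator => f (fun=> 1) [::])) /eqP.
by rewrite /= oner_eq0.
Qed.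

HB.instance Definition _ := GRing.Zmodule_isNzRing.Build operator
  opmulA opmul1 op1mul opmulDl opmulDr op1_neq0.

Fact opscaleAl (c : k) (f g : operator) : c *: (f * g) = (c *: f) * g.
Proof. by apply: opP. Qed.
HB.instance Definition _ := GRing.Lmodule_isLalgebra.Build k operator opscaleAl.

Fact opscaleAr (c : k) (f g : operator) : c *: (f * g) = f * (c *: g).
Proof. by apply: opP => v; rewrite -[RHS]/(f (c *: g v)) (linZ (operatorP f)). Qed.
HB.instance Definition _ := GRing.Lalgebra_isAlgebra.Build k operator opscaleAr.

End WordOperators.

(** * Straightening of words *)

Record lie_basis (k : fieldType) (L : lieAlgType k) (n : nat) := LieBasis {
  bvec : 'I_n -> L;
  bcoord : L -> 'I_n -> k;
  bcoord_linear : forall i, linear (fun y => bcoord y i : k^o);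
  bcoord_sum : forall y, y = \sum_i bcoord y i *: bvec i;
  bcoord_bvec : forall i j, bcoord (bvec i) j = (i == j)%:R }.

Section Straightening.
Variables (k : fieldType) (L : lieAlgType k) (n : nat) (B : lie_basis L n).
Local Notation I := 'I_n.
Local Notation x := (bvec B).
Local Notation co := (bcoord B).
Local Notation co_lin := (@bcoord_linear _ _ _ B).
Local Notation coE := (@bcoord_sum _ _ _ B).

Implicit Types (u v w : seq I) (i j h l : I) (N : seq I -> k) (y z : L).

(** A weight that decreases when two adjacent letters [i < j] are exchanged and
    when two adjacent letters are replaced by one: letters, shifted by one, are
    digits in base [n.+1], and later letters are more significant. *)
Definition weight w : nat := foldr (fun i m => (i.+1 + n.+1 * m)%N) 0%N w.

Lemma weight_cat u v v' :
  (weight v < weight v')%N -> (weight (u ++ v) < weight (u ++ v'))%N.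
Proof. by move=> h; elim: u => //= i u IH; rewrite ltn_add2l ltn_pmul2l. Qed.

Lemma weight_swap u i j v : (i < j)%N ->
  (weight (u ++ j :: i :: v) < weight (u ++ i :: j :: v))%N.
Proof.
move=> h; apply: weight_cat => /=; have := ltn_ord j; move: (weight v) => V.
by move=> jn; rewrite !mulnDr !addnA ltn_add2r; nia.
Qed.

Lemma weight_drop u i j l v : (weight (u ++ l :: v) < weight (u ++ i :: j :: v))%N.
Proof.
apply: weight_cat => /=; have := ltn_ord l; move: (weight v) => V ln.
have : (n.+1 * V <= n.+1 * (n.+1 * V))%N by rewrite leq_pmull.
by rewrite !mulnDr; nia.
Qed.

Lemma weight_drop3 u i j h l l' v :
  (weight (u ++ l :: l' :: v) < weight (u ++ i :: j :: h :: v))%N.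
Proof.
apply: weight_cat => /=; have := ltn_ord l; have := ltn_ord l'; move: (weight v) => V ln l'n.
have : (n.+1 * (n.+1 * V) <= n.+1 * (n.+1 * (n.+1 * V)))%N by rewrite leq_pmull.
have : (n.+1 * l'.+1 <= n.+1 * n)%N by rewrite leq_pmul2l.
have : (n.+1 * n.+1 <= n.+1 * (n.+1 * h.+1))%N by rewrite leq_pmul2l // leq_pmulr.
rewrite !mulnDr; lia.
Qed.

(** The multilinear extension of [N] to words in which one letter is replaced
    by an arbitrary vector [y]. *)
Definition ins N u y v : k := \sum_l co y l * N (u ++ l :: v).

Lemma insD N u v y z : ins N u (y + z) v = ins N u y v + ins N u z v.
Proof.
rewrite /ins -big_split; apply: eq_bigr => l _.
have := co_lin l 1 y z; rewrite !scale1r => ->; exact: mulrDl.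
Qed.

Lemma insN N u v y : ins N u (- y) v = - ins N u y v.
Proof.
rewrite /ins -sumrN; apply: eq_bigr => l _.
by have /linZ := co_lin l => /(_ (-1) y); rewrite !scaleN1r => ->; rewrite mulNr.
Qed.

Lemma ins0 N u v : ins N u 0 v = 0.
Proof. by have := insD N u v 0 0; rewrite add0r -{1}[ins _ _ _ _]addr0 => /addrI. Qed.

Lemma insZ N u v c y : ins N u (c *: y) v = c * ins N u y v.
Proof.
rewrite /ins mulr_sumr; apply: eq_bigr => l _.
by have /linZ := co_lin l => /(_ c y) ->; rewrite mulrA.
Qed.

Lemma ins_sum N u v (f : I -> L) :
  ins N u (\sum_i f i) v = \sum_i ins N u (f i) v.
Proof. exact: (big_morph (fun z => ins N u z v) (insD N u v) (ins0 N u v)). Qed.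

Lemma lie_suml (f : I -> L) z : lie (\sum_i f i) z = \sum_i lie (f i) z.
Proof.
exact: (big_morph (fun y => lie y z) (linD (lie_linearl _)) (lin0 (lie_linearl _))).
Qed.

Lemma lie_sumr (f : I -> L) z : lie z (\sum_i f i) = \sum_i lie z (f i).
Proof.
exact: (big_morph (lie z) (linD (lie_linearr _)) (lin0 (lie_linearr _))).
Qed.

Lemma lieNC y z : lie y z = - lie z y.
Proof.
apply/eqP; rewrite -addr_eq0; have := lie_alternating (y + z).
rewrite (linD (lie_linearl (y + z))) !(linD (lie_linearr _)) !lie_alternating.
by rewrite add0r addr0 => ->.
Qed.

Definition ascent w (t : seq I * I * I * seq I) : Prop :=
  let: (u, i, j, v) := t in w = u ++ i :: j :: v /\ (i < j)%N.

(** The value that the relation [x i * x j = x j * x i + lie (x i) (x j)] forces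
    on a word at one of its ascents. *)
Definition straighten N (t : seq I * I * I * seq I) : k :=
  let: (u, i, j, v) := t in N (u ++ j :: i :: v) + ins N u (lie (x i) (x j)) v.

Section Construct.
Variable g : seq I -> k.

(** An arbitrary ascent is chosen at each step, and [m] bounds the number of
    steps; words without ascent take their value from [g]. *)
Fixpoint straighten_upto m w : k :=
  if m is m'.+1 then
    if pselect (exists t, ascent w t) is left ex
    then straighten (straighten_upto m') (projT1 (cid ex)) else g w
  else g w.

Lemma straighten_ext N N' w t : ascent w t ->
  (forall w', (weight w' < weight w)%N -> N w' = N' w') -> straighten N t = straighten N' t.
Proof.
case: t => [[[u i] j] v] [-> hij] hN /=; rewrite hN ?weight_swap //; congr (_ + _).
by apply: eq_bigr => l _; rewrite hN ?weight_drop.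
Qed.

Lemma straighten_upto_enough m m' w : (weight w <= m)%N -> (weight w <= m')%N ->
  straighten_upto m w = straighten_upto m' w.
Proof.
elim: m m' w => [|m IH] [|m'] w //=.
- rewrite leqn0 => h0 _; case: pselect => // ex; exfalso.
  case: ex => -[[[u i] j] v] [e _].
  by move: h0; rewrite e; case: u {e} => /=; nia.
- move=> _; rewrite leqn0 => h0; case: pselect => // ex; exfalso.
  case: ex => -[[[u i] j] v] [e _].
  by move: h0; rewrite e; case: u {e} => /=; nia.
- move=> h h'; case: pselect => // ex; apply: straighten_ext (projT2 (cid ex)) _.
  by move=> w' hw'; apply: IH; lia.
Qed.

Definition normal w : k := straighten_upto (weight w) w.

Lemma normal_step w : (exists t, ascent w t) ->
  exists2 t, ascent w t & normal w = straighten normal t.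
Proof.
move=> ex; rewrite /normal; case E: (weight w) => [|m] /=.
  exfalso; case: ex => -[[[u i] j] v] [e _].
  by move: E; rewrite e; case: u {e} => /=; nia.
case: pselect => [ex'|] //; case: (cid ex') => t ht /=; exists t => //.
apply: (straighten_ext ht) => w' hw'; apply: straighten_upto_enough; lia.
Qed.

Lemma normal_irred w : ~ (exists t, ascent w t) -> normal w = g w.
Proof. by rewrite /normal; case: (weight w) => [|m] //= h; case: pselect. Qed.

Section Diamond.
Variable M : nat.
Local Notation N := normal.
Hypothesis IH : forall w, (weight w < M)%N -> forall t, ascent w t -> N w = straighten N t.

Lemma IHswap u i j v : (weight (u ++ i :: j :: v) < M)%N -> (i < j)%N ->
  N (u ++ i :: j :: v) = N (u ++ j :: i :: v) + ins N u (lie (x i) (x j)) v.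
Proof. by move=> h hij; apply: (IH h (t := (u, i, j, v))). Qed.

Lemma IHcomm u i j v :
  (weight (u ++ i :: j :: v) < M)%N -> (weight (u ++ j :: i :: v) < M)%N ->
  N (u ++ i :: j :: v) - N (u ++ j :: i :: v) = ins N u (lie (x i) (x j)) v.
Proof.
move=> h h'; case: (ltngtP i j) => [ij|ji|/val_inj ->].
- by rewrite (IHswap h ij) addrAC subrr add0r.
- by rewrite (IHswap h' ji) [lie (x i) _]lieNC insN opprD addrA subrr sub0r.
- by rewrite subrr lie_alternating ins0.
Qed.

Lemma ins_comm u y h v :
  (forall l, weight (u ++ l :: h :: v) < M)%N -> (forall l, weight (u ++ h :: l :: v) < M)%N ->
  ins N u y (h :: v) - ins N (u ++ [:: h]) y v = ins N u (lie y (x h)) v.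
Proof.
move=> h1 h2; have -> : lie y (x h) = \sum_l co y l *: lie (x l) (x h).
  by rewrite {1}(coE y) lie_suml; apply: eq_bigr => l _; exact: (linZ (lie_linearl _)).
rewrite ins_sum [in LHS]/ins -sumrB; apply: eq_bigr => l _.
by rewrite -catA /= insZ -IHcomm // mulrBr.
Qed.

(** Straightening from either ascent leads to the letters [h], [j], [i]; the
    difference of the commutator terms collected on the two ways vanishes by the
    Jacobi identity. *)
Lemma diamond_overlap u i j h v : weight (u ++ i :: j :: h :: v) = M ->
  (i < j)%N -> (j < h)%N ->
  straighten N (u, i, j, h :: v) = straighten N (u ++ [:: i], j, h, v).
Proof.
move=> eM ij jh; have ih := ltn_trans ij jh.
have lt1 : (weight (u ++ j :: i :: h :: v) < M)%N by rewrite -eM weight_swap.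
have lt2 : (weight (u ++ j :: h :: i :: v) < M)%N.
  apply: ltn_trans lt1; have := weight_swap (u ++ [:: j]) v ih.
  by rewrite -!catA.
have lt3 : (weight (u ++ i :: h :: j :: v) < M)%N.
  by rewrite -eM; have := weight_swap (u ++ [:: i]) v jh; rewrite -!catA.
have lt4 : (weight (u ++ h :: i :: j :: v) < M)%N.
  by apply: ltn_trans lt3; apply: weight_swap.
have e1 : N (u ++ j :: i :: h :: v) =
    N (u ++ j :: h :: i :: v) + ins N (u ++ [:: j]) (lie (x i) (x h)) v.
  have := @IHswap (u ++ [:: j]) i h v; rewrite -!catA /=; exact.
have e2 := IHswap lt2 jh; have e3 := IHswap lt3 ih.
have e4 : N (u ++ h :: i :: j :: v) =
    N (u ++ h :: j :: i :: v) + ins N (u ++ [:: h]) (lie (x i) (x j)) v.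
  have := @IHswap (u ++ [:: h]) i j v; rewrite -!catA /=; exact.
rewrite /straighten -!catA /= e1 e2 e3 e4.
have small l l' : (weight (u ++ l :: l' :: v) < M)%N by rewrite -eM weight_drop3.
have c1 := @ins_comm u (lie (x i) (x j)) h v (fun l => small l h) (fun l => small h l).
have c2 := @ins_comm u (lie (x i) (x h)) j v (fun l => small l j) (fun l => small j l).
have c3 := @ins_comm u (lie (x j) (x h)) i v (fun l => small l i) (fun l => small i l).
have : ins N u (lie (lie (x i) (x j)) (x h)) v
     - ins N u (lie (lie (x i) (x h)) (x j)) v
     + ins N u (lie (lie (x j) (x h)) (x i)) v = 0.
  rewrite -insN -!insD -[RHS](ins0 N u v); congr (ins N u _ v).
  have lieNr y z : lie y (- z) = - lie y z.
    by rewrite -[- z]scaleN1r (linZ (lie_linearr _)) scaleN1r.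
  rewrite (lieNC (lie _ _) (x h)) (lieNC (lie _ _) (x j)) (lieNC (lie _ _) (x i)).
  rewrite (lieNC (x i) (x h)) lieNr opprK -opprD -opprD; apply/eqP.
  rewrite oppr_eq0 -(lie_jacobi (x i) (x j) (x h)).
  by apply/eqP; rewrite addrC [X in _ + X]addrC addrA.
rewrite -c1 -c2 -c3; move: (N (u ++ h :: j :: i :: v)).
do 6! move: (ins _ _ _ _); move=> a b c d e f q E.
apply/eqP; rewrite -subr_eq0 -E; apply/eqP; ring.
Qed.

(** Straightening at one place leaves the other ascent intact, and both orders
    yield the same four terms. *)
Lemma diamond_disjoint u i j (z : seq I) i' j' v :
  weight (u ++ i :: j :: z ++ i' :: j' :: v) = M -> (i < j)%N -> (i' < j')%N ->
  straighten N (u, i, j, z ++ i' :: j' :: v) =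
  straighten N (u ++ i :: j :: z, i', j', v).
Proof.
move=> eM ij ij'.
have swapR w : (weight (w ++ z ++ i' :: j' :: v) < M)%N ->
    N (w ++ z ++ i' :: j' :: v) = N (w ++ z ++ j' :: i' :: v) +
      ins N (w ++ z) (lie (x i') (x j')) v.
  by rewrite !catA => h; rewrite IHswap.
have lt1 : (weight (u ++ j :: i :: z ++ i' :: j' :: v) < M)%N.
  by rewrite -eM weight_swap.
have lt2 : (weight (u ++ i :: j :: z ++ j' :: i' :: v) < M)%N.
  by rewrite -eM; have := weight_swap (u ++ i :: j :: z) v ij'; rewrite -!catA.
have lt3 l : (weight (u ++ l :: z ++ i' :: j' :: v) < M)%N.
  by rewrite -eM weight_drop.
have lt4 l : (weight (u ++ i :: j :: z ++ l :: v) < M)%N.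
  by rewrite -eM; have := weight_drop (u ++ i :: j :: z) i' j' l v; rewrite -!catA.
rewrite /straighten -!catA /= (IHswap lt2 ij).
have -> : N (u ++ j :: i :: z ++ i' :: j' :: v) =
    N (u ++ j :: i :: z ++ j' :: i' :: v) +
      ins N (u ++ j :: i :: z) (lie (x i') (x j')) v.
  by have := swapR (u ++ [:: j; i]); rewrite -!catA /=; apply.
rewrite -!addrA; congr (_ + _); rewrite [ins N u _ (z ++ i' :: _)]/ins.
have -> : \sum_l co (lie (x i) (x j)) l * N (u ++ l :: z ++ i' :: j' :: v) =
    ins N u (lie (x i) (x j)) (z ++ j' :: i' :: v) +
    \sum_l co (lie (x i) (x j)) l * ins N (u ++ l :: z) (lie (x i') (x j')) v.
  rewrite [ins N u _ (z ++ j' :: _)]/ins -big_split.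
  apply: eq_bigr => l _ /=; rewrite -mulrDr; congr (_ * _).
  by have := swapR (u ++ [:: l]); rewrite -!catA /=; apply.
have -> : ins N (u ++ i :: j :: z) (lie (x i') (x j')) v =
    ins N (u ++ j :: i :: z) (lie (x i') (x j')) v +
    \sum_l co (lie (x i') (x j')) l * ins N u (lie (x i) (x j)) (z ++ l :: v).
  rewrite {1 2}/ins -big_split.
  apply: eq_bigr => l _ /=; rewrite -mulrDr; congr (_ * _).
  by rewrite -!catA /= IHswap.
rewrite addrCA; congr (_ + (_ + _)).
rewrite /ins; under eq_bigr do rewrite mulr_sumr.
rewrite exchange_big; apply: eq_bigr => l' _ /=; rewrite mulr_sumr.
by apply: eq_bigr => l _; rewrite mulrCA -!catA.
Qed.

Lemma two_ascents u i j v u' i' j' v' : u ++ i :: j :: v = u' ++ i' :: j' :: v' ->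
  (size u <= size u')%N ->
  [\/ [/\ u = u', i = i', j = j' & v = v'],
      u' = u ++ [:: i] /\ v = j' :: v' /\ j = i' |
      exists z : seq I, u' = u ++ i :: j :: z /\ v = z ++ i' :: j' :: v'].
Proof.
elim: u u' => [|a u IHu] [|b u'] //=.
- by case=> -> -> -> _; apply: Or31.
- case: u' => [|b' u'] [<-]; first by case=> <- <- _; apply: Or32.
  by case=> <- -> _; apply: Or33; exists u'.
- move=> [<-] /IHu h /h [[-> -> -> ->]|[-> [-> ->]]|[z [-> ->]]].
  + exact: Or31.
  + exact: Or32.
  + by apply: Or33; exists z.
Qed.

Lemma diamond w t t' : weight w = M -> ascent w t -> ascent w t' ->
  straighten N t = straighten N t'.
Proof.
wlog: t t' / (size t.1.1.1 <= size t'.1.1.1)%N => [hw|].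
  have [le|/ltnW le] := leqP (size t.1.1.1) (size t'.1.1.1); first exact: hw.
  by move=> eM d d'; rewrite (hw _ _ le eM d' d).
case: t t' => [[[u i] j] v] [[[u' i'] j'] v'] le eM [e ij] [e' ij'].
rewrite e in e' eM; case: (two_ascents e' le) => [[-> -> -> ->]//|[-> [eq1 eq2]]|[z [-> eq]]].
  by move: eM ij; rewrite eq1 eq2 => eM ij; apply: diamond_overlap.
by move: eM; rewrite eq => eM; apply: diamond_disjoint.
Qed.

End Diamond.

(** Independence of the chosen ascent, by induction on the weight: the choice
    made by [normal] and any other one agree by [diamond]. *)
Lemma normal_straighten w t : ascent w t -> normal w = straighten normal t.
Proof.
move: {2}(weight w) (erefl (weight w)) => m; elim/ltn_ind: m w t => m IH w t eM d.
have [|t' d' ->] := @normal_step w; first by exists t.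
by apply: (diamond _ eM d' d) => w' lt t'' d''; exact: IH lt _ _ erefl d''.
Qed.

Lemma normal_comm u i j v :
  normal (u ++ i :: j :: v) - normal (u ++ j :: i :: v) =
  ins normal u (lie (x i) (x j)) v.
Proof.
pose M := (weight (u ++ i :: j :: v) + weight (u ++ j :: i :: v)).+1.
apply: (@IHcomm M) => [w _ t||]; rewrite /M; [exact: normal_straighten|lia|lia].
Qed.
End Construct.

Definition decreasing w := sorted (fun i j => (j <= i)%N) w.

Lemma decreasing_or_ascent w : decreasing w \/ exists t, ascent w t.
Proof.
case: (boolP (decreasing w)) => [|ns]; [by left|right].
elim: w ns => // i [|j w] IH //; rewrite /decreasing /= -/(decreasing (j :: w)) negb_and.
case/orP => [|/IH [[[[u i'] j'] v] [e h]]].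
  by rewrite -ltnNge => h; exists ([::], i, j, w).
by exists (i :: u, i', j', v); split=> //; rewrite e.
Qed.

Lemma decreasing_irred w : decreasing w -> ~ exists t, ascent w t.
Proof.
move=> sw [[[[u i] j] v] [e lt]]; move: sw; rewrite /decreasing e.
by move=> /cat_sorted2 [_] /=; rewrite leqNgt lt.
Qed.

(** The functionals on the free algebra that factor through the enveloping
    algebra. *)
Definition commuting N := forall u i j v,
  N (u ++ i :: j :: v) - N (u ++ j :: i :: v) = ins N u (lie (x i) (x j)) v.

Lemma commuting_uniq N N' : commuting N -> commuting N' ->
  (forall w, decreasing w -> N w = N' w) -> N =1 N'.
Proof.
move=> cN cN' e w; move: {2}(weight w) (erefl (weight w)) => m.
elim/ltn_ind: m w => m IH w eM; case: (decreasing_or_ascent w) => [/e//|].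
case=> -[[[u i] j] v] [ew lt]; rewrite ew in eM *.
rewrite -(subrK (N (u ++ j :: i :: v)) (N _)) cN.
rewrite -(subrK (N' (u ++ j :: i :: v)) (N' _)) cN'.
rewrite (IH (weight (u ++ j :: i :: v)) _ _ erefl) -?eM ?weight_swap //; congr (_ + _).
by apply: eq_bigr => l _; rewrite (IH _ _ _ erefl) // -eM weight_drop.
Qed.

Local Notation V := (seq I -> k^o).

Lemma normal_linear w : linear (fun g : V => normal g w : k^o).
Proof.
move=> c g g'; apply: (@commuting_uniq _ (fun w => c * normal g w + normal g' w)).
- exact: normal_comm.
- move=> u i j v; rewrite /ins.
  under eq_bigr do rewrite mulrDr mulrCA.
  by rewrite big_split -mulr_sumr -!/(ins _ _ _ _) -!normal_comm /=; ring.
- by move=> {}w sw; rewrite !normal_irred //; apply: decreasing_irred.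
Qed.

Fact word_action_operator y :
  (fun (g : V) w => ins (normal g) w y [::] : k^o) \in @linear_operator k I.
Proof.
apply/asboolP => c g g'; apply/funext => w.
rewrite -[RHS]/(c * ins (normal g) w y [::] + ins (normal g') w y [::]).
rewrite {2}/ins mulr_sumr -big_split; apply: eq_bigr => l _ /=.
have e := normal_linear (w ++ [:: l]) c g g'; rewrite e.
by rewrite mulrDr; congr (_ + _); exact: mulrCA.
Qed.

(** Right translation by [y] of the extension [normal g].  This extension
    respects the relations of the enveloping algebra, hence so does the
    action. *)
Definition word_action y : operator k I := Operator (word_action_operator y).

(** Both sides respect the relations, so it suffices to compare them on
    decreasing words, where [normal] is the identity. *)
Lemma normal_action y g w : normal (word_action y g) w = ins (normal g) w y [::].
Proof.
move: w; apply: commuting_uniq => [|u i j v|w sw]; first exact: normal_comm.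
  rewrite /ins -sumrB; transitivity (\sum_l co y l *
      ins (normal g) u (lie (x i) (x j)) (v ++ [:: l])).
    apply: eq_bigr => l _; rewrite -normal_comm -!catA /= -mulrBr //.
  rewrite /ins; under eq_bigr do rewrite mulr_sumr.
  rewrite exchange_big; apply: eq_bigr => l' _ /=; rewrite mulr_sumr.
  by apply: eq_bigr => l _; rewrite mulrCA -!catA.
by rewrite normal_irred //; apply: decreasing_irred.
Qed.

Lemma word_action_hom : lie_hom word_action.
Proof.
split=> [c y z|y z]; apply/val_inj/funext => g; apply/funext => w.
  rewrite -[RHS]/(c * ins (normal g) w y [::] + ins (normal g) w z [::]).
  by rewrite -[LHS]/(ins (normal g) w (c *: y + z) [::]) insD insZ.
rewrite -[LHS]/(ins (normal g) w (lie y z) [::]).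
rewrite -[RHS]/(ins (normal (word_action z g)) w y [::] -
                ins (normal (word_action y g)) w z [::]) /ins.
under [X in _ = X - _]eq_bigr do rewrite normal_action.
under [X in _ = _ - X]eq_bigr do rewrite normal_action.
under [X in _ = X - _]eq_bigr do rewrite /ins mulr_sumr.
under [X in _ = _ - X]eq_bigr do rewrite /ins mulr_sumr.
rewrite [X in _ = _ - X]exchange_big -sumrB.
rewrite -/(ins (normal g) w (lie y z) [::]) [in LHS](coE y) lie_suml ins_sum.
apply: eq_bigr => l _; rewrite (linZ (lie_linearl _)) insZ.
rewrite {1}(coE z) lie_sumr ins_sum mulr_sumr -sumrB; apply: eq_bigr => m _.
rewrite (linZ (lie_linearr _)) insZ -normal_comm -!catA /=; ring.
Qed.
End Straightening.

(** * The Poincare-Birkhoff-Witt basis *)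

Section PBW.
Variables (k : fieldType) (L : lieAlgType k) (n : nat) (B : lie_basis L n).
Local Notation I := 'I_n.
Local Notation x := (bvec B).
Local Notation co := (bcoord B).
Local Notation coE := (@bcoord_sum _ _ _ B).
Local Notation cox := (@bcoord_bvec _ _ _ B).
Local Notation H := (uea L).
Local Notation M := 'X_{1..n}.
Local Notation rho := (word_action B).
Implicit Types (u v w : seq I) (i j l : I) (a b : M) (h : H).

Definition mon w : H := \prod_(i <- w) uea_in (x i).
Definition pbw a : H := mon (rev (m2s a)).

(** Functionals on the enveloping algebra, by evaluation at the empty word: each
    letter of a monomial appends itself to the argument, so that a monomial has
    the value of [normal g] at its word, see [wcoef_mon]. *)
Definition wcoef (g : seq I -> k) h : k := uea_lift rho h g [::].
Definition coef a h : k := wcoef (fun w => (s2m w == a)%:R) h.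

Lemma mon_cat u v : mon (u ++ v) = mon u * mon v.
Proof. exact: big_cat. Qed.

Lemma mon_cons i w : mon (i :: w) = uea_in (x i) * mon w.
Proof. exact: big_cons. Qed.

Lemma wcoef_mon g w : wcoef g (mon w) = normal B g w.
Proof.
have rhoE : uea_lift rho (mon w) = \prod_(i <- w) rho (x i).
  have [_ r1 rM] := uea_lift_hom (word_action_hom B).
  rewrite /mon (big_morph _ rM r1); apply: eq_bigr => i _.
  by apply: uea_lift_in; apply: word_action_hom.
have actE w' : normal B ((\prod_(i <- w) rho (x i) : operator k I) g) w' =
    normal B g (w' ++ w).
  elim: w w' {rhoE} => [|i w IH] w'; first by rewrite big_nil cats0.
  rewrite big_cons; set f := \prod_(j <- w) _.
  rewrite -[LHS]/(normal B (rho (x i) (f g)) w') normal_action /ins.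
  rewrite (bigD1 i) //= big1 => [|l li]; last by rewrite cox eq_sym (negPf li) mul0r.
  by rewrite cox eqxx mul1r addr0 IH -catA.
rewrite /wcoef rhoE -[RHS](actE [::]) normal_irred //.
by apply: decreasing_irred.
Qed.

Lemma wcoef_linear g : linear (wcoef g : H -> k^o).
Proof.
move=> c h h'; have [rl _ _] := uea_lift_hom (word_action_hom B).
by rewrite /wcoef rl.
Qed.

Lemma coef_linear a : linear (coef a : H -> k^o).
Proof. exact: wcoef_linear. Qed.

Lemma mon_straighten u i j v :
  mon (u ++ i :: j :: v) = mon (u ++ j :: i :: v) +
    \sum_l co (lie (x i) (x j)) l *: mon (u ++ l :: v).
Proof.
have [il iM] := uea_in_hom L.
have e : uea_in (x i) * uea_in (x j) = uea_in (x j) * uea_in (x i) +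
    \sum_l co (lie (x i) (x j)) l *: uea_in (x l).
  apply/eqP; rewrite addrC -subr_eq -iM {1}(coE (lie _ _)); apply/eqP.
  rewrite (big_morph _ (linD il) (lin0 il)).
  by apply: eq_bigr => l _; rewrite (linZ il).
rewrite !mon_cat !mon_cons (mulrA (uea_in (x i))) e mulrDl mulrDr -mulrA; congr (_ + _).
rewrite mulr_suml mulr_sumr; apply: eq_bigr => l _.
by rewrite mon_cat mon_cons -scalerAl -scalerAr.
Qed.

Lemma s2m_cat u v : s2m (u ++ v) = (s2m u + s2m v)%MM.
Proof. by apply/mnmP => i; rewrite !mnmE count_cat. Qed.

Lemma s2m_cons i w : s2m (i :: w) = (U_(i) + s2m w)%MM.
Proof. by apply/mnmP => j; rewrite !mnmE /= eq_sym. Qed.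

Lemma s2m0 : s2m [::] = 0%MM :> M.
Proof. by apply/mnmP => j; rewrite !mnmE. Qed.

Lemma mdeg_s2m w : mdeg (s2m w) = size w.
Proof. by elim: w => [|i w IH]; rewrite ?s2m0 ?mdeg0 // s2m_cons mdegD mdeg1 IH. Qed.

Lemma rev_m2s_decreasing a : decreasing (rev (m2s a)).
Proof. by rewrite /decreasing rev_sorted; have := srt_m2s a; rewrite sorted_map. Qed.

Lemma s2m_rev_m2s a : s2m (rev (m2s a)) = a.
Proof. by rewrite -{2}(s2mK a); apply/mnmP => i; rewrite !mnmE count_rev. Qed.

Lemma mon_decreasing w : decreasing w -> mon w = pbw (s2m w).
Proof.
move=> sw; congr mon; apply: (@sorted_eq _ (fun i j : I => (j <= i)%N)) => //.
- by move=> i j l /= h1 h2; apply: leq_trans h2 h1.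
- by move=> i j /= /anti_leq /val_inj.
- exact: rev_m2s_decreasing.
- apply/allP => i _ /=; have /mnmP/(_ i) := s2m_rev_m2s (s2m w).
  by rewrite !mnmE => ->.
Qed.

Lemma coef_decreasing a w : decreasing w -> coef a (mon w) = (s2m w == a)%:R.
Proof.
by move=> sw; rewrite /coef wcoef_mon normal_irred //; apply: decreasing_irred.
Qed.

Lemma coef_pbw a b : coef a (pbw b) = (b == a)%:R.
Proof. by rewrite coef_decreasing ?rev_m2s_decreasing // s2m_rev_m2s. Qed.

(** Induction along straightening: [P] may be assumed for the exchanged word and
    for all words that are shorter by one letter. *)
Lemma mon_ind (P : seq I -> Prop) : (forall w, decreasing w -> P w) ->
  (forall u i j v, P (u ++ j :: i :: v) -> (forall l, P (u ++ l :: v)) ->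
     P (u ++ i :: j :: v)) ->
  forall w, P w.
Proof.
move=> Ps Pd w; move: {2}(weight w) (erefl (weight w)) => m.
elim/ltn_ind: m w => m IH w eM; case: (decreasing_or_ascent w) => [/Ps//|].
case=> -[[[u i] j] v] [ew lt]; rewrite ew in eM *; apply: Pd.
  by apply: (IH _ _ _ erefl); rewrite -eM weight_swap.
by move=> l; apply: (IH _ _ _ erefl); rewrite -eM weight_drop.
Qed.

(** Ordered monomials span, because products of generators do and can be
    straightened. *)
Lemma pbw_ind (P : H -> Prop) : P 0 -> (forall h h', P h -> P h' -> P (h + h')) ->
  (forall c h, P h -> P (c *: h)) -> (forall a, P (pbw a)) -> forall h, P h.
Proof.
pose closed (P : H -> Prop) := [/\ P 0, forall h h', P h -> P h' -> P (h + h') &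
  forall c h, P h -> P (c *: h)].
suff span h : forall P, closed P -> (forall w, P (mon w)) -> P h.
  move=> P0 PD PZ Pp h; apply: span => // w; elim/mon_ind: w => [w sw|u i j v hs hd].
    by rewrite mon_decreasing.
  rewrite mon_straighten; apply: (PD) => //.
  apply: (big_ind P) => [||l _]; [exact: P0|exact: PD|].
  by apply: PZ.
elim/uea_ind: h => [y|c|h h' hh hh'|h h' hh hh'] {}P cP Pm; have [P0 PD PZ] := cP.
- have [il _] := uea_in_hom L.
  rewrite (coE y) (big_morph _ (linD il) (lin0 il)).
  apply: (big_ind P) => [||l _]; [exact: P0|exact: PD|].
  rewrite (linZ il); apply: PZ.
  by have := Pm [:: l]; rewrite mon_cons /mon big_nil mulr1.
- by apply: PZ; have := Pm [::]; rewrite /mon big_nil.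
- by apply: PD; [apply: hh|apply: hh'].
- apply: (hh (fun h => P (h * h'))) => [|w].
    split=> [|h1 h2 e1 e2|c h1 e1]; first by rewrite mul0r.
    + by rewrite mulrDl; apply: PD.
    + by rewrite -scalerAl; apply: PZ.
  apply: (hh' (fun h => P (mon w * h))) => [|w'].
    split=> [|h1 h2 e1 e2|c h1 e1]; first by rewrite mulr0.
    + by rewrite mulrDr; apply: PD.
    + by rewrite -scalerAr; apply: PZ.
  by rewrite -mon_cat.
Qed.

(** Straightening a word produces, besides the ordered monomial with the same
    letters, only shorter words. *)
Lemma coef_mon_ge a w : (s2m w <= a)%O -> coef a (mon w) = (s2m w == a)%:R.
Proof.
elim/mon_ind: w => [w sw _|u i j v hs hd le]; first exact: coef_decreasing.
have swE : s2m (u ++ i :: j :: v) = s2m (u ++ j :: i :: v).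
  by apply/mnmP => l; rewrite !s2m_cat !s2m_cons !mnmDE; lia.
have cl := coef_linear a.
rewrite mon_straighten (linD cl) hs -swE //.
have lt l : (s2m (u ++ l :: v) < a)%O.
  apply: lt_le_trans le; apply: lt_mdeg_ltmc.
  by rewrite !mdeg_s2m !size_cat /= !addnS.
rewrite (big_morph _ (linD cl) (lin0 cl)) big1 ?addr0 // => l _.
by rewrite (linZ cl) hd ?(ltW (lt l)) // (lt_eqF (lt l)) scaler0.
Qed.
End PBW.

(** * Leading terms in a tensor product *)

Lemma ktens0l (k : fieldType) (V W : lmodType k) (w : W) : (0 : V) \ox w = 0.
Proof. exact: balanced0l (@ktens_balanced _ _ _). Qed.

Lemma ktens0r (k : fieldType) (V W : lmodType k) (v : V) : v \ox (0 : W) = 0.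
Proof. by apply: (addIr (v \ox 0)); rewrite -ktensDr !add0r. Qed.

Section Lead.
Variables (k : fieldType) (L : lieAlgType k) (n : nat) (B : lie_basis L n).
Local Notation H := (uea L).
Local Notation M := 'X_{1..n}.
Local Notation x := (bvec B).
Implicit Types (a b c : M).

Section Coefficients.
Variable W : algType k.
Implicit Types (w : W) (u v : ktensor H W).

(** The second factor that accompanies the ordered monomial [a] in the first. *)
Definition tcoef a : ktensor H W -> W := klift (fun h w => coef B a h *: w).

Fact tcoef_balanced a : kbalanced (fun h w => coef B a h *: w).
Proof.
have cl := coef_linear B a; split=> [h h' w|h w w'|h c w].
- by rewrite (linD cl) scalerDl.
- exact: scalerDr.
- by rewrite (linZ cl) scalerA; congr (_ *: _); exact: mulrC.
Qed.

Lemma tcoefE a h w : tcoef a (h \ox w) = coef B a h *: w.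
Proof. exact: kliftE (tcoef_balanced a). Qed.

Lemma tcoef_linear a : linear (tcoef a).
Proof.
apply: klift_linear => [|w c h h' /=]; first exact: tcoef_balanced.
by rewrite (coef_linear B a) scalerDl -scalerA.
Qed.

(** The finite support may be enlarged, so that the expansions of two elements
    can be added. *)
Lemma tensor_expand u : exists s0 : seq M, forall s, uniq s -> {subset s0 <= s} ->
  u = \sum_(a <- s) pbw B a \ox tcoef a u.
Proof.
elim/ktensor_ind: u => [|u v [s1 h1] [s2 h2]|h w].
- exists [::] => s _ _; rewrite big1 // => a _.
  by rewrite (lin0 (tcoef_linear a)) ktens0r.
- exists (s1 ++ s2) => s us ss; rewrite {1}(h1 s) //; last first.
    by move=> a as1; apply: ss; rewrite mem_cat as1.
  rewrite {1}(h2 s) //; last by move=> a as2; apply: ss; rewrite mem_cat as2 orbT.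
  rewrite -big_split; apply: eq_bigr => a _ /=.
  by rewrite -ktensDr (linD (tcoef_linear a)).
- elim/(@pbw_ind _ _ _ B): h => [|h h' [s1 h1] [s2 h2]|c h [s1 h1]|b].
  + exists [::] => s _ _; rewrite big1 => [|a _].
      by rewrite ktens0l.
    by rewrite ktens0l (lin0 (tcoef_linear a)) ktens0r.
  + exists (s1 ++ s2) => s us ss; rewrite ktensDl {1}(h1 s) //; last first.
      by move=> a as1; apply: ss; rewrite mem_cat as1.
    rewrite {1}(h2 s) //; last by move=> a as2; apply: ss; rewrite mem_cat as2 orbT.
    rewrite -big_split; apply: eq_bigr => a _ /=.
    by rewrite -ktensDr (linD (tcoef_linear a)).
  + exists s1 => s us ss; rewrite -scale_ktens {1}(h1 s) // scaler_sumr.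
    apply: eq_bigr => a _ ; rewrite (linZ (tcoef_linear a)).
    by rewrite scale_ktens ktensZ.
  + exists [:: b] => s us ss; rewrite (bigD1_seq b) //=; last by apply: ss; rewrite inE.
    rewrite tcoefE coef_pbw eqxx scale1r big1 ?addr0 // => a ab.
    by rewrite tcoefE coef_pbw eq_sym (negPf ab) scale0r ktens0r.
Qed.

Lemma tcoef_eq0 u : (forall a, tcoef a u = 0) -> u = 0.
Proof.
move=> h; have [s0 /(_ (undup s0) (undup_uniq _))] := tensor_expand u.
rewrite big1 => [|a _]; first by apply=> a; rewrite mem_undup.
by rewrite h ktens0r.
Qed.

(** No exponent of the first factor of [u] exceeds [a], which comes with [w].
    The case [w = 0] is included: it makes the notion additive, and it says that
    only exponents below [a] occur. *)
Record lead a u w : Prop := Lead {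
  leadE : forall b, (a <= b)%O -> tcoef b u = if b == a then w else 0 }.

Lemma lead_coef a u w : lead a u w -> tcoef a u = w.
Proof. by move=> [/(_ a (lexx a))]; rewrite eqxx. Qed.

Lemma lead_uniq a u w w' : lead a u w -> lead a u w' -> w = w'.
Proof. by move=> /lead_coef <- /lead_coef. Qed.

Lemma lead_zero a : lead a 0 0.
Proof. by split=> b _; rewrite (lin0 (tcoef_linear b)) if_same. Qed.

Lemma leadD a u w u' w' : lead a u w -> lead a u' w' -> lead a (u + u') (w + w').
Proof.
move=> [h] [h']; split=> b ab; rewrite (linD (tcoef_linear b)) h // h' //.
by case: ifP; rewrite ?addr0.
Qed.

Lemma lead_addl a u w v : lead a u w -> lead a v 0 -> lead a (u + v) w.
Proof. by move=> lu /(leadD lu); rewrite addr0. Qed.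

Lemma leadN a u w : lead a u w -> lead a (- u) (- w).
Proof.
move=> [h]; split=> b ab; rewrite -scaleN1r (linZ (tcoef_linear b)) h // scaleN1r.
by case: ifP; rewrite ?oppr0.
Qed.

Lemma leadB a u w u' w' : lead a u w -> lead a u' w' -> lead a (u - u') (w - w').
Proof. by move=> h h'; apply: leadD h (leadN h'). Qed.

Lemma lead_lt a b u w : lead a u w -> (a < b)%O -> lead b u 0.
Proof.
move=> [h] ab; split=> c bc; have ac := lt_le_trans ab bc.
by rewrite (h _ (ltW ac)) (gt_eqF ac) if_same.
Qed.

Lemma lead_mon s w : lead (s2m s) (mon B s \ox w) w.
Proof.
split=> b sb; rewrite tcoefE coef_mon_ge // eq_sym.
by case: eqP; rewrite ?scale1r ?scale0r.
Qed.

Lemma lead_pbw a w : lead a (pbw B a \ox w) w.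
Proof. by have := lead_mon (rev (m2s a)) w; rewrite s2m_rev_m2s. Qed.

Lemma lead_one w : lead 0%MM (1 \ox w) w.
Proof. by have := lead_mon [::] w; rewrite s2m0 /mon big_nil. Qed.

Lemma lead_in i w : lead U_(i)%MM (uea_in (x i) \ox w) w.
Proof.
by have := lead_mon [:: i] w; rewrite s2m_cons s2m0 addm0 /mon big_seq1.
Qed.

Lemma lower_ind a (P : ktensor H W -> Prop) : P 0 ->
  (forall u v, P u -> P v -> P (u + v)) ->
  (forall b w, (b < a)%O -> P (pbw B b \ox w)) -> forall u, lead a u 0 -> P u.
Proof.
move=> P0 PD Pp u lu; have [s0 /(_ (undup s0) (undup_uniq _)) e] := tensor_expand u.
rewrite e => [|b]; last by rewrite mem_undup.
apply: (big_ind P) => // b _; case: (ltP b a) => [/Pp//|ab].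
by rewrite (leadE lu) // if_same ktens0r.
Qed.

Lemma lead_split a u w : lead a u w ->
  exists2 u', u = pbw B a \ox w + u' & lead a u' 0.
Proof.
move=> lu; exists (u - pbw B a \ox w); first by rewrite addrC subrK.
by have := leadB lu (lead_pbw a w); rewrite subrr.
Qed.

Lemma lead_exists u : u != 0 -> exists a w, w != 0 /\ lead a u w.
Proof.
move=> u0; have [s0 /(_ (undup s0) (undup_uniq _)) e] := tensor_expand u.
pose s := [seq a <- s0 | tcoef a u != 0].
have out a : tcoef a u != 0 -> a \in s.
  move=> ha; rewrite mem_filter ha /=; apply: contraNT ha => ns0.
  rewrite e => [|b]; last by rewrite mem_undup.
  rewrite (big_morph _ (linD (tcoef_linear a)) (lin0 (tcoef_linear a))).
  rewrite big_seq big1 // => b; rewrite mem_undup => bs.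
  rewrite tcoefE coef_pbw; case: eqP => [eb|_]; last by rewrite scale0r.
  by rewrite -eb bs in ns0.
have max (r : seq M) : r = [::] \/ exists2 a, a \in r & forall b, b \in r -> (b <= a)%O.
  elim: r => [|b r [->|[a ar am]]]; first by left.
    by right; exists b => [|c]; rewrite inE // => /eqP ->.
  right; case: (leP a b) => ab.
    exists b => [|c]; rewrite inE ?eqxx // => /orP[/eqP ->//|/am ca].
    exact: le_trans ca ab.
  exists a => [|c]; rewrite inE ?ar ?orbT // => /orP[/eqP ->|/am//]; exact: ltW.
case: (max s) => [s0'|[a as_ am]].
  case/eqP: u0; apply: tcoef_eq0 => a; apply/eqP; apply: contraT => /out.
  by rewrite s0'.
exists a, (tcoef a u); split; first by move: as_; rewrite mem_filter => /andP[].
split=> b ab; case: eqP => [->//|/eqP nab]; apply/eqP; apply: contraT => /out /am ba.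
by case/eqP: nab; apply/le_anti; rewrite ab ba.
Qed.

(** The graded algebra associated with the degree filtration is commutative: up
    to smaller exponents, ordered monomials multiply by adding exponents. *)
Lemma lead_mul a b u v w w' : lead a u w -> lead b v w' ->
  lead (a + b)%MM (u * v) (w * w').
Proof.
have pp c d t t' : lead (c + d)%MM ((pbw B c \ox t) * (pbw B d \ox t')) (t * t').
  rewrite mul_ktens -mon_cat; have := lead_mon (rev (m2s c) ++ rev (m2s d)) (t * t').
  by rewrite s2m_cat !s2m_rev_m2s.
move=> /lead_split[u' -> lu'] /lead_split[v' -> lv'].
rewrite mulrDl !mulrDr -addrA; apply: lead_addl; first exact: pp.
apply: lead_addl.
  elim/lower_ind: {v'} lv' => [|v1 v2 h1 h2|d t db].
  - by rewrite mulr0; apply: lead_zero.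
  - by rewrite mulrDr; apply: lead_addl.
  - by apply: lead_lt (pp _ _ _ _) _; rewrite ltmc_add2r.
apply: lead_addl.
  elim/lower_ind: {u'} lu' => [|v1 v2 h1 h2|d t db].
  - by rewrite mul0r; apply: lead_zero.
  - by rewrite mulrDl; apply: lead_addl.
  - by apply: lead_lt (pp _ _ _ _) _; rewrite ltmc_add2l.
elim/lower_ind: {u'} lu' => [|v1 v2 h1 h2|d t da].
- by rewrite mul0r; apply: lead_zero.
- by rewrite mulrDl; apply: lead_addl.
elim/lower_ind: {v'} lv' => [|v1 v2 h1 h2|c t' cb].
- by rewrite mulr0; apply: lead_zero.
- by rewrite mulrDr; apply: lead_addl.
- by apply: lead_lt (pp _ _ _ _) _; apply: ltm_add.
Qed.

Lemma lead0E u w : lead 0%MM u w -> u = 1 \ox w.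
Proof.
move=> lu; apply/eqP; rewrite -subr_eq0; apply/eqP/tcoef_eq0 => a.
by have := leadE (leadB lu (lead_one w)) (le0x a); rewrite subrr if_same.
Qed.

End Coefficients.

(** Only the leading monomial of each generator matters, so terms [1 \ox r i] may
    be added to the image of a generator.  Coproducts have this form in each
    factor, generators being primitive. *)
Lemma lead_hom (W W' : algType k) (D : ktensor H W -> ktensor H W')
    (r : 'I_n -> W') (j : W -> W') : alg_hom D -> linear j -> j 1 = 1 ->
  (forall i, D (uea_in (x i) \ox 1) = uea_in (x i) \ox 1 + 1 \ox r i) ->
  (forall w, D (1 \ox w) = 1 \ox j w) ->
  forall a u w, lead a u w -> lead a (D u) (j w).
Proof.
move=> [Dl D1 DM] jl j1 Dx Dj.
have Dmon s w : lead (s2m s) (D (mon B s \ox w)) (j w).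
  elim: s => [|i s IH]; first by rewrite s2m0 /mon big_nil Dj; exact: lead_one.
  rewrite mon_cons s2m_cons -{1}[w]mul1r -mul_ktens DM -[j w]mul1r.
  apply: lead_mul IH; rewrite Dx; apply: lead_addl.
    exact: lead_in.
  apply: lead_lt (lead_one _) _; apply: lt_mdeg_ltmc.
  by rewrite mdeg0 mdeg1.
move=> a u w /lead_split[u' -> lu']; rewrite (linD Dl); apply: lead_addl.
  by have := Dmon (rev (m2s a)) w; rewrite s2m_rev_m2s.
elim/lower_ind: {u'} lu' => [|v1 v2 h1 h2|d t da].
- by rewrite (lin0 Dl); apply: lead_zero.
- by rewrite (linD Dl); apply: lead_addl.
- have := Dmon (rev (m2s d)) t; rewrite s2m_rev_m2s => h; exact: lead_lt h da.
Qed.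

End Lead.

(** * The smallest generator *)

Section LastGenerator.
Variables (k : fieldType) (L : lieAlgType k) (n : nat) (B : lie_basis L n.+1).
Local Notation H := (uea L).
Local Notation M := 'X_{1..n.+1}.
Local Notation sigma := (U_(ord_max))%MM.
Local Notation s := (uea_in (bvec B ord_max)).
Implicit Types (a b : M) (h : H).

Lemma sigma_le a : a != 0%MM -> (sigma <= a)%O.
Proof.
move=> a0; have := lt0n (mdeg a); rewrite mdeg_eq0 a0 => a1.
case: (ltngtP (mdeg a) 1) => [|a2|/eqP/mdeg1P[i /eqP ->]]; first by rewrite ltnNge a1.
  by apply/ltW/lt_mdeg_ltmc; rewrite mdeg1.
have [->|ni] := eqVneq i ord_max; first exact: lexx.
apply/ltW/ltmcP; first by rewrite !mdeg1.
have lt : (i < n)%N by rewrite ltn_neqAle -ltnS ltn_ord andbT -[n]/(val (@ord_max n)).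
exists i => [j ji|]; rewrite !mnm1E; last by rewrite eqxx eq_sym (negPf ni).
have -> : (ord_max == j) = false by apply/negP => /eqP e; move: ji; rewrite -e /=; lia.
by have -> : (i == j) = false by apply/negP => /eqP e; move: ji; rewrite -e ltnn.
Qed.

Lemma sigma_gt0 : ((0%MM : M) < sigma)%O.
Proof. by apply: lt_mdeg_ltmc; rewrite mdeg0 mdeg1. Qed.

(** Ordered words are decreasing, so they remain ordered when the last generator
    is put in front. *)
Lemma s_pbw a : s * pbw B a = pbw B (a + sigma)%MM.
Proof.
rewrite -mon_cons mon_decreasing; first by rewrite s2m_cons s2m_rev_m2s addmC.
rewrite /decreasing; have := rev_m2s_decreasing a; rewrite /decreasing.
by case: (rev _) => //= i w ->; rewrite -ltnS ltn_ord.
Qed.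

Lemma coef_s_mul a h : coef B (a + sigma)%MM (s * h) = coef B a h.
Proof.
have cl b := coef_linear B b.
elim/(@pbw_ind _ _ _ B): h => [|h h' e e'|c h e|b].
- by rewrite mulr0 !(lin0 (cl _)).
- by rewrite mulrDr !(linD (cl _)) e e'.
- by rewrite -scalerAr !(linZ (cl _)) e.
- by rewrite s_pbw !coef_pbw eqm_add2r.
Qed.

(** Straightening a nonempty word never produces the empty one; the coefficient
    at exponent zero is the augmentation. *)
Lemma coef0_mon (i : 'I_n.+1) w : coef B 0%MM (mon B (i :: w)) = 0.
Proof.
suff h v : v != [::] -> coef B 0%MM (mon B v) = 0 by apply: h.
elim/mon_ind: v => [v sv|u {}i j v hs hd _].
  rewrite coef_decreasing //; case: v sv => // l v _ _.
  have -> // : (s2m (l :: v) == 0%MM) = false.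
  by rewrite -mdeg_eq0 mdeg_s2m.
have cl := coef_linear B 0%MM.
rewrite mon_straighten (linD cl) hs; last by case: u {hs hd}.
rewrite (big_morph _ (linD cl) (lin0 cl)) big1 ?add0r // => l _.
by rewrite (linZ cl) hd ?scaler0 //; case: u {hs hd}.
Qed.

Lemma coef0_in_mul i h : coef B 0%MM (uea_in (bvec B i) * h) = 0.
Proof.
have cl b := coef_linear B b.
elim/(@pbw_ind _ _ _ B): h => [|h h' e e'|c h e|b].
- by rewrite mulr0 !(lin0 (cl _)).
- by rewrite mulrDr !(linD (cl _)) e e' addr0.
- by rewrite -scalerAr !(linZ (cl _)) e scaler0.
- by rewrite -mon_cons coef0_mon.
Qed.

Lemma coef_one a : coef B a 1 = (a == 0%MM)%:R.
Proof.
have -> : (1 : H) = pbw B 0%MM by rewrite -s2m0 -mon_decreasing // /mon big_nil.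
by rewrite coef_pbw eq_sym.
Qed.

Lemma coef_eq0 h : (forall a, coef B a h = 0) -> h = 0.
Proof.
move=> h0; have : h \ox (1 : H) = 0.
  by apply: (@tcoef_eq0 _ _ _ B) => a; rewrite tcoefE h0 scale0r.
move/(congr1 (@ktswap _ _ _)); rewrite ktswapE (lin0 (@ktswap_linear _ _ _)).
move/(congr1 (tcoef B 0%MM)); rewrite tcoefE coef_one eqxx scale1r.
by rewrite (lin0 (tcoef_linear B _)).
Qed.

Lemma s_mulI h h' : s * h = s * h' -> h = h'.
Proof.
move=> e; apply/eqP; rewrite -subr_eq0; apply/eqP/coef_eq0 => a.
by rewrite -coef_s_mul mulrBr e subrr (lin0 (coef_linear B _)).
Qed.

Lemma s_mul_scalar h c : s * h = c%:A -> h = 0.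
Proof.
move=> e; apply/coef_eq0 => a; rewrite -coef_s_mul e (linZ (coef_linear B _)) coef_one.
have -> : (a + sigma == 0 :> M)%MM = false by rewrite -mdeg_eq0 mdegD mdeg1 addn1.
exact: mulr0.
Qed.

Lemma coef_bound h : exists d, forall a, (d <= mdeg a)%N -> coef B a h = 0.
Proof.
have cl b := coef_linear B b.
elim/(@pbw_ind _ _ _ B): h => [|h h' [d e] [d' e']|c h [d e]|b].
- by exists 0%N => a _; rewrite (lin0 (cl _)).
- exists (maxn d d') => a; rewrite geq_max => /andP[da d'a].
  by rewrite (linD (cl _)) e // e' // addr0.
- by exists d => a da; rewrite (linZ (cl _)) e // scaler0.
- exists (mdeg b).+1 => a ba; rewrite coef_pbw.
  by case: eqP => // e; rewrite e ltnn in ba.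
Qed.

Section TensorCoef.
Variable W : algType k.
Implicit Types u : ktensor H W.

Lemma tcoef_mulr a (w : W) u : tcoef B a ((1 \ox w) * u) = w * tcoef B a u.
Proof.
have tl := tcoef_linear B (W := W) a.
elim/ktensor_ind: u => [|u v hu hv|h w'].
- by rewrite mulr0 (lin0 tl) mulr0.
- by rewrite mulrDr !(linD tl) hu hv mulrDr.
- by rewrite mul_ktens mul1r !tcoefE -scalerAr.
Qed.

Lemma tcoef_s_mul a u : tcoef B (a + sigma)%MM ((s \ox 1) * u) = tcoef B a u.
Proof.
have tl b := tcoef_linear B (W := W) b.
elim/ktensor_ind: u => [|u v hu hv|h w'].
- by rewrite mulr0 !(lin0 (tl _)).
- by rewrite mulrDr !(linD (tl _)) hu hv.
- by rewrite mul_ktens mul1r !tcoefE coef_s_mul.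
Qed.

Lemma tcoef0_in_mul i u : tcoef B 0%MM ((uea_in (bvec B i) \ox 1) * u) = 0.
Proof.
have tl b := tcoef_linear B (W := W) b.
elim/ktensor_ind: u => [|u v hu hv|h w'].
- by rewrite mulr0 !(lin0 (tl _)).
- by rewrite mulrDr !(linD (tl _)) hu hv addr0.
- by rewrite mul_ktens mul1r !tcoefE coef0_in_mul scale0r.
Qed.

Lemma tcoef_one a (w : W) : tcoef B a (1 \ox w) = if a == 0%MM then w else 0.
Proof. by rewrite tcoefE coef_one; case: eqP; rewrite ?scale1r ?scale0r. Qed.

Lemma lead_sigmaE u w : lead B sigma u w -> u = s \ox w + 1 \ox tcoef B 0%MM u.
Proof.
move=> lu; apply/eqP; rewrite -subr_eq0; apply/eqP/(tcoef_eq0 (B := B)) => a.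
have tl := tcoef_linear B (W := W) a.
rewrite -[_ - _]scale1r opprD -scaleN1r -[- (1 \ox _)]scaleN1r.
rewrite scale1r !(linD tl) !(linZ tl) tcoef_one.
have [->|/sigma_le a0] := eqVneq a 0%MM.
  have := tcoef0_in_mul ord_max (1 \ox w); rewrite mul_ktens mulr1 mul1r => ->.
  by rewrite scaler0 add0r scaleN1r subrr.
rewrite (leadE lu a0) (leadE (lead_in B ord_max w) a0).
by rewrite scaler0 addr0 scaleN1r subrr.
Qed.

End TensorCoef.

(** In a product of coproducts [x (x) 1 + 1 (x) x] only the terms [1 (x) x]
    contribute to exponent zero in the first factor. *)
Lemma counit h : tcoef B 0%MM (delta h) = h.
Proof.
have tl := tcoef_linear B (W := H) 0%MM; have [dl d1 dM] := delta_hom L.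
suff e w : tcoef B 0%MM (delta (mon B w)) = mon B w.
  elim/(@pbw_ind _ _ _ B): h => [|h h' h1 h2|c h h1|b]; last exact: e.
  - by rewrite (lin0 dl) (lin0 tl).
  - by rewrite (linD dl) (linD tl) h1 h2.
  - by rewrite (linZ dl) (linZ tl) h1.
elim: w => [|i w IH]; first by rewrite /mon big_nil d1 one_ktens tcoef_one eqxx.
rewrite mon_cons dM deltaE mulrDl (linD tl) tcoef0_in_mul add0r.
by rewrite tcoef_mulr IH.
Qed.

(** The part of the coproduct that is linear in [s] in the first factor.  It acts
    on left multiples of [s] like the derivative with respect to [s], see
    [dcoef_s_mul]. *)
Definition dcoef h : H := tcoef B sigma (delta h).

Lemma dcoef_linear : linear dcoef.
Proof.
by move=> c h h'; rewrite /dcoef; have [-> _ _] := delta_hom L; apply: tcoef_linear.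
Qed.

Lemma dcoef_s_mul h : dcoef (s * h) = h + s * dcoef h.
Proof.
rewrite /dcoef; have [_ _ ->] := delta_hom L.
rewrite deltaE mulrDl (linD (tcoef_linear B _)) tcoef_mulr -{1}[sigma]add0m.
by rewrite tcoef_s_mul counit.
Qed.

Lemma dcoef_scalar c : dcoef c%:A = 0.
Proof.
rewrite (linZ dcoef_linear) /dcoef; have [_ -> _] := delta_hom L.
by rewrite one_ktens tcoef_one -mdeg_eq0 mdeg1 scaler0.
Qed.

Hypothesis char0 : [pchar k] =i pred0.

Lemma natr_neq0 m : m.+1%:R != 0 :> k.
Proof. by have /pcharf0P -> := char0. Qed.

(** Multiplied by [s ^+ m], the hypothesis says that the derivative of
    [s ^+ m.+1 * h] vanishes.  It makes [h] a multiple of [s], and the quotient,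
    of smaller degree, satisfies the same equation with [m.+1]. *)
Lemma dcoef_descent m h : m.+1%:R *: h + s * dcoef h = 0 -> h = 0.
Proof.
have [d] := coef_bound h; elim: d m h => [|d IH] m h hd e.
  by apply: coef_eq0 => a; exact: hd.
pose q := - m.+1%:R^-1 *: dcoef h.
have hq : h = s * q.
  apply: (scalerI (natr_neq0 m)); rewrite /q -scalerAr scalerA mulrN divff ?natr_neq0 //.
  by rewrite scaleN1r; apply/eqP; rewrite -addr_eq0 e.
have q0 : q = 0.
  apply: (IH m.+1) => [a da|].
    by rewrite -coef_s_mul -hq hd // mdegD mdeg1 addn1 ltnS.
  apply: s_mulI; rewrite mulr0 -[RHS]e hq dcoef_s_mul !mulrDr addrA.
  by congr (_ + _); rewrite -!scalerAr -[m.+2]addn1 natrD scalerDl scale1r.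
by rewrite hq q0 mulr0.
Qed.

(** Coefficients of [s] in the first factor show that [f = s * h + c1].  The
    factor [1 \ox s - s \ox 1] can be taken out once more, which gives an equation
    for [h]; its coefficients of [s] and of [s ^+ 2] say that [dcoef h = 0] and
    [h = s * (s * h2) + c2], and then [h2 = 0] by [dcoef_descent]. *)
Lemma affine_equation (f : H) :
  (1 \ox s - s \ox 1) * delta f = 1 \ox (f * s) - (f * s) \ox 1 ->
  exists l c : k, f = l *: s + c%:A.
Proof.
have [_ _ dM] := delta_hom L; have dl := delta_hom L; have {}dl := alg_hom_linear dl.
move=> eqf.
have scalar h a : a != 0%MM -> tcoef B a (1 \ox h - h \ox 1) = (- coef B a h)%:A.
  move=> a0; rewrite (linD (tcoef_linear B a)) tcoef_one (negPf a0) add0r.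
  by rewrite -scaleN1r (linZ (tcoef_linear B a)) tcoefE scalerA mulN1r.
have s0 : sigma != 0%MM :> M by rewrite -mdeg_eq0 mdeg1.
have s20 : (sigma + sigma)%MM != 0%MM :> M by rewrite -mdeg_eq0 mdegD mdeg1.
have tlB a (u v : ktensor H H) : tcoef B a (u - v) = tcoef B a u - tcoef B a v.
  rewrite (linD (tcoef_linear B a)) -[- v]scaleN1r (linZ (tcoef_linear B a)).
  by rewrite scaleN1r.
have [h [c1 ef]] : exists h c1, f = s * h + c1%:A.
  exists (dcoef f), (coef B sigma (f * s)).
  have := scalar (f * s) _ s0; rewrite -eqf mulrBl tlB tcoef_mulr.
  rewrite -{2}[sigma]add0m tcoef_s_mul counit -/(dcoef f) scaleNr => e.
  by rewrite -[_%:A]opprK -e opprB addrC subrK.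
have eqh : (1 \ox s) * ((1 \ox s) * delta h) - (s \ox 1) * ((s \ox 1) * delta h) =
    1 \ox (s * h * s) - (s * h * s) \ox 1.
  have ed : delta f = (1 \ox s + s \ox 1) * delta h + c1%:A.
    rewrite ef (linD dl) dM deltaE (linZ dl); have [_ -> _] := delta_hom L.
    by rewrite [_ + 1 \ox _]addrC.
  have efs : f * s = s * h * s + c1 *: s by rewrite ef mulrDl -scalerAl mul1r.
  move: eqf; rewrite ed efs mulrDr ktensDr ktensDl -scalerAr mulr1 opprD addrACA.
  rewrite scalerBr -!scale_ktens -[1 \ox (c1 *: s)]ktensZ -scale_ktens.
  move/addIr => <-.
  rewrite !mulrA -mulrBl; congr (_ * _).
  rewrite mulrBl !mulrDr !mul_ktens !mulr1 !mul1r.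
  by rewrite opprD addrA addrK.
have dh0 : dcoef h = 0.
  have := scalar (s * h * s) _ s0; rewrite -eqh tlB !tcoef_mulr -/(dcoef h).
  rewrite -{1}[sigma]add0m tcoef_s_mul tcoef0_in_mul subr0 => /s_mul_scalar e.
  by apply: s_mulI; rewrite e mulr0.
have [h2 [c2 eh]] : exists h2 c2, h = s * (s * h2) + c2%:A.
  exists (tcoef B (sigma + sigma)%MM (delta h)), (coef B (sigma + sigma)%MM (s * h * s)).
  have := scalar (s * h * s) _ s20; rewrite -eqh tlB !tcoef_mulr tcoef_s_mul.
  rewrite -{3}[sigma]add0m tcoef_s_mul counit scaleNr => e.
  by rewrite -[_%:A]opprK -e opprB addrC subrK.
have h20 : h2 = 0.
  apply: (@dcoef_descent 1); apply: s_mulI; rewrite mulr0 -[RHS]dh0 eh.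
  rewrite (linD dcoef_linear) dcoef_scalar addr0 !dcoef_s_mul !mulrDr addrA.
  by congr (_ + _); rewrite -scalerAr scaler_nat mulr2n.
by exists c2, c1; rewrite ef eh h20 !mulr0 add0r -scalerAr mulr1.
Qed.
End LastGenerator.

(** * Homomorphisms into the threefold tensor product *)

Section AlgebraHomomorphisms.
Variables (k : fieldType) (A B C : algType k).

Lemma homB (F : A -> B) : alg_hom F -> forall u v, F (u - v) = F u - F v.
Proof.
by move=> [Fl _ _] u v; rewrite (linD Fl) -[- v]scaleN1r (linZ Fl) scaleN1r.
Qed.

Lemma homN (F : A -> B) : alg_hom F -> forall u, F (- u) = - F u.
Proof. by move=> [Fl _ _] u; rewrite -[- u]scaleN1r (linZ Fl) scaleN1r. Qed.

Lemma hom_scalar (F : A -> B) : alg_hom F -> forall c, F c%:A = c%:A.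
Proof. by move=> [Fl F1 _] c; rewrite (linZ Fl) F1. Qed.

Lemma hom_add_scalar (F : A -> B) : alg_hom F ->
  forall u c, F (u + c%:A) = F u + c%:A.
Proof. by move=> Fh u c; rewrite (linD (alg_hom_linear Fh)) hom_scalar. Qed.

Lemma hom_affine (F : A -> B) : alg_hom F -> forall u l v c,
  F (u + (l *: v + c%:A)) = F u + (l *: F v + c%:A).
Proof.
move=> Fh u l v c; have Fl := alg_hom_linear Fh.
by rewrite (linD Fl) hom_add_scalar // (linZ Fl).
Qed.

Lemma hom_mulB (F : A -> B) : alg_hom F ->
  forall u v u' v', F (u * v - u' * v') = F u * F v - F u' * F v'.
Proof. by move=> Fh u v u' v'; have [_ _ FM] := Fh; rewrite homB // !FM. Qed.

Lemma hom_mulDB (F : A -> B) : alg_hom F -> forall u v u' v' u2 v2,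
  F (u * v + u' * v' - u2 * v2) = F u * F v + F u' * F v' - F u2 * F v2.
Proof.
move=> Fh u v u' v' u2 v2; have [Fl _ FM] := Fh.
by rewrite homB // (linD Fl) !FM.
Qed.

Lemma tensl_hom : alg_hom (fun u : A => u \ox (1 : B)).
Proof.
split=> [c u v||u v] //; first by rewrite ktensDl -scale_ktens.
by rewrite mul_ktens mulr1.
Qed.

Lemma tensr_hom : alg_hom (fun u : B => (1 : A) \ox u).
Proof.
split=> [c u v||u v] //; first by rewrite ktensDr -ktensZ -scale_ktens.
by rewrite mul_ktens mulr1.
Qed.

Lemma ktswapK (V W : lmodType k) : cancel (@ktswap k V W) (@ktswap k W V).
Proof.
have l := @ktswap_linear k; move=> u; elim/ktensor_ind: u => [|u v hu hv|v w].
- by rewrite !(lin0 (l _ _)).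
- by rewrite !(linD (l _ _)) hu hv.
- by rewrite !ktswapE.
Qed.

End AlgebraHomomorphisms.

Section Slots.
Variables (k : fieldType) (L : lieAlgType k).
Local Notation H := (uea L : algType k).
Local Notation T2 := (ktensor H H).
Local Notation T3 := (ktensor (T2 : algType k) H).
Implicit Types (x y z h : H) (u v : T2).

(** [slot1], [slot2], [slot3] bring the factor in which leading terms are to be
    compared to the front. *)
Definition slot3 : T3 -> ktensor H T2 := @ktswap k T2 H.
Definition slot1 : T3 -> ktensor H T2 :=
  @ktswap k T2 H \o (@ktassoc k H H H \o (@ktswap k T2 H \o (@ktassoc k H H H \o slot3))).
Definition slot2 : T3 -> ktensor H T2 := slot1 \o @swap12 k L.

Definition in12 u : T3 := u \ox 1.
Definition in23 u : T3 := ktassoc (1 \ox u).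

Lemma slot3_hom : alg_hom slot3. Proof. exact: ktswap_hom. Qed.

Lemma slot1_hom : alg_hom slot1.
Proof.
apply: comp_hom (ktswap_hom _ _) _; apply: comp_hom (ktassoc_hom _ _ _) _.
apply: comp_hom (ktswap_hom _ _) _; apply: comp_hom (ktassoc_hom _ _ _) _.
exact: slot3_hom.
Qed.

Lemma slot2_hom : alg_hom slot2.
Proof. exact: comp_hom slot1_hom (swap12_hom L). Qed.

Lemma in12_hom : alg_hom in12. Proof. exact: tensl_hom. Qed.

Lemma in23_hom : alg_hom in23.
Proof. exact: comp_hom (ktassoc_hom _ _ _) (tensr_hom _ _). Qed.

Lemma slot1E x y z : slot1 ((x \ox y) \ox z) = x \ox (y \ox z).
Proof. by rewrite /slot1 /slot3 /= ktswapE ktassocE ktswapE ktassocE ktswapE. Qed.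

Lemma slot3E x y z : slot3 ((x \ox y) \ox z) = z \ox (x \ox y).
Proof. exact: ktswapE. Qed.

Lemma swap12E x y z : swap12 ((x \ox y) \ox z) = (y \ox x) \ox z.
Proof. by rewrite /swap12 ktmapE ?ktswapE //; apply: ktswap_linear. Qed.

Lemma slot2E x y z : slot2 ((x \ox y) \ox z) = y \ox (x \ox z).
Proof. by rewrite /slot2 /= swap12E slot1E. Qed.

Lemma in23E x y : in23 (x \ox y) = (1 \ox x) \ox y.
Proof. exact: ktassocE. Qed.

Lemma delta_idE x y : delta_id (x \ox y) = delta x \ox y.
Proof. by rewrite /delta_id ktmapE //; exact: alg_hom_linear (delta_hom L). Qed.

Lemma id_deltaE x y : id_delta (x \ox y) = ktassoc (x \ox delta y).
Proof.
by rewrite /id_delta ktmapE //; exact: alg_hom_linear (delta_hom L).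
Qed.

Lemma delta1 : delta (1 : H) = 1 \ox 1. Proof. exact: alg_hom1 (delta_hom L). Qed.

Lemma tensor3_ind (P : T3 -> Prop) : P 0 -> (forall p q, P p -> P q -> P (p + q)) ->
  (forall x y z, P ((x \ox y) \ox z)) -> forall p, P p.
Proof.
move=> P0 PD Pp p; elim/ktensor_ind: p => [|p q|u z] //; first exact: PD.
elim/ktensor_ind: u => [|u v hu hv|x y] //; first by rewrite ktens0l.
by rewrite ktensDl; apply: PD.
Qed.

Lemma swap12K : involutive (@swap12 k L).
Proof.
have l := alg_hom_linear (swap12_hom L).
move=> p; elim/tensor3_ind: p => [|p q hp hq|x y z].
- by rewrite !(lin0 l).
- by rewrite !(linD l) hp hq.
- by rewrite !swap12E.
Qed.

Lemma slot1_swap12 (p : T3) : slot1 (swap12 p) = slot2 p. Proof. by []. Qed.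
Lemma slot2_swap12 (p : T3) : slot2 (swap12 p) = slot1 p.
Proof. by rewrite /slot2 /= swap12K. Qed.

Lemma swap12_in12 u : swap12 (in12 u) = in12 (ktswap u).
Proof. by rewrite /swap12 ktmapE //; exact: ktswap_linear. Qed.

Lemma swap_delta h : ktswap (delta h) = delta h.
Proof.
apply: (uea_hom_ext (comp_hom (ktswap_hom _ _) (delta_hom L)) (delta_hom L)) => x /=.
by rewrite deltaE (linD (@ktswap_linear k H H)) !ktswapE addrC.
Qed.

Lemma swap12_delta_id u : swap12 (delta_id u) = delta_id u.
Proof.
have sl := alg_hom_linear (swap12_hom L); have dl := alg_hom_linear (delta_id_hom L).
elim/ktensor_ind: u => [|u v hu hv|x y].
- by rewrite (lin0 dl) (lin0 sl).
- by rewrite (linD dl) (linD sl) hu hv.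
- by rewrite delta_idE /swap12 ktmapE ?swap_delta //; exact: ktswap_linear.
Qed.

Variables (n : nat) (B : lie_basis L n).
Local Notation lead := (lead B).

Lemma tensl_linear : linear (fun x => x \ox (1 : H)).
Proof. exact: alg_hom_linear (tensl_hom H H). Qed.
Lemma tensr_linear : linear (fun x => (1 : H) \ox x).
Proof. exact: alg_hom_linear (tensr_hom H H). Qed.

(** The lemmas on slots tell how the leading exponents of [u] in its first factor,
    or in its second one through [ktswap], reappear in each factor of the images
    of [u]. *)
Lemma slot2_in23 a u w : lead a u w -> lead a (slot2 (in23 u)) (1 \ox w).
Proof.
apply: (lead_hom (r := fun=> 0) (comp_hom slot2_hom in23_hom) tensr_linear) => //= [i|{}w].
- by rewrite ktens0r addr0 in23E slot2E.
- by rewrite in23E slot2E.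
Qed.

Lemma slot1_in12 a u w : lead a u w -> lead a (slot1 (in12 u)) (w \ox 1).
Proof.
apply: (lead_hom (r := fun=> 0) (comp_hom slot1_hom in12_hom) tensl_linear) => //= [i|{}w].
- by rewrite ktens0r addr0 /in12 slot1E.
- by rewrite /in12 slot1E.
Qed.

Lemma slot2_in12 a u w : lead a (ktswap u) w -> lead a (slot2 (in12 u)) (w \ox 1).
Proof.
rewrite -{2}(ktswapK u); apply: (lead_hom (r := fun=> 0)
  (comp_hom slot2_hom (comp_hom in12_hom (ktswap_hom _ _))) tensl_linear) => //= [i|{}w].
- by rewrite ktens0r addr0 ktswapE /in12 slot2E.
- by rewrite ktswapE /in12 slot2E.
Qed.

Lemma slot1_delta_id a u w : lead a u w -> lead a (slot1 (delta_id u)) (1 \ox w).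
Proof.
apply: (lead_hom (r := fun i => uea_in (bvec B i) \ox 1)
  (comp_hom slot1_hom (delta_id_hom L)) tensr_linear) => //= [i|{}w].
- by rewrite delta_idE deltaE ktensDl (linD (alg_hom_linear slot1_hom)) !slot1E.
- by rewrite delta_idE delta1 slot1E.
Qed.

Lemma slot2_delta_id a u w : lead a u w -> lead a (slot2 (delta_id u)) (1 \ox w).
Proof. by rewrite -slot1_swap12 swap12_delta_id; exact: slot1_delta_id. Qed.

Lemma slot2_id_delta a u w : lead a (ktswap u) w -> lead a (slot2 (id_delta u)) (w \ox 1).
Proof.
rewrite -{2}(ktswapK u); apply: (lead_hom (r := fun i => 1 \ox uea_in (bvec B i))
  (comp_hom slot2_hom (comp_hom (id_delta_hom L) (ktswap_hom _ _))) tensl_linear)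
  => //= [i|{}w].
- rewrite ktswapE id_deltaE deltaE ktensDr (linD (@ktassoc_linear k H H H)).
  by rewrite !ktassocE (linD (alg_hom_linear slot2_hom)) !slot2E.
- by rewrite ktswapE id_deltaE delta1 ktassocE slot2E.
Qed.

Lemma slot3_id_delta a u w : lead a (ktswap u) w -> lead a (slot3 (id_delta u)) (w \ox 1).
Proof.
rewrite -{2}(ktswapK u); apply: (lead_hom (r := fun i => 1 \ox uea_in (bvec B i))
  (comp_hom slot3_hom (comp_hom (id_delta_hom L) (ktswap_hom _ _))) tensl_linear)
  => //= [i|{}w].
- rewrite ktswapE id_deltaE deltaE ktensDr (linD (@ktassoc_linear k H H H)).
  by rewrite !ktassocE (linD (alg_hom_linear slot3_hom)) !slot3E addrC.
- by rewrite ktswapE id_deltaE delta1 ktassocE slot3E.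
Qed.

Lemma slot1_id_delta a u w : lead a u w -> lead a (slot1 (id_delta u)) (delta w).
Proof.
have dl := alg_hom_linear (delta_hom L).
apply: (lead_hom (r := fun=> 0) (comp_hom slot1_hom (id_delta_hom L)) dl
  (alg_hom1 (delta_hom L))) => //= [i|{}w].
- by rewrite ktens0r addr0 id_deltaE delta1 ktassocE slot1E.
- rewrite id_deltaE; elim/ktensor_ind: (delta w) => [|u1 u2 h1 h2|y z].
  + by rewrite ktens0r (lin0 (@ktassoc_linear k H H H)) (lin0 (alg_hom_linear slot1_hom)).
  + rewrite ktensDr (linD (@ktassoc_linear k H H H)) (linD (alg_hom_linear slot1_hom)).
    by rewrite h1 h2.
  + by rewrite ktassocE slot1E.
Qed.

Lemma slot3_delta_id a u w : lead a (ktswap u) w -> lead a (slot3 (delta_id u)) (delta w).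
Proof.
have dl := alg_hom_linear (delta_hom L).
rewrite -{2}(ktswapK u); apply: (lead_hom (r := fun=> 0)
  (comp_hom slot3_hom (comp_hom (delta_id_hom L) (ktswap_hom _ _))) dl
  (alg_hom1 (delta_hom L))) => //= [i|{}w].
- by rewrite ktens0r addr0 ktswapE delta_idE delta1 slot3E.
- by rewrite ktswapE delta_idE /slot3 ktswapE.
Qed.

Lemma slot1_in23 u : slot1 (in23 u) = 1 \ox u.
Proof.
have sl := alg_hom_linear slot1_hom; have il := alg_hom_linear in23_hom.
elim/ktensor_ind: u => [|u v hu hv|y z].
- by rewrite (lin0 il) (lin0 sl) ktens0r.
- by rewrite (linD il) (linD sl) hu hv ktensDr.
- by rewrite in23E slot1E.
Qed.

Lemma slot3_in12 u : slot3 (in12 u) = 1 \ox u.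
Proof. exact: ktswapE. Qed.

End Slots.

(** * Solving the coordinate equations *)

Lemma zmod_cancel (G : zmodType) (p q r x y z : G) :
  p + r + (- x - y) = q + r + (- x - z) -> p = y - z + q.
Proof.
move/(congr1 (fun g => g + x + y - r)); rewrite [- x - y]addrC [- x - z]addrC.
rewrite !addrA !subrK addrK => ->.
rewrite addrAC [q + r - z]addrAC addrK.
by rewrite addrC [q - z]addrC addrA.
Qed.

Lemma scalar_quadratic (k : fieldType) (A : algType k) (z : A) (r t : k) :
  r%:A * r%:A - (z + t%:A) * r%:A = - (r *: z) -> r = 0 \/ r = t.
Proof.
rewrite !mulr_algr scalerDr opprD addrA => /(congr1 (+%R^~ (r *: z))).
rewrite addrAC addrNK addNr !scalerA -scalerBl -mulrBr => /eqP.
rewrite scaler_eq0 oner_eq0 orbF mulf_eq0 subr_eq0.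
by case/orP => /eqP; [left|right].
Qed.

(** With [z] the copy of [s] in the third factor and [K] the contraction of that
    factor with the augmentation, this extracts the terms free of [z]. *)
Lemma contraction_form (k : fieldType) (A C : algType k) (F : C -> A) (K : A -> C) (z : A) :
  alg_hom F -> linear K -> (forall u, K (F u) = u) -> (forall p, K (z * p) = 0) ->
  (forall u, F u * z = z * F u) -> forall u v u' v',
  K (F u * (F v + z) - (F u' + z) * (F v' + z)) = u * v - u' * v'.
Proof.
move=> [_ _ FM] Kl KF Kz zC u v u' v'; rewrite mulrDl !mulrDr !zC -!FM (linD Kl).
rewrite -[- (_ + _)]scaleN1r (linZ Kl) !(linD Kl) !Kz !KF !addr0.
by rewrite scaleN1r.
Qed.

Section CoordinateEquations.
Variables (k : fieldType) (L : lieAlgType k) (n : nat) (B : lie_basis L n.+1).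
Local Notation H := (uea L : algType k).
Local Notation T2 := (ktensor H H).
Local Notation T3 := (ktensor (T2 : algType k) H).
Local Notation lead := (lead B).
Local Notation sigma := (U_(ord_max))%MM.
Local Notation s := (uea_in (bvec B ord_max)).
Implicit Types (a b c d u v : T2) (h f : H) (m : 'X_{1..n.+1}).

Lemma ktens_eq0 h h' : h \ox h' = 0 -> h = 0 \/ h' = 0.
Proof.
move=> e; have [->|h0] := eqVneq h' 0; [by right|left].
apply: (coef_eq0 (B := B)) => m; have := congr1 (tcoef B m) e.
rewrite tcoefE (lin0 (tcoef_linear B m)) => /eqP.
by rewrite scaler_eq0 (negPf h0) orbF => /eqP.
Qed.

Lemma ktswap_neq0 u : u != 0 -> ktswap u != 0.
Proof.
apply: contraNneq => e; rewrite -(ktswapK u) e.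
by rewrite (lin0 (@ktswap_linear k H H)).
Qed.

Section LeadHT.
Variable W : algType k.
Implicit Types (p q : ktensor H W) (w : W).

Lemma lead_le m m' p : lead m p 0 -> (m <= m')%O -> lead m' p 0.
Proof. by rewrite le_eqVlt => l /orP[/eqP <- //|]; apply: lead_lt l. Qed.

Lemma lead0_gt m p w : lead 0%MM p w -> m != 0%MM -> lead m p 0.
Proof. by move=> l m0; apply: lead_lt l _; rewrite lt0x. Qed.

Lemma scalar_one_tens (t : k) : t%:A = (1 : H) \ox t%:A :> ktensor H W.
Proof. by rewrite (hom_scalar (tensr_hom H W)). Qed.

Lemma lead_s_add w : lead sigma (s \ox 1 + 1 \ox w) 1.
Proof.
apply: lead_addl; first exact: lead_in.
exact: lead_lt (lead_one B w) (sigma_gt0 n).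
Qed.

End LeadHT.

(** In the second factor the left side has as leading exponent the sum of those
    of the two factors of [b], the right side only that of the first factor. *)
Lemma trivial_second_factor_of_b b :
  in23 b * id_delta b = swap12 (in23 b * id_delta b) -> exists f, b = f \ox 1.
Proof.
have [-> _|b0] := eqVneq b 0; first by exists 0; rewrite ktens0l.
have [m [w [w0 lb]]] := lead_exists B b0.
have [m' [v [v0 lb']]] := lead_exists B (ktswap_neq0 b0).
move/(congr1 (@slot2 k L)); rewrite slot2_swap12.
have [_ _ ->] := slot2_hom L; have [_ _ ->] := slot1_hom L => e.
have l2 := lead_mul (slot2_in23 lb) (slot2_id_delta lb').
have := lead_mul (lead_one B b) (slot1_id_delta lb); rewrite -slot1_in23 -e add0m => l1.
have [m0|m0] := eqVneq m' 0%MM.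
  exists v; rewrite m0 in lb'; have := lead0E lb' => /(congr1 (@ktswap _ _ _)).
  by rewrite ktswapK ktswapE.
have lt : (m < (m + m')%MM)%O by rewrite -{1}[m]addm0 ltmc_add2r lt0x.
have := lead_uniq l2 (lead_lt l1 lt); rewrite mul_ktens mul1r mulr1.
by case/ktens_eq0 => z; [rewrite z eqxx in v0|rewrite z eqxx in w0].
Qed.

(** Let [m] be the leading exponent of the first factor of [d].  In the second
    factor the two terms on the left have leading exponent [m] and cancel there,
    whereas the right side has leading exponent [m + m]. *)
Lemma vanish_d f d :
  in12 (f \ox 1) * delta_id d - in23 d * id_delta (f \ox 1) =
    swap12 (in12 d * delta_id d) -> d = 0.
Proof.
have [//|d0] := eqVneq d 0; have [m [w [w0 ld]]] := lead_exists B d0.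
move/(congr1 (@slot2 k L)); rewrite slot2_swap12 (hom_mulB (slot2_hom L)).
have [_ _ ->] := slot1_hom L => e.
have l1 := lead_mul (slot1_in12 ld) (slot1_delta_id ld).
have e1 : slot2 (in12 (f \ox 1)) = 1 \ox (f \ox 1) by rewrite /in12 slot2E.
have e2 : slot2 (id_delta (f \ox 1)) = 1 \ox (f \ox 1).
  by rewrite id_deltaE delta1 ktassocE slot2E.
rewrite e1 e2 in e.
have la := lead_mul (lead_one B (f \ox (1 : H))) (slot2_delta_id ld).
have lb := lead_mul (slot2_in23 ld) (lead_one B (f \ox (1 : H))).
rewrite add0m in la; rewrite addm0 in lb; have := leadB la lb.
rewrite e !mul_ktens !mulr1 !mul1r subrr => l2.
have := lead_uniq l1 (lead_le l2 (lemc_addr m m)); rewrite mul_ktens mul1r mulr1.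
by case/ktens_eq0 => z; rewrite z eqxx in w0.
Qed.

Lemma vanish_b_or_c f c : in12 (f \ox 1) * delta_id c = 0 -> f = 0 \/ c = 0.
Proof.
have [->|c0] := eqVneq c 0; first by right.
have [m [w [w0 lc]]] := lead_exists B c0.
move/(congr1 (@slot2 k L)); have [l _ ->] := slot2_hom L.
rewrite (lin0 l) /in12 slot2E => e; left.
have := lead_mul (lead_one B (f \ox (1 : H))) (slot2_delta_id lc).
rewrite e => /lead_uniq/(_ (lead_zero B _ _)); rewrite mul_ktens mulr1 mul1r.
by case/ktens_eq0 => // z; rewrite z eqxx in w0.
Qed.

Variable t : k.
(** The coefficient of the square of [e2]. *)
Definition virasoro : T2 := 1 \ox s + t%:A.
Local Notation alpha := virasoro.

Lemma in12_alpha : in12 alpha = (1 \ox s) \ox 1 + t%:A.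
Proof. exact: hom_add_scalar (in12_hom L) _ _. Qed.

Lemma in23_alpha : in23 alpha = (1 \ox 1) \ox s + t%:A.
Proof. by rewrite (hom_add_scalar (in23_hom L)) in23E. Qed.

Lemma delta_id_alpha : delta_id alpha = (1 \ox 1) \ox s + t%:A.
Proof. by rewrite (hom_add_scalar (delta_id_hom L)) delta_idE delta1. Qed.

Lemma id_delta_1s : id_delta (1 \ox s) = in12 (1 \ox s) + (1 \ox 1) \ox s.
Proof.
rewrite id_deltaE deltaE ktensDr (linD (@ktassoc_linear k H H H)) !ktassocE.
by [].
Qed.

Lemma id_delta_alpha : id_delta alpha = in12 (1 \ox s) + (1 \ox 1) \ox s + t%:A.
Proof. by rewrite (hom_add_scalar (id_delta_hom L)) id_delta_1s. Qed.

(** The coefficient of [s] in the third factor is [f \ox 1 - f \ox 1] on the left and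
    [- (f \ox 1)] on the right. *)
Lemma vanish_f a f :
  in12 a * delta_id (f \ox 1) + in12 (f \ox 1) * delta_id alpha
    - in23 alpha * id_delta (f \ox 1) =
  - swap12 (in23 (f \ox 1) * id_delta alpha) -> f = 0.
Proof.
have e0 : id_delta (f \ox (1 : H)) = in12 (f \ox 1).
  by rewrite id_deltaE delta1 ktassocE.
have e1 : slot3 (in12 (f \ox (1 : H))) = 1 \ox (f \ox 1) by rewrite slot3_in12.
have e2 : slot3 (delta_id (f \ox (1 : H))) = 1 \ox delta f.
  by rewrite delta_idE /slot3 ktswapE.
have e3 : slot3 (swap12 (in23 (f \ox (1 : H)))) = 1 \ox (f \ox 1).
  by rewrite in23E swap12E slot3E.
have wM := alg_homM (swap12_hom L); have sM := alg_homM (slot3_hom L).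
have wl := alg_hom_linear (swap12_hom L); have sl := alg_hom_linear (slot3_hom L).
have e4 : slot3 ((1 \ox 1) \ox s + t%:A) = s \ox 1 + 1 \ox t%:A.
  by rewrite (hom_add_scalar (slot3_hom L)) slot3E -scalar_one_tens.
have e5 : slot3 (swap12 (id_delta alpha)) = s \ox 1 + 1 \ox (s \ox 1 + t%:A).
  rewrite id_delta_alpha (hom_add_scalar (swap12_hom L)) (linD wl) swap12_in12 swap12E.
  rewrite ktswapE (hom_add_scalar (slot3_hom L)) (linD sl) slot3_in12 slot3E.
  by rewrite [in LHS]scalar_one_tens [X in X + _]addrC -addrA -ktensDr.
move/(congr1 (@slot3 k L)); rewrite in23_alpha delta_id_alpha e0 wM.
rewrite (hom_mulDB (slot3_hom L)) (homN (slot3_hom L)) [slot3 (swap12 _ * _)]sM.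
rewrite e1 e2 e3 e4 e5 slot3_in12 => e.
have ls := lead_s_add (W := T2).
have la : lead sigma ((1 \ox a) * (1 \ox delta f)) 0.
  have := lead_mul (lead_one B a) (lead_one B (delta f)); rewrite addm0 => l.
  by apply: lead0_gt l _; rewrite -mdeg_eq0 mdeg1.
have lb := lead_mul (lead_one B (f \ox (1 : H))) (ls t%:A).
have lc := lead_mul (ls t%:A) (lead_one B (f \ox (1 : H))).
have ld := lead_mul (lead_one B (f \ox (1 : H))) (ls (s \ox 1 + t%:A)).
rewrite add0m in lb ld; rewrite addm0 in lc.
have := leadB (leadD la lb) lc; rewrite e => /lead_uniq/(_ (leadN ld)).
rewrite add0r mulr1 mul1r subrr => /(congr1 -%R); rewrite oppr0 opprK.
by case/esym/ktens_eq0 => // /eqP; rewrite oner_eq0.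
Qed.

Lemma slot2_in12_alpha : slot2 (in12 alpha) = s \ox 1 + 1 \ox t%:A.
Proof.
by rewrite in12_alpha (hom_add_scalar (slot2_hom L)) slot2E -scalar_one_tens.
Qed.

Lemma slot1_in12_alpha : slot1 (in12 alpha) = 1 \ox (s \ox 1 + t%:A).
Proof.
rewrite in12_alpha (hom_add_scalar (slot1_hom L)) slot1E.
by rewrite [in LHS]scalar_one_tens -ktensDr.
Qed.

(** Let [m] and [m'] be the leading exponents of the two factors of [c].  In the
    second factor the right side has no exponent above [m], while the two terms
    on the left have leading exponents [m + sigma] and [m + m'].  They must
    cancel, so [m' = sigma], and the coefficient of [s] is [1]. *)
Lemma second_factor_of_c c :
  in12 alpha * delta_id c - in23 c * id_delta c =
    swap12 (in12 alpha * delta_id c - in23 c * id_delta c) ->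
  c = 0 \/ exists f, c = f \ox 1 + 1 \ox s.
Proof.
have [-> _|c0] := eqVneq c 0; first by left.
have [m [w [w0 lc]]] := lead_exists B c0.
have [m' [v [v0 lc']]] := lead_exists B (ktswap_neq0 c0).
move/(congr1 (@slot2 k L)).
rewrite slot2_swap12 (hom_mulB (slot2_hom L)) (hom_mulB (slot1_hom L)).
rewrite slot2_in12_alpha slot1_in12_alpha slot1_in23 => e; right.
have l1 := lead_mul (lead_s_add (t%:A : T2)) (slot2_delta_id lc).
have l2 := lead_mul (slot2_in23 lc) (slot2_id_delta lc').
have r1 := lead_mul (lead_one B (s \ox (1 : H) + t%:A)) (slot1_delta_id lc).
have r2 := lead_mul (lead_one B c) (slot1_id_delta lc).
rewrite add0m in r1 r2; have := leadB r1 r2; rewrite -e; set p := (X in lead m X _) => r.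
rewrite mul1r in l1; rewrite !mul_ktens mul1r mulr1 in l2.
have rlt m1 : m1 != 0%MM -> lead (m + m1)%MM p 0.
  by move=> m10; apply: lead_lt r _; rewrite -{1}[m]addm0 ltmc_add2r lt0x.
have sn0 : sigma != 0%MM :> 'X_{1..n.+1} by rewrite -mdeg_eq0 mdeg1.
have vw0 : v \ox w <> 0.
  by case/ktens_eq0 => z; [rewrite z eqxx in v0|rewrite z eqxx in w0].
rewrite addmC in l1.
have [m0|/[dup] m0 /sigma_le] := eqVneq m' 0%MM.
  rewrite m0 addm0 in l2; have lt : (m < (m + sigma)%MM)%O.
    by rewrite -{1}[m]addm0 ltmc_add2r lt0x.
  have := lead_uniq (leadB l1 (lead_lt l2 lt)) (rlt _ sn0); rewrite subr0.
  case/ktens_eq0 => [/eqP|z]; first by rewrite oner_eq0.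
  by rewrite z eqxx in w0.
rewrite le_eqVlt => /orP[/eqP em|lt]; last first.
  have lt' : ((m + sigma)%MM < (m + m')%MM)%O by rewrite ltmc_add2r.
  have := lead_uniq (leadB (lead_lt l1 lt') l2) (rlt _ m0).
  by rewrite sub0r => /(congr1 -%R); rewrite opprK oppr0.
rewrite -em in l2 lc'; have := lead_uniq (leadB l1 l2) (rlt _ sn0).
move/eqP; rewrite subr_eq0 => /eqP e1.
have v1 : v = 1.
  apply/eqP; rewrite eq_sym -subr_eq0; apply/eqP.
  have : (1 - v) \ox w = 0.
    by apply: (addIr (v \ox w)); rewrite -ktensDl subrK add0r.
  by case/ktens_eq0 => // z; rewrite z eqxx in w0.
exists (tcoef B 0%MM (ktswap c)); rewrite -[LHS]ktswapK.
rewrite {1}(lead_sigmaE lc') v1 (linD (@ktswap_linear k H H)) !ktswapE.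
by rewrite addrC.
Qed.

Definition contract3 (p : T3) : T2 := tcoef B 0%MM (slot3 p).

Lemma contract3_linear : linear contract3.
Proof.
by move=> x p q; rewrite /contract3 (alg_hom_linear (slot3_hom L)) tcoef_linear.
Qed.

Lemma contract3_in12 u : contract3 (in12 u) = u.
Proof. by rewrite /contract3 slot3_in12 tcoef_one eqxx. Qed.

Lemma contract3_s_mul p : contract3 ((1 \ox 1) \ox s * p) = 0.
Proof.
rewrite /contract3 (alg_homM (slot3_hom L)) slot3E; exact: tcoef0_in_mul.
Qed.

Lemma in12_s3 u : in12 u * ((1 \ox 1) \ox s) = (1 \ox 1) \ox s * in12 u.
Proof. by rewrite !mul_ktens !mulr1 !mul1r. Qed.

Lemma contract3_form u v u' v' :
  contract3 (in12 u * (in12 v + (1 \ox 1) \ox s) -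
             (in12 u' + (1 \ox 1) \ox s) * (in12 v' + (1 \ox 1) \ox s)) =
  u * v - u' * v'.
Proof.
exact: contraction_form (in12_hom L) contract3_linear contract3_in12 contract3_s_mul
  in12_s3 _ _ _ _.
Qed.

(** Every term is a polynomial in the copy of [s] in the third factor; the terms
    free of it give the equation. *)
Lemma first_factor_of_c f : let c := f \ox 1 + 1 \ox s in
  in12 alpha * delta_id c - in23 c * id_delta c =
    swap12 (in12 alpha * delta_id c - in23 c * id_delta c) ->
  (1 \ox s - s \ox 1) * delta f = 1 \ox (f * s) - (f * s) \ox 1.
Proof.
move=> c; have [wl _ wM] := swap12_hom L.
have [dl _ _] := delta_id_hom L; have [il _ _] := id_delta_hom L.
have [jl _ _] := in12_hom L; have [el _ _] := in23_hom L.
have e1 : delta_id c = in12 (delta f) + (1 \ox 1) \ox s.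
  by rewrite (linD dl) !delta_idE delta1.
have e2 : id_delta c = in12 (f \ox 1 + 1 \ox s) + (1 \ox 1) \ox s.
  by rewrite (linD il) id_delta_1s id_deltaE delta1 ktassocE (linD jl) addrA.
have e3 : in23 c = in12 (1 \ox f) + (1 \ox 1) \ox s by rewrite (linD el) !in23E.
have e4 : swap12 (in12 alpha) = in12 (s \ox 1 + t%:A).
  by rewrite swap12_in12 (hom_add_scalar (ktswap_hom H H)) ktswapE.
have e5 : swap12 (id_delta c) = in12 (1 \ox f + s \ox 1) + (1 \ox 1) \ox s.
  by rewrite e2 (linD wl) swap12_in12 swap12E (linD (@ktswap_linear k H H)) !ktswapE.
have e6 : swap12 (in23 c) = in12 (f \ox 1) + (1 \ox 1) \ox s.
  by rewrite e3 (linD wl) swap12_in12 swap12E ktswapE.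
rewrite (hom_mulB (swap12_hom L)) swap12_delta_id e1 e4 e5 e6 e2 e3.
move/(congr1 contract3); rewrite !contract3_form.
have vE r u : (r + t%:A) * u = r * u + t *: u by rewrite mulrDl mulr_algl.
rewrite /virasoro !vE !mulrDr !mul_ktens !mulr1 !mul1r !opprD => e.
apply/eqP; rewrite mulrBl subr_eq; apply/eqP.
move: e; exact: zmod_cancel.
Qed.

(** In the third factor the second term has a larger leading exponent than the
    first, because of the summand [s] of [alpha]. *)
Lemma vanish_a a : in12 a * delta_id a - in23 alpha * id_delta a = 0 -> a = 0.
Proof.
have [//|a0] := eqVneq a 0.
have [m [v [v0 la]]] := lead_exists B (ktswap_neq0 a0).
have e4 : slot3 (in23 alpha) = s \ox 1 + 1 \ox t%:A.
  by rewrite in23_alpha (hom_add_scalar (slot3_hom L)) slot3E -scalar_one_tens.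
move/(congr1 (@slot3 k L)); rewrite (hom_mulB (slot3_hom L)).
rewrite (lin0 (alg_hom_linear (slot3_hom L))) slot3_in12 e4 => e.
have l1 := lead_mul (lead_one B a) (slot3_delta_id la).
have l2 := lead_mul (lead_s_add (t%:A : T2)) (slot3_id_delta la).
rewrite add0m in l1.
have lt : (m < (sigma + m)%MM)%O by rewrite -{1}[m]add0m ltmc_add2l lt0x -mdeg_eq0 mdeg1.
have := leadB (lead_lt l1 lt) l2; rewrite e => /lead_uniq/(_ (lead_zero B _ _)).
rewrite sub0r mul1r => /(congr1 -%R); rewrite oppr0 opprK.
by case/ktens_eq0 => /eqP; rewrite ?(negPf v0) // oner_eq0.
Qed.

Section FormOfA.
Variables (l c : k).
(** The form of [c], with [f = l s + c]. *)
Definition right_action : T2 := 1 \ox s + (l *: (s \ox 1) + c%:A).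
Local Notation gamma := right_action.

Lemma slot2_in12_gamma : slot2 (in12 gamma) = s \ox 1 + 1 \ox (l *: (s \ox 1) + c%:A).
Proof.
rewrite (hom_affine (in12_hom L)) (hom_affine (slot2_hom L)) /in12 !slot2E.
have [rl _ _] := tensr_hom H T2.
by rewrite (hom_add_scalar (tensr_hom H T2)) (linZ rl).
Qed.

Lemma id_delta_gamma : id_delta gamma = in12 gamma + (1 \ox 1) \ox s.
Proof.
rewrite (hom_affine (id_delta_hom L)) (hom_affine (in12_hom L)) id_delta_1s.
by rewrite id_deltaE delta1 ktassocE addrAC.
Qed.

Lemma slot2_s3 : slot2 ((1 \ox 1) \ox s) = 1 \ox ((1 : H) \ox s).
Proof. exact: slot2E. Qed.

(** Let [m] be the leading exponent of the first factor of [a].  In the first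
    factor the left side has leading exponent [m + m], if [m] is not zero, while
    the two terms of exponent [m + sigma] on the right cancel. *)
Lemma trivial_first_factor_of_a a :
  in12 a * delta_id a - in23 alpha * id_delta a =
    swap12 (in12 gamma * delta_id a - in23 a * id_delta gamma) ->
  exists h, a = 1 \ox h.
Proof.
have [-> _|a0] := eqVneq a 0; first by exists 0; rewrite ktens0r.
have [m [w [w0 la]]] := lead_exists B a0.
have [m0|m0] := eqVneq m 0%MM; first by exists w; rewrite m0 in la; apply: lead0E la.
move/(congr1 (@slot1 k L)); rewrite slot1_swap12 (hom_mulB (slot1_hom L)).
rewrite (hom_mulB (slot2_hom L)) id_delta_gamma.
rewrite (linD (alg_hom_linear (slot2_hom L))) slot2_in12_gamma slot2_s3 slot1_in23.
rewrite -addrA -ktensDr => e.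
have l1 := lead_mul (slot1_in12 la) (slot1_delta_id la).
have l2 := lead_mul (lead_one B alpha) (slot1_id_delta la).
have r1 := lead_mul (lead_s_add (l *: (s \ox 1) + c%:A : T2)) (slot2_delta_id la).
have r2 := lead_mul (slot2_in23 la) (lead_s_add (l *: (s \ox 1) + c%:A + 1 \ox s : T2)).
rewrite add0m in l2; rewrite addmC in r1; have := leadB r1 r2; rewrite -e.
rewrite mul1r mulr1 subrr => r0.
have le : ((m + sigma)%MM <= (m + m)%MM)%O by rewrite lemc_add2r sigma_le.
have r := lead_le r0 le.
have lt : (m < (m + m)%MM)%O by rewrite -{1}[m]addm0 ltmc_add2r lt0x.
have := lead_uniq (leadB l1 (lead_lt l2 lt)) r.
by rewrite subr0 mul_ktens mul1r mulr1 => /ktens_eq0[] z; rewrite z eqxx in w0.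
Qed.

(** If the leading exponent of [h] is zero then [h] is a scalar that satisfies a
    quadratic equation.  Otherwise, in the second factor, it occurs only on the
    left, with coefficient [v \ox h - v \ox (s + t)]. *)
Lemma second_factor_of_a h : let a := 1 \ox h in
  in12 a * delta_id a - in23 alpha * id_delta a =
    swap12 (in12 gamma * delta_id a - in23 a * id_delta gamma) ->
  [\/ a = 0, a = t%:A | a = alpha].
Proof.
move=> a; have [h0|h0] := eqVneq h 0; first by move=> _; apply: Or31; rewrite /a h0 ktens0r.
have wl := alg_hom_linear (swap12_hom L).
have ed : delta_id a = (1 \ox 1) \ox h by rewrite delta_idE delta1.
have ea : swap12 (in23 a) = (1 \ox 1) \ox h by rewrite in23E swap12E.
have -> : swap12 (in12 gamma * delta_id a - in23 a * id_delta gamma) =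
    - ((1 \ox 1) \ox (h * s)).
  rewrite (hom_mulB (swap12_hom L)) swap12_delta_id id_delta_gamma (linD wl) swap12E.
  rewrite ea ed swap12_in12 mulrDr opprD addrA mul_ktens mulr1.
  by rewrite !mul_ktens !mulr1 !mul1r subrr sub0r.
have a0 : ktswap a != 0.
  apply: ktswap_neq0; apply/eqP => /ktens_eq0[] /eqP; rewrite ?(negPf h0) //.
  by rewrite oner_eq0.
have [m [v [v0 la]]] := lead_exists B a0.
have [m0|m0] := eqVneq m 0%MM => e.
  rewrite m0 in la; have := lead0E la.
  rewrite ktswapE => /(congr1 (fun u => tcoef B 0%MM (ktswap u))).
  rewrite !ktswapE tcoef_one eqxx tcoefE; set r := coef _ _ _ => eh.
  have ear : a = r%:A by rewrite /a eh -scalar_one_tens.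
  have e3 : (1 \ox 1) \ox (h * s) = r *: ((1 \ox 1) \ox s) :> T3.
    by rewrite eh -scalerAl mul1r -ktensZ scale_ktens.
  move: e; rewrite in23_alpha e3 ear (hom_scalar (id_delta_hom L)).
  rewrite (hom_scalar (delta_id_hom L)) (hom_scalar (in12_hom L)).
  case/scalar_quadratic => [r0|rt].
    by apply: Or31; rewrite r0 scale0r.
  by apply: Or32; rewrite rt.
apply: Or33; move/(congr1 (@slot2 k L)): e.
rewrite (hom_mulB (slot2_hom L)) ed.
have s2d : slot2 ((1 \ox 1) \ox h) = 1 \ox ((1 : H) \ox h) by exact: slot2E.
have s2a : slot2 (in23 alpha) = 1 \ox alpha.
  rewrite in23_alpha (hom_add_scalar (slot2_hom L)) slot2_s3.
  by rewrite [in LHS]scalar_one_tens -ktensDr.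
have s2s : slot2 (- ((1 \ox 1) \ox (h * s))) = - (1 \ox ((1 : H) \ox (h * s))).
  by rewrite (homN (slot2_hom L)) slot2E.
rewrite s2d s2a s2s => e.
have l1 := lead_mul (slot2_in12 la) (lead_one B ((1 : H) \ox h)).
have l2 := lead_mul (lead_one B alpha) (slot2_id_delta la).
have r0 := lead0_gt (leadN (lead_one B ((1 : H) \ox (h * s)))) m0.
rewrite add0m in l2; rewrite addm0 in l1; have := leadB l1 l2; rewrite e.
move=> /lead_uniq/(_ r0); rewrite /virasoro scalar_one_tens -ktensDr.
rewrite !mul_ktens !mulr1 !mul1r => /eqP; rewrite subr_eq0 => /eqP ev.
have : v \ox (h - (s + t%:A)) = 0.
  by apply: (addIr (v \ox (s + t%:A))); rewrite -ktensDr subrK add0r.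
case/ktens_eq0 => [z|/eqP]; first by rewrite z eqxx in v0.
by rewrite subr_eq0 /a => /eqP ->; rewrite ktensDr -scalar_one_tens.
Qed.
End FormOfA.
End CoordinateEquations.

(** * The coordinates of an associator *)

Section CoordinateAssociator.
Variables (k : fieldType) (C A : algType k) (i12 i23 dl dr : C -> A) (w : A -> A).
Hypotheses (i12h : alg_hom i12) (i23h : alg_hom i23).
Hypotheses (dlh : alg_hom dl) (drh : alg_hom dr) (wh : alg_hom w).
Variable S : bool -> bool -> bool -> C.

(** The coefficient at [e l] of the associator of [e i], [e j], [e m] when
    [S i j l] is the coefficient at [e l] of the product of [e i] and [e j]; the
    maps stand for [in12], [in23], [delta_id] and [id_delta].  Working with
    arbitrary homomorphisms of algebras keeps the threefold tensor product out of
    these computations. *)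
Definition coord_associator i j m l : A :=
  i12 (S i j true) * dl (S true m l) + i12 (S i j false) * dl (S false m l)
  - (i23 (S j m true) * dr (S i true l) + i23 (S j m false) * dr (S i false l)).
Local Notation X := coord_associator.

Variable alpha : C.
Hypothesis S11 : forall l, S true true l = 0.
Hypothesis S22 : forall l, S false false l = if l then 0 else alpha.
Local Notation a := (S true false true).
Local Notation b := (S true false false).
Local Notation c := (S false true true).
Local Notation d := (S false true false).

Let zeroE := (lin0 (alg_hom_linear i12h), lin0 (alg_hom_linear i23h),
  lin0 (alg_hom_linear dlh), lin0 (alg_hom_linear drh), lin0 (alg_hom_linear wh),
  mul0r, mulr0, subr0, sub0r, add0r, addr0, oppr0).

Lemma zero_coord_equations :
  i12 0 * dl 0 - i23 alpha * dr 0 = w (i12 0 * dl 0 - i23 0 * dr 0) /\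
  i12 alpha * dl 0 - i23 0 * dr 0 = w (i12 alpha * dl 0 - i23 0 * dr 0).
Proof. by rewrite !zeroE. Qed.

(** The index [true] stands for [e1] and [false] for [e2].  The equations come
    in the order in which they determine [b], [d], [b] again, [c] and [a]. *)
Lemma symmetric_coord_equations :
  (forall i j m l, X i j m l = w (X j i m l)) ->
  [/\ i23 b * dr b = w (i23 b * dr b),
      i12 b * dl d - i23 d * dr b = w (i12 d * dl d) &
      d = 0 ->
      [/\ i12 b * dl c = 0,
          c = 0 -> i12 a * dl b + i12 b * dl alpha - i23 alpha * dr b =
                   - w (i23 b * dr alpha),
          i12 alpha * dl c - i23 c * dr c = w (i12 alpha * dl c - i23 c * dr c) &
          b = 0 -> i12 a * dl a - i23 alpha * dr a = w (i12 c * dl a - i23 a * dr c)]].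
Proof.
move=> sym; split.
- have := sym true true false false; rewrite /X !S11 !zeroE (homN wh).
  exact: oppr_inj.
- by have := sym true false true false; rewrite /X !S11 !zeroE.
move=> d0; split=> [|c0||b0].
- by have := sym true false true true; rewrite /X !S11 d0 !zeroE.
- by have := sym true false false false; rewrite /X !S22 c0 d0 !zeroE (homN wh).
- by have := sym false false true true; rewrite /X !S22 d0 !zeroE.
- by have := sym true false false true; rewrite /X !S22 b0 d0 !zeroE.
Qed.

Hypothesis wK : involutive w.

(** When [b] and [d] vanish, the remaining equations reduce to three, two
    equations exchanged by [w] being equivalent. *)
Lemma coord_equations_symmetric : b = 0 -> d = 0 ->
  i12 alpha * dl alpha - i23 alpha * dr alpha =
    w (i12 alpha * dl alpha - i23 alpha * dr alpha) ->
  i12 a * dl a - i23 alpha * dr a = w (i12 c * dl a - i23 a * dr c) ->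
  i12 alpha * dl c - i23 c * dr c = w (i12 alpha * dl c - i23 c * dr c) ->
  forall i j m l, X i j m l = w (X j i m l).
Proof.
move=> b0 d0 ha hl hr; case=> [] [] [] []; rewrite /X ?S11 ?S22 ?b0 ?d0 !zeroE //.
by rewrite hl wK.
Qed.

End CoordinateAssociator.

(** * From the pre-Lie identity to coordinates *)

Section Associator.
Variables (k : fieldType) (L : lieAlgType k).
Local Notation H := (uea L : algType k).
Local Notation T2 := (ktensor H H).
Local Notation T3 := (ktensor (T2 : algType k) H).
Variables (P : lmodType H) (star : P -> P -> ptensor (@delta k L) P).
Hypothesis star_pseudo : pseudoproduct star.
Local Notation A2 := (ptensor (@delta k L) P).
Local Notation A3 := (ptensor (@delta3 k L) P).
Implicit Types (x y z : P) (f g h : H).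

Definition associator x y z : A3 := starl star (star x y) z - starr star x (star y z).

Definition symmetric_at x y z : Prop :=
  associator x y z = pswap12 (associator y x z).

Lemma starlDl p q z : starl star (p + q) z = starl star p z + starl star q z.
Proof. exact: pliftD (starl_balanced star_pseudo z). Qed.

Lemma starrDr x p q : starr star x (p + q) = starr star x p + starr star x q.
Proof. exact: pliftD (starr_balanced star_pseudo x). Qed.

Lemma starl0 z : starl star 0 z = 0.
Proof. exact: plift0 (starl_balanced star_pseudo z). Qed.

Lemma starr0 x : starr star x 0 = 0.
Proof. exact: plift0 (starr_balanced star_pseudo x). Qed.

Lemma starlDr p z z' : starl star p (z + z') = starl star p z + starl star p z'.
Proof.
elim/ptensor_ind: p => [|p q hp hq|b x]; first by rewrite !starl0 addr0.
  by rewrite !starlDl hp hq addrACA.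
rewrite !(starl_ptens star_pseudo) (pseudoDr star_pseudo).
exact: pliftD (starl_balanced_in _ _).
Qed.

Lemma starrDl x x' p : starr star (x + x') p = starr star x p + starr star x' p.
Proof.
elim/ptensor_ind: p => [|p q hp hq|b y]; first by rewrite !starr0 addr0.
  by rewrite !starrDr hp hq addrACA.
rewrite !(starr_ptens star_pseudo) (pseudoDl star_pseudo).
exact: pliftD (starr_balanced_in _ _).
Qed.

Lemma pswap12D p q : pswap12 (p + q : A3) = pswap12 p + pswap12 q.
Proof. exact: pliftD (pswap12_balanced P). Qed.

Lemma pswap120 : pswap12 (0 : A3) = 0.
Proof. exact: plift0 (pswap12_balanced P). Qed.

Lemma associatorDl x x' y z :
  associator (x + x') y z = associator x y z + associator x' y z.
Proof.
by rewrite /associator (pseudoDl star_pseudo) starlDl starrDl opprD addrACA.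
Qed.

Lemma associatorDm x y y' z :
  associator x (y + y') z = associator x y z + associator x y' z.
Proof.
rewrite /associator (pseudoDl star_pseudo) (pseudoDr star_pseudo) starlDl starrDr.
by rewrite opprD addrACA.
Qed.

Lemma associatorDr x y z z' :
  associator x y (z + z') = associator x y z + associator x y z'.
Proof.
by rewrite /associator (pseudoDr star_pseudo) starlDr starrDr opprD addrACA.
Qed.

Lemma symmetric_atDl x x' y z : symmetric_at x y z -> symmetric_at x' y z ->
  symmetric_at (x + x') y z.
Proof. by move=> h h'; rewrite /symmetric_at associatorDl associatorDm h h' pswap12D. Qed.

Lemma symmetric_atDm x y y' z : symmetric_at x y z -> symmetric_at x y' z ->
  symmetric_at x (y + y') z.
Proof. by move=> h h'; rewrite /symmetric_at associatorDl associatorDm h h' pswap12D. Qed.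

Lemma symmetric_atDr x y z z' : symmetric_at x y z -> symmetric_at x y z' ->
  symmetric_at x y (z + z').
Proof. by move=> h h'; rewrite /symmetric_at !associatorDr h h' pswap12D. Qed.

Lemma pactD (b : T3) (p q : A3) : pact b (p + q) = pact b p + pact b q.
Proof. exact: pliftD (pact_balanced _ _ _). Qed.

Lemma pact0 (b : T3) : pact b (0 : A3) = 0.
Proof. exact: plift0 (pact_balanced _ _ _). Qed.

Lemma pact2D (b : T2) (p q : A2) : pact b (p + q) = pact b p + pact b q.
Proof. exact: pliftD (pact_balanced _ _ _). Qed.

Lemma pact20 (b : T2) : pact b (0 : A2) = 0.
Proof. exact: plift0 (pact_balanced _ _ _). Qed.

Lemma starl_pact h g f p z :
  starl star (pact (h \ox g) p) (f *: z) = pact ((h \ox g) \ox f) (starl star p z).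
Proof.
elim/ptensor_ind: p => [|p q hp hq|b x].
- by rewrite pact20 !starl0 pact0.
- by rewrite pact2D !starlDl hp hq pactD.
rewrite pactE !(starl_ptens star_pseudo).
have := pseudo_bilinear star_pseudo 1 f x z; rewrite scale1r => ->.
elim/ptensor_ind: (star x z) => [|p q hp hq|a c].
- by rewrite pact20 !(plift0 (starl_balanced_in _ _)) pact0.
- by rewrite pact2D !(pliftD _ _ (starl_balanced_in _ _)) hp hq pactD.
- rewrite pactE !(pliftE _ _ (starl_balanced_in _ _)) pactE.
  have [_ _ ->] := delta_id_hom L; rewrite delta_idE delta1 !mulrA; congr (_ * _ \oxH c).
  by rewrite !mul_ktens !mulr1 mul1r.
Qed.

Lemma in23_comm h (b : T2) : in23 b * ((h \ox 1) \ox 1) = ((h \ox 1) \ox 1) * in23 b.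
Proof.
have il := alg_hom_linear (in23_hom L).
elim/ktensor_ind: b => [|u v hu hv|y z].
- by rewrite (lin0 il) mulr0 mul0r.
- by rewrite (linD il) mulrDl mulrDr hu hv.
- by rewrite in23E !mul_ktens !mulr1 !mul1r.
Qed.

Lemma starr_pact h g f x p :
  starr star (h *: x) (pact (g \ox f) p) = pact ((h \ox g) \ox f) (starr star x p).
Proof.
elim/ptensor_ind: p => [|p q hp hq|b y].
- by rewrite pact20 !starr0 pact0.
- by rewrite pact2D !starrDr hp hq pactD.
rewrite pactE !(starr_ptens star_pseudo).
have := pseudo_bilinear star_pseudo h 1 x y; rewrite scale1r => ->.
elim/ptensor_ind: (star x y) => [|p q hp hq|a c].
- by rewrite pact20 !(plift0 (starr_balanced_in _ _)) pact0.
- by rewrite pact2D !(pliftD _ _ (starr_balanced_in _ _)) hp hq pactD.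
- rewrite pactE !(pliftE _ _ (starr_balanced_in _ _)) pactE.
  have [_ _ ->] := id_delta_hom L; rewrite -!/(in23 _).
  have [_ _ ->] := in23_hom L; rewrite id_deltaE delta1 ktassocE !mulrA.
  congr (_ * _ \oxH c); rewrite -mulrA in23_comm mulrA in23E !mul_ktens.
  by rewrite !mulr1 !mul1r.
Qed.

Lemma pswap12_pact h g f p :
  pswap12 (pact ((h \ox g) \ox f) p : A3) = pact ((g \ox h) \ox f) (pswap12 p).
Proof.
elim/ptensor_ind: p => [|p q hp hq|a c].
- by rewrite pact0 pswap120 pact0.
- by rewrite pactD !pswap12D hp hq pactD.
- rewrite pactE !pswap12_ptens pactE; have [_ _ ->] := swap12_hom L.
  by rewrite swap12E.
Qed.

(** The associator is linear over the enveloping algebra in each argument, and the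
    exchange of factors follows the exchange of arguments. *)
Lemma symmetric_atZ h g f x y z : symmetric_at x y z ->
  symmetric_at (h *: x) (g *: y) (f *: z).
Proof.
have pactB b (p q : A3) : pact b (p - q) = pact b p - pact b q.
  by apply/eqP; rewrite eq_sym subr_eq -pactD subrK.
have aZ h' g' x' y' : associator (h' *: x') (g' *: y') (f *: z) =
    pact ((h' \ox g') \ox f) (associator x' y' z).
  rewrite /associator !(pseudo_bilinear star_pseudo) starl_pact starr_pact.
  by rewrite pactB.
by rewrite /symmetric_at !aZ => ->; rewrite pswap12_pact.
Qed.

Variables (e : bool -> P) (co : bool -> P -> H).
Hypothesis coD : forall i x y, co i (x + y) = co i x + co i y.
Hypothesis coZ : forall i h x, co i (h *: x) = h * co i x.
Hypothesis co_sum : forall x, x = co true x *: e true + co false x *: e false.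
Hypothesis co_e : forall i j, co i (e j) = (i == j)%:R.

Lemma symmetric_at_basis :
  (forall i j m, symmetric_at (e i) (e j) (e m)) -> left_preLie star.
Proof.
move=> h x y z; rewrite -/(symmetric_at x y z) (co_sum x) (co_sum y) (co_sum z).
by do ![apply: symmetric_atDl | apply: symmetric_atDm | apply: symmetric_atDr];
  apply: symmetric_atZ.
Qed.

Section Projection.
Variables (T : algType k) (D : H -> T).
Hypothesis D_hom : alg_hom D.
Local Notation A := (ptensor D P).

(** The coefficient at the basis vector [e i]. *)
Definition proj i : A -> T := plift (fun a x => a * D (co i x)).

Lemma proj_balanced i : pbalanced D (fun a x => a * D (co i x)).
Proof.
have [Dl _ DM] := D_hom; split=> [a a' x|a x x'|a h x].
- exact: mulrDl.
- by rewrite coD (linD Dl) mulrDr.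
- by rewrite coZ DM mulrA.
Qed.

Lemma projE i a x : proj i (a \oxH x) = a * D (co i x).
Proof. exact: pliftE (proj_balanced i). Qed.

Lemma projD i p q : proj i (p + q) = proj i p + proj i q.
Proof. exact: pliftD (proj_balanced i). Qed.

Lemma proj0 i : proj i 0 = 0.
Proof. exact: plift0 (proj_balanced i). Qed.

Lemma projB i p q : proj i (p - q) = proj i p - proj i q.
Proof. by apply/eqP; rewrite eq_sym subr_eq -projD subrK. Qed.

Lemma proj_basis i j a : proj i (a \oxH e j) = if i == j then a else 0.
Proof.
have [Dl D1 _] := D_hom; rewrite projE co_e.
by case: eqP => _; rewrite ?D1 ?(lin0 Dl) ?mulr1 ?mulr0.
Qed.

Lemma ptensor_sum p :
  p = proj true p \oxH e true + proj false p \oxH e false.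
Proof.
have pb := ptens_balanced D P.
elim/ptensor_ind: p => [|p q hp hq|a x].
- by rewrite !proj0 !(balanced0l _ pb) addr0.
- by rewrite !projD !(balancedDl pb) addrACA -hp -hq.
- by rewrite {1}(co_sum x) (balancedDr pb) -!(balancedA pb) !projE.
Qed.

Lemma ptensor_eq p q : (forall i, proj i p = proj i q) -> p = q.
Proof. by move=> h; rewrite (ptensor_sum p) !h -ptensor_sum. Qed.

End Projection.

Notation proj2 := (@proj T2 (@delta k L)).
Notation proj3 := (@proj T3 (@delta3 k L)).
Definition structure i j l : T2 := proj2 l (star (e i) (e j)).

Definition associator_coord : bool -> bool -> bool -> bool -> T3 :=
  coord_associator (@in12 k L) (@in23 k L) (@delta_id k L) (@id_delta k L) structure.

Lemma proj_starl l p z :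
  proj3 l (starl star p z) =
    in12 (proj2 true p) * delta_id (proj2 l (star (e true) z)) +
    in12 (proj2 false p) * delta_id (proj2 l (star (e false) z)).
Proof.
have d2 := delta_hom L; have d3 := delta3_hom L.
have pure b q : proj3 l (starl star (b \oxH e q) z) =
    in12 b * delta_id (proj2 l (star (e q) z)).
  rewrite (starl_ptens star_pseudo); have [dl _ dM] := delta_id_hom L.
  elim/ptensor_ind: (star (e q) z) => [|p1 p2 h1 h2|a c].
  - by rewrite (plift0 (starl_balanced_in _ _)) !proj0 // (lin0 dl) mulr0.
  - rewrite (pliftD _ _ (starl_balanced_in _ _)) !projD // h1 h2.
    by rewrite (linD dl) mulrDr.
  - by rewrite (pliftE _ _ (starl_balanced_in _ _)) !projE // dM mulrA.
by rewrite {1}(ptensor_sum d2 p) starlDl projD // !pure.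
Qed.

Lemma proj_starr l x p :
  proj3 l (starr star x p) =
    in23 (proj2 true p) * id_delta (proj2 l (star x (e true))) +
    in23 (proj2 false p) * id_delta (proj2 l (star x (e false))).
Proof.
have d2 := delta_hom L; have d3 := delta3_hom L.
have pure b q : proj3 l (starr star x (b \oxH e q)) =
    in23 b * id_delta (proj2 l (star x (e q))).
  rewrite (starr_ptens star_pseudo); have [dl _ dM] := id_delta_hom L.
  elim/ptensor_ind: (star x (e q)) => [|p1 p2 h1 h2|a c].
  - by rewrite (plift0 (starr_balanced_in _ _)) !proj0 // (lin0 dl) mulr0.
  - rewrite (pliftD _ _ (starr_balanced_in _ _)) !projD // h1 h2.
    by rewrite (linD dl) mulrDr.
  - by rewrite (pliftE _ _ (starr_balanced_in _ _)) !projE // dM delta_coassoc mulrA.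
by rewrite {1}(ptensor_sum d2 p) starrDr projD // !pure.
Qed.

Lemma proj_pswap12 l (p : A3) : proj3 l (pswap12 p) = swap12 (proj3 l p).
Proof.
have d3 := delta3_hom L; have [sl _ sM] := swap12_hom L.
elim/ptensor_ind: p => [|p q hp hq|a c].
- by rewrite pswap120 !proj0 // (lin0 sl).
- by rewrite pswap12D !projD // hp hq (linD sl).
- by rewrite pswap12_ptens !projE // sM swap12_delta3.
Qed.

Lemma proj_associator i j m l :
  proj3 l (associator (e i) (e j) (e m)) = associator_coord i j m l.
Proof. by rewrite projB ?proj_starl ?proj_starr //; exact: delta3_hom. Qed.

Lemma left_preLie_coord : left_preLie star <->
  forall i j m l, associator_coord i j m l = swap12 (associator_coord j i m l).
Proof.
have d3 := delta3_hom L; split=> [h i j m l|h].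
  by rewrite -!proj_associator -proj_pswap12; congr (proj _); exact: h.
apply: symmetric_at_basis => i j m; apply: (ptensor_eq d3) => l.
by rewrite proj_pswap12 !proj_associator.
Qed.

End Associator.

(** * Adapted bases *)

(** Listed last, [s] is the smallest generator for the monomial order. *)
Lemma lie_basis_last (k : fieldType) (L : finLieAlgType k) (s : L) : s != 0 ->
  exists (n : nat) (B : lie_basis L n.+1), bvec B ord_max = s.
Proof.
move=> s0; pose C := (<[s]>^C)%VS; pose X := [tuple of rcons (vbasis C) s].
have sX : basis_of fullv X.
  have sb : basis_of <[s]>%VS [:: s].
    by rewrite basisEfree span_seq1 subvv dim_vline s0 seq1_free s0.
  have dC : directv (C + <[s]>) by apply/directv_addP; rewrite capvC capv_compl.
  have := cat_basis dC (vbasisP C) sb; have -> : (C + <[s]>)%VS = fullv.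
    by rewrite addvC addv_complf.
  by rewrite cats1.
have fX := basis_free sX; exists (\dim C).
unshelve eexists.
  refine (@LieBasis k L _ (fun i => X`_i) (fun y i => coord X i y) _ _ _).
  - by move=> i c y z; rewrite linearP.
  - by move=> y; rewrite -(coord_basis sX) // memvf.
  - by move=> i j; rewrite coord_free.
rewrite /= nth_rcons size_tuple ltnn eqxx //.
Qed.

Section ModuleBasis.
Variables (R : pzRingType) (M : lmodType R) (e1 e2 : M).

Lemma module_basis2_coord : module_basis2 e1 e2 ->
  exists co : bool -> M -> R,
    [/\ forall i x y, co i (x + y) = co i x + co i y,
        forall i a x, co i (a *: x) = a * co i x,
        forall x, x = co true x *: e1 + co false x *: e2 &
        forall i j, co i (if j then e1 else e2) = (i == j)%:R].
Proof.
case=> g fK gK.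
have gE a b : g (a *: e1 + b *: e2) = (a, b) by rewrite (fK (a, b)).
have gsum x : x = (g x).1 *: e1 + (g x).2 *: e2 by rewrite gK.
exists (fun i x => if i then (g x).1 else (g x).2); split=> //.
- move=> i x y; rewrite {1 2}(gsum x) {1 2}(gsum y) addrACA -!scalerDl gE.
  by case: i.
- by move=> i a x; rewrite {1 2}(gsum x) scalerDr !scalerA gE; case: i.
- case; case.
  + by have := gE 1 0; rewrite scale1r scale0r addr0 => ->.
  + by have := gE 0 1; rewrite scale1r scale0r add0r => ->.
  + by have := gE 1 0; rewrite scale1r scale0r addr0 => ->.
  + by have := gE 0 1; rewrite scale1r scale0r add0r => ->.
Qed.

End ModuleBasis.

(** * The solutions satisfy the equations *)

Lemma scalar_comm (k : fieldType) (A : algType k) (c : k) (p : A) :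
  GRing.comm p c%:A.
Proof. by rewrite /GRing.comm mulr_algl mulr_algr. Qed.

Lemma zmod_collect (G : zmodType) (u r w u' v q : G) :
  u + r - (w + (u - u') - (v + q)) = r - w + (u' + v) + q.
Proof.
rewrite opprB opprD opprB -!addrA addrC !addrA subrK.
by rewrite [LHS](ACl (1*4*5*2*3)).
Qed.

Lemma zmod_exchange (G : zmodType) (y y' x c z : G) :
  y + (x + c) + z = z + (x + y' + c) + (y - y').
Proof. by rewrite !addrA [RHS](ACl (3*6*5*2*4*1)) /= subrr add0r. Qed.

(** For [x], [y], [z] the three copies of [s].  Expanded, both sides are the same
    polynomial, symmetric in [x] and [y]. *)
Lemma commuting_identity (k : fieldType) (A : algType k) (x y z : A) (l t : k) :
  x * y = y * x -> x * z = z * x -> y * z = z * y ->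
  (y + t%:A) * z - (z - l *: x) * (z + (y - l *: y)) =
  (x + t%:A) * z - (z - l *: y) * (z + (x - l *: x)).
Proof.
have form (p q : A) : p * z = z * p -> q * z = z * q ->
    (q + t%:A) * z - (z - l *: p) * (z + (q - l *: q)) =
    t *: z - z * z + (l *: (z * q) + l *: (z * p)) + (l *: (p * q) - l *: (l *: (p * q))).
  move=> pz qz; rewrite mulrDl mulr_algl mulrBl !mulrDr !mulrN.
  by rewrite -!scalerAl -!scalerAr pz qz zmod_collect.
by move=> xy xz yz; rewrite !form // xy [l *: (z * y) + _]addrC.
Qed.

(** The equation for [c], written in terms of the three copies [x], [y], [z] of [s].
    The factors [q] and [r] differ from [d] by multiples of [x] and [y], which
    reduces it to [commuting_identity] with [d] in the place of [z]. *)
Lemma symmetric_of_commuting (k : fieldType) (A : algType k) (w : A -> A)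
    (x y z : A) (l c t : k) (p q r d : A) : alg_hom w -> w x = y -> w y = x -> w z = z ->
  x * y = y * x -> x * z = z * x -> y * z = z * y ->
  p = y + t%:A -> d = z + (l *: (x + y) + c%:A) ->
  q = z + (l *: y + c%:A) -> r = y + (l *: x + c%:A) + z ->
  p * d - q * r = w (p * d - q * r).
Proof.
move=> wh wx wy wz xy xz yz -> ed -> ->.
have wl := alg_hom_linear wh.
have -> : z + (l *: y + c%:A) = d - l *: x.
  rewrite ed scalerDr -(addrA (l *: x)) [l *: x + (_ + _)]addrC.
  by rewrite [X in _ = X - _]addrA addrK.
have -> : y + (l *: x + c%:A) + z = d + (y - l *: y).
  by rewrite ed scalerDr; exact: zmod_exchange.
have wd : w d = d by rewrite ed hom_affine // wz (linD wl) wx wy [y + x]addrC.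
have comm u : u * z = z * u -> u * (x + y) = (x + y) * u -> u * d = d * u.
  move=> uz ux; rewrite ed; apply: commrD => //.
  apply: commrD; last exact: scalar_comm.
  by rewrite /GRing.comm -scalerAr -scalerAl ux.
rewrite (hom_mulB wh) !(homB wh, linD wl, linZ wl) (alg_hom1 wh) wx wy wd.
apply: commuting_identity => //; apply: comm => //; by rewrite mulrDr mulrDl xy.
Qed.

Lemma scalar_action_identity (k : fieldType) (A : algType k) (g z : A) (t : k) :
  t%:A * t%:A - (z + t%:A) * t%:A = g * t%:A - t%:A * (g + z).
Proof.
rewrite mulrDl mulrDr !mulr_algr !mulr_algl !opprD !addrA.
by rewrite addrAC subrr sub0r [X in _ = X - _]subrr sub0r.
Qed.

(** Both sides are [- (z + t%:A) * z]. *)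
Lemma affine_action_identity (k : fieldType) (A : algType k) (g y z : A) (t : k) :
  g * z = z * g -> y * z = z * y ->
  (y + t%:A) * (z + t%:A) - (z + t%:A) * (y + z + t%:A) =
  g * (z + t%:A) - (z + t%:A) * (g + z).
Proof.
move=> gz yz; rewrite -(addrA y); set u := z + t%:A.
have cu (p : A) : p * z = z * p -> p * u = u * p.
  by move=> pz; apply: commrD pz _; exact: scalar_comm.
have yu : (y + t%:A) * u = u * (y + t%:A).
  apply: cu; apply/commr_sym/commrD; [exact/commr_sym|exact: scalar_comm].
rewrite (cu _ gz) yu -!mulrBr; congr (_ * _).
have subDr (p q : A) : p - (p + q) = - q by rewrite opprD addrA subrr sub0r.
by rewrite /u [z + _]addrC addrA !subDr.
Qed.

Lemma affine_action_symmetric (k : fieldType) (A : algType k) (w : A -> A)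
    (y z : A) (t : k) : alg_hom w -> w z = z -> y * z = z * y -> w y * z = z * w y ->
  (y + t%:A) * (z + t%:A) - (z + t%:A) * (y + z + t%:A) =
  w ((y + t%:A) * (z + t%:A) - (z + t%:A) * (y + z + t%:A)).
Proof.
move=> wh wz yz wyz; rewrite (hom_mulB wh) !(hom_add_scalar wh).
rewrite (linD (alg_hom_linear wh)) wz.
by rewrite !(@affine_action_identity _ _ 0) // mul0r mulr0.
Qed.

Section Sufficiency.
Variables (k : fieldType) (L : lieAlgType k) (n : nat) (B : lie_basis L n.+1).
Variables (t l c : k).
Local Notation H := (uea L : algType k).
Local Notation T2 := (ktensor H H).
Local Notation T3 := (ktensor (T2 : algType k) H).
Local Notation s := (uea_in (bvec B ord_max)).
Local Notation alpha := (virasoro B t).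
Local Notation gamma := (right_action B l c).
Local Notation s3 := ((1 \ox 1) \ox s : T3).

Lemma zero_action_identity (a : T2) :
  swap12 (in12 0 * delta_id a - in23 a * id_delta 0) = 0.
Proof.
rewrite (lin0 (alg_hom_linear (in12_hom L))) (lin0 (alg_hom_linear (id_delta_hom L))).
by rewrite mul0r mulr0 subr0 (lin0 (alg_hom_linear (swap12_hom L))).
Qed.

Lemma right_action_identity :
  in12 alpha * delta_id gamma - in23 gamma * id_delta gamma =
  swap12 (in12 alpha * delta_id gamma - in23 gamma * id_delta gamma).
Proof.
pose x : T3 := in12 (s \ox 1); pose y : T3 := in12 (1 \ox s).
have swx : swap12 x = y by rewrite swap12_in12 ktswapE.
have swy : swap12 y = x by rewrite swap12_in12 ktswapE.
have swz : swap12 s3 = s3 by rewrite swap12E.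
have xy : x * y = y * x by rewrite !mul_ktens !mulr1 !mul1r.
have ep : in12 alpha = y + t%:A by exact: in12_alpha.
have ed : delta_id gamma = s3 + (l *: (x + y) + c%:A).
  rewrite (hom_affine (delta_id_hom L)) !delta_idE delta1 deltaE ktensDl.
  by [].
have eq : in23 gamma = s3 + (l *: y + c%:A).
  by rewrite (hom_affine (in23_hom L)) !in23E.
have er : id_delta gamma = y + (l *: x + c%:A) + s3.
  by rewrite id_delta_gamma (hom_affine (in12_hom L)).
exact: (symmetric_of_commuting (swap12_hom L) swx swy swz xy
  (in12_s3 B (s \ox 1)) (in12_s3 B (1 \ox s)) ep ed eq er).
Qed.

Lemma left_action_identity (a : ktensor H H) :
  [\/ a = 0, a = t%:A | a = alpha] ->
  in12 a * delta_id a - in23 alpha * id_delta a =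
  swap12 (in12 gamma * delta_id a - in23 a * id_delta gamma).
Proof.
have [wl _ wM] := swap12_hom L.
have [dl _ _] := delta_id_hom L; have [il _ _] := id_delta_hom L.
have [jl _ _] := in12_hom L; have [el _ _] := in23_hom L.
pose g := swap12 (in12 gamma).
have gz : g * s3 = s3 * g by rewrite /g swap12_in12 in12_s3.
have sgz : swap12 (id_delta gamma) = g + s3.
  by rewrite id_delta_gamma (linD (alg_hom_linear (swap12_hom L))) swap12E.
rewrite (hom_mulB (swap12_hom L)) swap12_delta_id sgz -/g.
case=> ->.
- by rewrite (lin0 jl) (lin0 dl) (lin0 il) (lin0 el) (lin0 wl) !mulr0 !mul0r.
- rewrite (hom_scalar (in12_hom L)) (hom_scalar (delta_id_hom L)).
  rewrite (hom_scalar (id_delta_hom L)) (hom_scalar (in23_hom L)).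
  rewrite (hom_scalar (swap12_hom L)) in23_alpha.
  exact: scalar_action_identity.
rewrite in23_alpha (hom_add_scalar (swap12_hom L)) swap12E in12_alpha.
rewrite delta_id_alpha id_delta_alpha; apply: affine_action_identity gz _.
exact: in12_s3.
Qed.

Lemma virasoro_identity :
  in12 alpha * delta_id alpha - in23 alpha * id_delta alpha =
  swap12 (in12 alpha * delta_id alpha - in23 alpha * id_delta alpha).
Proof.
rewrite in12_alpha in23_alpha delta_id_alpha id_delta_alpha.
apply: affine_action_symmetric (swap12_hom L) _ (in12_s3 B _) _.
  by rewrite swap12E.
by rewrite swap12_in12 in12_s3.
Qed.

End Sufficiency.

(** * The classification *)

Section Classification.
Variables (k : fieldType) (char0 : [pchar k] =i pred0).
Variables (L : lieAlgType k) (n : nat) (B : lie_basis L n.+1).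
Local Notation H := (uea L : algType k).
Local Notation T2 := (ktensor H H).
Local Notation s := (uea_in (bvec B ord_max)).
Variables (P : lmodType H) (star : P -> P -> ptensor (@delta k L) P).
Hypothesis star_pseudo : pseudoproduct star.
Variables (e : bool -> P) (co : bool -> P -> H).
Hypothesis coD : forall i x y, co i (x + y) = co i x + co i y.
Hypothesis coZ : forall i h x, co i (h *: x) = h * co i x.
Hypothesis co_sum : forall x, x = co true x *: e true + co false x *: e false.
Hypothesis co_e : forall i j, co i (e j) = (i == j)%:R.
Variable t : k.
Local Notation alpha := (virasoro B t).
Hypothesis star11 : star (e true) (e true) = 0.
Hypothesis star22 : star (e false) (e false) = alpha \oxH e false.
Local Notation S := (structure star e co).
Local Notation X := (associator_coord star e co).

Lemma structure11 l : S true true l = 0.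
Proof. by rewrite /structure star11 proj0 //; exact: delta_hom. Qed.

Lemma structure22 l : S false false l = if l then 0 else alpha.
Proof. by rewrite /structure star22 proj_basis //; [case: l|exact: delta_hom]. Qed.

Lemma structure_forward :
  (forall i j m l, X i j m l = swap12 (X j i m l)) ->
  [/\ S true false false = 0, S false true false = 0 &
      (S true false true = 0 /\ S false true true = 0) \/
      exists l c, S false true true = right_action B l c /\
        [\/ S true false true = 0, S true false true = t%:A | S true false true = alpha]].
Proof.
case/(symmetric_coord_equations (in12_hom L) (in23_hom L) (delta_id_hom L)
  (id_delta_hom L) (swap12_hom L) structure11 structure22).
move: (S true false true) (S true false false) (S false true true) (S false true false).
move=> a b c d Qb Qd Q.
have [f eb] := trivial_second_factor_of_b B Qb.
have d0 : d = 0 by apply: (vanish_d B (f := f)); rewrite -eb.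
have {Q}[Qc Qf Qr Ql] := Q d0.
have b0 : b = 0.
  have [fz|cz] : f = 0 \/ c = 0 by apply: (vanish_b_or_c B); rewrite -eb.
    by rewrite eb fz ktens0l.
  rewrite eb; suff -> : f = 0 by rewrite ktens0l.
  by apply: (vanish_f (B := B) (t := t) (a := a)); rewrite -eb; apply: Qf.
split=> //; have {}Ql := Ql b0; have [c0|[f2 ec]] := second_factor_of_c Qr.
  left; split=> //; apply: (vanish_a (B := B) (t := t)).
  rewrite Ql c0; exact: zero_action_identity.
right; have [l [c' ef]] : exists l c', f2 = l *: s + c'%:A.
  apply: (affine_equation char0); apply: (first_factor_of_c (t := t)).
  by rewrite -ec.
have ecg : c = right_action B l c'.
  rewrite ec ef /right_action addrC ktensDl -scale_ktens.
  by rewrite -[c'%:A \ox 1]scale_ktens.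
exists l, c'; split=> //; rewrite ecg in Ql.
have [h ea] := trivial_first_factor_of_a Ql.
by rewrite ea in Ql *; exact: second_factor_of_a Ql.
Qed.

End Classification.

Theorem theorem3p9
  (k : closedFieldType) (char0 : [pchar k] =i pred0)
  (L : finLieAlgType k)
  (P : lmodType (uea L)) (e1 e2 : P) (basis_e : module_basis2 e1 e2)
  (star : P -> P -> ptensor (@delta k L) P) (star_pseudo : pseudoproduct star)
  (s : L) (t : k) (s_neq0 : s != 0)
  (star11 : star e1 e1 = 0)
  (star22 : star e2 e2 =
     ((1 : uea L) \ox uea_in s + t%:A) \oxH e2) :
  left_preLie star <->
  (star e1 e2 = 0 /\ star e2 e1 = 0) \/
  (exists (alpha : ktensor (uea L) (uea L)) (c l : k),
     [/\ [\/ alpha = 0, alpha = t%:A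
           | alpha = (1 : uea L) \ox uea_in s + t%:A],
         star e1 e2 = alpha \oxH e1
       & star e2 e1 =
           ((1 : uea L) \ox uea_in s + l *: (uea_in s \ox (1 : uea L)) + c%:A)
             \oxH e1]).
Proof.
have [n [B es]] := lie_basis_last s_neq0; subst s.
have [co [coD coZ co_sum co_e]] := module_basis2_coord basis_e.
pose e (i : bool) := if i then e1 else e2.
have d_hom := delta_hom L.
have pb := ptens_balanced (@delta k L) P.
rewrite (left_preLie_coord (e := e) star_pseudo coD coZ co_sum).
split=> [sym|h].
  have [b0 d0 h] := structure_forward char0 coD coZ co_e star11 star22 sym.
  have expand i j : star (e i) (e j) = structure star e co i j true \oxH e1
      + structure star e co i j false \oxH e2.
    exact: (ptensor_sum (e := e) coD coZ co_sum d_hom).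
  have st12 := expand true false; have st21 := expand false true.
  rewrite b0 (balanced0l _ pb) addr0 in st12; rewrite d0 (balanced0l _ pb) addr0 in st21.
  case: h => [[a0 c0]|[l [c [ec ea]]]].
    by left; rewrite a0 (balanced0l _ pb) in st12; rewrite c0 (balanced0l _ pb) in st21.
  right; exists (structure star e co true false true), c, l; split=> //.
  by rewrite ec /right_action addrA in st21.
have pe a l : @proj k L P co _ (@delta k L) l (a \oxH e1) = if l then a else 0.
  by have := proj_basis (e := e) coD coZ co_e d_hom l true a; case: l.
have S11 l : structure star e co true true l = 0 by exact: structure11.
have S22 l : structure star e co false false l = if l then 0 else virasoro B t.
  exact: (structure22 (e := e) coD coZ co_e star22).
have sufficient := coord_equations_symmetric (in12_hom L) (in23_hom L)
  (delta_id_hom L) (id_delta_hom L) (swap12_hom L) S11 S22 (@swap12K k L).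
case: h => [[z12 z21]|[a [c [l [ha h12 h21]]]]].
  have S12 i : structure star e co true false i = 0 by rewrite /structure z12 proj0.
  have S21 i : structure star e co false true i = 0 by rewrite /structure z21 proj0.
  have [zl zr] := zero_coord_equations (@in23 k L) (in12_hom L) (delta_id_hom L)
    (id_delta_hom L) (swap12_hom L) (virasoro B t).
  apply: sufficient; rewrite ?S12 ?S21 //; exact: virasoro_identity.
have S12 i : structure star e co true false i = if i then a else 0.
  by rewrite /structure h12 pe.
have S21 i : structure star e co false true i = if i then right_action B l c else 0.
  by rewrite /structure h21 pe /right_action addrA.
apply: sufficient; rewrite ?S12 ?S21 //.
- exact: virasoro_identity.
- exact: left_action_identity.
- exact: right_action_identity.
Qed.
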